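(* Let $n\ge1$, $q\in(0,1)$, $a=(a_1,\dots,a_n)\in\mathbb R_{>0}^n$, and let $Z=(Z(t),t\ge0)$ be the continuous-time Markov process on $\mathcal W_0^n$ with transition rate matrix $\{Q_n^q(z,z'):z,z'\in\mathcal W_0^n\}$, started from the origin. Assume hypothesis (C): for every $n\ge 1$ and every $z\in\mathcal W_0^n$, the Laurent polynomial $\mathcal P^{(n)}_z(\cdot;q)$ coincides with the $q$-deformed $\mathfrak{so}_{2n+1}$-Whittaker function $P^{(n)}_z(\cdot;q)$. Then, for every $t\ge0$, $Z(t)$ has law $p^{(n)}_t(\cdot;a,q)$.
   Context: **Notation.** $\mathcal W_0^n=\Lambda_n=\{z\in\mathbb Z^n:z_1\ge\dots\ge z_n\ge0\}$, $|z|=\sum z_i$, $e_i$ standard basis; $\nu\preceq\mu$ iff $\mu_1\ge\nu_1\ge\mu_2\ge\cdots$; $(x;q)_m=\prod_{k=0}^{m-1}(1-xq^k)$, $(x;q)_\infty=\prod_{k\ge0}(1-xq^k)$, $(x_1,\dots,x_r;q)_\infty=\prod_j(x_j;q)_\infty$, $\binom mk_q=\frac{(q;q)_m}{(q;q)_k(q;q)_{m-k}}$. **$\mathcal P^{(n)}$.** $\mathcal P^{(1)}_{z}(a_1;q)=\sum_{m=0}^z\binom zm_qa_1^{2m-z}$ and for $n\ge2$, $\mathcal P^{(n)}_\lambda(a_1,\dots,a_n;q)=\sum_{\nu\in\Lambda_{n-1}}Q^{(n-1,n)}_{a_n,q}(\nu,\lambda)\mathcal P^{(n-1)}_\nu(a_1,\dots,a_{n-1};q)$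 with $$Q^{(n-1,n)}_{a_n,q}(\nu,\lambda)=\sum_{\mu\in\Lambda_n:\nu\preceq\mu\preceq\lambda}a_n^{2|\mu|-|\nu|-|\lambda|}\prod_{i=1}^{n-1}\binom{\lambda_i-\lambda_{i+1}}{\lambda_i-\mu_i}_q\binom{\mu_i-\mu_{i+1}}{\mu_i-\nu_i}_q\binom{\lambda_n}{\lambda_n-\mu_n}_q.$$ **$q$-deformed $\mathfrak{so}_{2n+1}$-Whittaker functions.** $P^{(n)}_\lambda(\cdot;q)$, $\lambda\in\Lambda_n$, is the unique Laurent polynomial, invariant under permutations and inversions of its $n$ variables, with coefficients rational in $q$, such that $P_\lambda^{(n)}=m_\lambda+\sum_{\mu\in\Lambda_n,\mu<\lambda}c_{\lambda,\mu}m_\mu$, where $m_\lambda(a)=\sum_{\mu\in W_n\lambda}\prod_ja_j^{\mu_j}$ ($W_n\lambda$ the orbit under signed permutations) and $<$ is the dominance order ($\mu\le\lambda$ iff $\mu_1+\dots+\mu_i\le\lambda_1+\dots+\lambda_i$ for all $i$), and which are orthogonal for $$\langle f,g\rangle_{\hat\Delta^{(n)}}=\frac1{(2\pi\mathrm i)^nn!}\int_{\mathbb T^n}f(b)\overline{g(b)}\hat\Delta^{(n)}(b)\prod_{j=1}^n\frac{db_j}{b_j},$$ $\mathbb T^n=\{|b_j|=1\}$, $\hat\Delta^{(n)}(b)=\prod_j(b_j^2,b_j^{-2};q)_\infty\prod_{j<k}(b_jb_k,b_j^{-1}b_k,b_jb_k^{-1},b_j^{-1}b_k^{-1};q)_\infty$.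 **Rates.** For $z'=z\pm e_i\in\mathcal W_0^n$, $Q_n^q(z,z')=\frac{\mathcal P^{(n)}_{z'}(a;q)}{\mathcal P^{(n)}_z(a;q)}f_n(z,z')$ with $f_n(z,z+e_i)=1-q^{z_{i-1}-z_i}$, $f_n(z,z-e_i)=1-q^{z_i-z_{i+1}}$ ($z_0=+\infty$, $z_{n+1}=0$); $Q_n^q(z,z)=-\sum_i(a_i+a_i^{-1})$; other entries $0$. **$p_t^{(n)}$.** With $\Pi(a;t)=e^{\sum_{i=1}^n(a_i+a_i^{-1})t}$ and $Q^{(n)}_z(t;q)=\frac{\langle\Pi(\cdot;t),\mathcal P_z^{(n)}(\cdot;q)\rangle_{\hat\Delta^{(n)}}}{\langle\mathcal P_z^{(n)}(\cdot;q),\mathcal P_z^{(n)}(\cdot;q)\rangle_{\hat\Delta^{(n)}}}$, $$p_t^{(n)}(z;a,q)=\frac{\mathcal P_z^{(n)}(a;q)\,Q_z^{(n)}(t;q)}{\Pi(a;t)},\qquad z\in\mathcal W_0^n.$$ *)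

(* Defs.v *)
From HB Require Import structures.
From mathcomp Require Import all_boot all_order all_algebra all_fingroup.
From mathcomp Require Import complex.
From mathcomp Require Import all_classical all_reals all_analysis.

Set Implicit Arguments.
Unset Strict Implicit.
Unset Printing Implicit Defensive.
Import Order.TTheory GRing.Theory Num.Theory.
Import numFieldNormedType.Exports.
Local Open Scope classical_set_scope.
Local Open Scope ring_scope.

(* Indices are 0-based throughout: the i-th coordinate here is the
   (i+1)-st of the usual notation. *)

(* Coordinates are extended by 0 past the end, i.e. z_{n+1} = 0. *)
Definition part (n : nat) (z : 'rV[int]_n) (i : nat) : int :=
  if insub i is Some j then z ord0 j else 0.

(* For the last index the condition reads z_n >= z_{n+1} = 0. *)
Definition dominant (n : nat) : pred 'rV[int]_n :=
  fun z => [forall i : 'I_n, part z i.+1 <= part z i].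

Definition cone (n : nat) := {z : 'rV[int]_n | dominant z}.

Definition wsize (n : nat) (z : 'rV[int]_n) : int := \sum_(i < n) z ord0 i.

(* Used for m = n and m = n.-1; for dominant vectors the inequalities that
   involve the extension by 0 hold automatically. *)
Definition interlace (m n : nat) (nu : 'rV[int]_m) (mu : 'rV[int]_n) : Prop :=
  forall i : nat, part mu i.+1 <= part nu i /\ part nu i <= part mu i.

Definition dom_le (n : nat) (mu la : 'rV[int]_n) : Prop :=
  forall k : 'I_n, \sum_(i < n | (i <= k)%N) mu ord0 i
                <= \sum_(i < n | (i <= k)%N) la ord0 i.

Definition dom_lt (n : nat) (mu la : 'rV[int]_n) : Prop :=
  dom_le mu la /\ mu <> la.

Lemma dominant0 (n : nat) : dominant (0 : 'rV[int]_n).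
Proof.
by apply/forallP => i; rewrite /part; do 2!case: insubP => *; rewrite ?mxE.
Qed.

Definition origin (n : nat) : cone n := exist _ 0 (dominant0 n).

Section Branching.
Variables (F : fieldType) (q : F).

Definition qpoch (x : F) (m : nat) : F := \prod_(k < m) (1 - x * q ^+ k).

Definition qbinom (m k : nat) : F :=
  qpoch q m / (qpoch q k * qpoch q (m - k)).

(* q-binomial with integer arguments; they are nonnegative wherever it is
   used below. *)
Definition qbinomz (m k : int) : F := qbinom `|m|%N `|k|%N.

(* The kernel Q^{(n,n+1)}_{x,q}(nu, la). *)
Definition branch (n : nat) (x : F) (nu : 'rV[int]_n) (la : 'rV[int]_n.+1)
    : F :=
  \sum_(mu \in [set mu : 'rV[int]_n.+1 |
                 [/\ dominant mu, interlace nu mu & interlace mu la]])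
    x ^ (2 * wsize mu - wsize nu - wsize la)
    * (\prod_(i < n) (qbinomz (part la i - part la i.+1) (part la i - part mu i)
                    * qbinomz (part mu i - part mu i.+1) (part mu i - part nu i)))
    * qbinomz (part la n) (part la n - part mu n).

(* The case n = 0 is a dummy value; n = 1 is the base of the recursion. *)
Fixpoint calP (n : nat) : 'rV[int]_n -> 'rV[F]_n -> F :=
  match n return 'rV[int]_n -> 'rV[F]_n -> F with
  | 0 => fun _ _ => 1
  | n'.+1 => fun la a =>
      if n' is 0 then
        \sum_(m < (`|part la 0|%N).+1)
          qbinom `|part la 0|%N m * a ord0 ord_max ^ (2 * (m%:Z) - part la 0)
      else
        \sum_(nu \in [set nu : 'rV[int]_n' | dominant nu])
          branch (a ord0 ord_max) nu la
          * calP nu (\row_(i < n') a ord0 (widen_ord (leqnSn n') i))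
  end.

End Branching.

Definition signed_orbit (n : nat) (la : 'rV[int]_n) : set 'rV[int]_n :=
  [set mu | exists (s : 'S_n) (e : 'I_n -> bool),
     mu = \row_j ((-1) ^+ e j * la ord0 (s j))].

Definition msym (F : fieldType) (n : nat) (la : 'rV[int]_n) (b : 'rV[F]_n)
    : F :=
  \sum_(mu \in signed_orbit la) \prod_(j < n) b ord0 j ^ mu ord0 j.

Section Torus.
Variable R : realType.
Local Notation C := R[i].

Definition toC (x : R) : C := (x%:C)%C.

Definition cexp (z : C) : C :=
  toC (expR (complex.Re z)) * (cos (complex.Im z) +i* sin (complex.Im z))%C.

Definition qpochoo (q : R) (x : C) : C :=
  lim ((fun m => qpoch (toC q) x m : C^o) @ \oo).

(* Integral over [0, 2 pi]^n as an iterated Lebesgue integral (there is no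
   Lebesgue measure on R^n in the library); it is only applied to continuous
   integrands. *)
Fixpoint box_integral (n : nat) : ('rV[R]_n -> R) -> R :=
  match n return ('rV[R]_n -> R) -> R with
  | 0 => fun f => f 0
  | n'.+1 => fun f =>
      Rintegral lebesgue_measure `[0, 2 * pi]
        (fun x : R => box_integral
           (fun v : 'rV[R]_n' => f (row_mx (x%:M : 'rV[R]_1) v)))
  end.

Definition circle (n : nat) (th : 'rV[R]_n) : 'rV[C]_n :=
  \row_j (cos (th ord0 j) +i* sin (th ord0 j))%C.

(* The integral over the torus of f(b) prod_j db_j / (2 pi i b_j): along
   b_j = exp(i th_j) one has db_j / b_j = i dth_j. *)
Definition torus_integral (n : nat) (f : 'rV[C]_n -> C) : C :=
  toC ((2 * pi) ^- n)
  * (box_integral (fun th => complex.Re (f (circle th)))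
     +i* box_integral (fun th => complex.Im (f (circle th))))%C.

Definition density (n : nat) (q : R) (b : 'rV[C]_n) : C :=
  let x j := b ord0 j in
  (\prod_(j < n) (qpochoo q (x j ^+ 2) * qpochoo q (x j ^- 2)))
  * (\prod_(j < n) \prod_(k < n | (j < k)%N)
       (qpochoo q (x j * x k) * qpochoo q ((x j)^-1 * x k)
      * qpochoo q (x j * (x k)^-1) * qpochoo q ((x j)^-1 * (x k)^-1))).

Definition inner (n : nat) (q : R) (f g : 'rV[C]_n -> C) : C :=
  (n`!%:R)^-1 * torus_integral (fun b => f b * Num.conj (g b) * density q b).

(* [c la mu q] is the coefficient of the orbit sum of mu in the expansion of
   P_la(.;q).  A linear combination of orbit sums is automatically a Laurent
   polynomial invariant under permutations and inversions of the variables. *)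
Definition triangular (n : nat) (c : 'rV[int]_n -> 'rV[int]_n -> R -> R)
    (q : R) (la : 'rV[int]_n) (b : 'rV[C]_n) : C :=
  msym la b
  + \sum_(mu \in [set mu | dominant mu /\ dom_lt mu la])
      toC (c la mu q) * msym mu b.

Definition rational_in_q (c : R -> R) : Prop :=
  exists num den : {poly R}, forall q : R, 0 < q -> q < 1 ->
    den.[q] != 0 /\ c q = num.[q] / den.[q].

(* The coefficients c describe the q-deformed so_{2n+1}-Whittaker functions,
   for all q in (0,1) at once.  Orthogonality determines them uniquely. *)
Definition whittaker_coefs (n : nat)
    (c : 'rV[int]_n -> 'rV[int]_n -> R -> R) : Prop :=
  (forall la mu, dominant la -> dominant mu -> dom_lt mu la ->
     rational_in_q (c la mu))
  /\ (forall q : R, 0 < q -> q < 1 ->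
      forall la la', dominant la -> dominant la' -> la <> la' ->
        inner q (triangular c q la) (triangular c q la') = 0).

(* Laurent polynomials are compared as functions on (C \ {0})^n. *)
Definition hypothesisC (q : R) : Prop :=
  forall n : nat, (1 <= n)%N ->
  exists2 c : 'rV[int]_n -> 'rV[int]_n -> R -> R, whittaker_coefs c &
    forall (z : 'rV[int]_n) (b : 'rV[C]_n), dominant z ->
      (forall j, b ord0 j != 0) ->
      calP (toC q) z b = triangular c q z b.

Definition PiF (n : nat) (t : R) (a : 'rV[C]_n) : C :=
  cexp ((\sum_(i < n) (a ord0 i + (a ord0 i)^-1)) * toC t).

Definition Qcoef (n : nat) (q t : R) (z : 'rV[int]_n) : C :=
  inner q (PiF t) (calP (toC q) z)
  / inner q (calP (toC q) z) (calP (toC q) z).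

Definition law_pt (n : nat) (q : R) (a : 'rV[R]_n) (t : R) (z : cone n) : C :=
  let aC := map_mx toC a in
  calP (toC q) (val z) aC * Qcoef q t (val z) / PiF t aC.

Definition unit_vec (n : nat) (i : 'I_n) : 'rV[int]_n := delta_mx ord0 i.

(* z_0 = +oo, so the factor for i = 0 is 1 - q^{+oo} = 1. *)
Definition f_up (n : nat) (q : R) (z : 'rV[int]_n) (i : 'I_n) : R :=
  if i : nat is k.+1 then 1 - q ^ (part z k - part z k.+1) else 1.

Definition f_down (n : nat) (q : R) (z : 'rV[int]_n) (i : 'I_n) : R :=
  1 - q ^ (part z i - part z i.+1).

(* At most one index i contributes to the two sums. *)
Definition f_rate (n : nat) (q : R) (z z' : 'rV[int]_n) : R :=
  \sum_(i < n | z' == z + unit_vec i) f_up q z i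
  + \sum_(i < n | z' == z - unit_vec i) f_down q z i.

Definition rate (n : nat) (q : R) (a : 'rV[R]_n) (z z' : cone n) : R :=
  if z' == z then - \sum_(i < n) (a ord0 i + (a ord0 i)^-1)
  else calP q (val z') a / calP q (val z) a * f_rate q (val z) (val z').

End Torus.

Section Markov.
Variables (R : realType) (S : countType).

Definition transition_function (p : R -> S -> S -> R) : Prop :=
  [/\ forall t x y, 0 <= t -> 0 <= p t x y,
      forall t x, 0 <= t -> (\esum_(y in [set: S]) (p t x y)%:E = 1%:E)%E,
      forall x y, p 0 x y = (x == y)%:R
    & forall s t x y, 0 <= s -> 0 <= t ->
        ((p (s + t) x y)%:E
           = \esum_(w in [set: S]) (p s x w * p t w y)%:E)%E].

Definition has_rates (p : R -> S -> S -> R) (Q : S -> S -> R) : Prop :=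
  forall x y,
    (p h x y - (x == y)%:R) / h @[h --> (0 : R)^'+] --> (Q x y : R).

(* No regularity of the sample paths is required: the rates enter through the
   transition function. *)
Definition markov_process (d : measure_display) (T : measurableType d)
    (P : probability T R) (Q : S -> S -> R) (x0 : S) (Z : R -> T -> S)
    : Prop :=
  [/\ forall t x, 0 <= t -> measurable [set w | Z t w = x],
      P [set w | Z 0 w = x0] = 1%E
    & exists p : R -> S -> S -> R,
      [/\ transition_function p, has_rates p Q
        & forall (k : nat) (t : nat -> R) (x : nat -> S),
            0 <= t 0%N -> (forall i, t i <= t i.+1) ->
            (P [set w | forall i, (i <= k.+1)%N -> Z (t i) w = x i]
             = P [set w | forall i, (i <= k)%N -> Z (t i) w = x i]
               * (p (t k.+1 - t k) (x k) (x k.+1))%:E)%E]].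

End Markov.

(* Main.v *)
Require Import Defs.
From mathcomp Require Import all_boot all_order all_algebra.
From mathcomp Require Import complex ring lra zify.
From mathcomp Require Import all_classical all_reals all_analysis.

Set Implicit Arguments.
Unset Strict Implicit.
Unset Printing Implicit Defensive.
Import Order.TTheory GRing.Theory Num.Theory.
Import numFieldNormedType.Exports.
Local Open Scope classical_set_scope.
Local Open Scope ring_scope.

(** Let F be the matrix with entries f(z, w) for neighbouring z and w in the
    cone, and let E be the function sum_i (a_i + 1 / a_i).

    The engine is the Pieri rule [Pieri]: multiplication by E acts on the
    polynomials calP as the matrix F.  It comes from the branching formula.
    One more variable x is added to calP by two successive kernels, each of
    them a product of q-binomials; the operator F commutes with the first
    kernel up to the extra term q ^ mu_n / x ([upper_ker_qtoda]), and with
    the second one up to the constant x + 1 / x that also absorbs this extra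
    term ([lower_ker_qtoda]).  Both commutations are telescoping sums of
    q-Pascal identities, one for each coordinate.

    Evaluated at the positive vector a, the Pieri rule says that the
    off-diagonal rates, which are those of F conjugated by calP(a), have the
    same total mass E(a) in every state.  Bounded conservative rates determine
    the transition function ([transition_exponential]), so that
    exp(t E(a)) p_t(0, z) = calP_z(a) sum_k (t^k / k!) F^k(0, z).

    On the torus E is real and bounded.  By hypothesis (C) the calP are
    orthogonal there, and since calP_0 = 1 the Pieri rule gives
    < E^k, calP_z > = F^k(0, z) < calP_z, calP_z > ([energy_moments]).  The
    exponential series of t E converges uniformly on the torus, hence
    Q_z(t) = sum_k (t^k / k!) F^k(0, z) ([angle_inner_exp]), which is the
    series found above.

    Dividing by the squared norms requires that they do not vanish.  As E is
    self-adjoint, f(z, w) < calP_w, calP_w > = f(w, z) < calP_z, calP_z > for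
    neighbours z and w, which reduces the question to z = 0, where the squared
    norm is the integral of the density ([norm_calP_circle_neq0]).

    Torus integrals are iterated one-dimensional integrals.  All integrands
    are bounded Lipschitz functions of the angles; this class is closed under
    sums, products and integration in some of the variables, so that
    linearity and positivity pass from one level to the next. *)

(** * q-binomial coefficients extended by zero *)

Section QBinomial.
Variables (F : fieldType) (q : F).

Lemma qpochS m : qpoch q q m.+1 = qpoch q q m * (1 - q ^+ m.+1).
Proof. by rewrite /qpoch big_ord_recr /= exprS. Qed.

(** Outside 0 <= k <= m the coefficient is 0, so that the interlacing
    conditions need not be carried along the sums: a product of such
    coefficients vanishes as soon as one of them fails. *)
Definition qbin (m k : int) : F :=
  if (0 <= k) && (k <= m) then qbinomz q m k else 0.

Lemma qbin_out m k : ~~ ((0 <= k) && (k <= m)) -> qbin m k = 0.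
Proof. by rewrite /qbin => /negbTE ->. Qed.

Lemma qbin_sym m k : qbin m (m - k) = qbin m k.
Proof.
rewrite /qbin; have -> : (0 <= m - k) && (m - k <= m) = (0 <= k) && (k <= m).
  by apply/idP/idP; lia.
case: ifP => // /andP[]; case: k => // k _; case: m => // m; rewrite lez_nat => km.
rewrite /qbinomz.
have -> : `|(m : int) - (k : int)|%N = (m - k)%N by lia.
by rewrite /qbinom /= subKn// [X in _ / X]mulrC.
Qed.

Hypotheses (q_neq0 : q != 0) (q_nroot : forall k, 1 - q ^+ k.+1 != 0).

Lemma qpoch_neq0 m : qpoch q q m != 0.
Proof.
by elim: m => [|m IH]; rewrite ?qpochS ?mulf_neq0// /qpoch big_ord0 oner_neq0.
Qed.

Lemma qbin_nat (m k : nat) : qbin m k = if (k <= m)%N then qbinom q m k else 0.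
Proof. by rewrite /qbin /qbinomz lez_nat. Qed.

Lemma qbin_n0 (m : nat) : qbin m 0 = 1.
Proof.
rewrite (qbin_nat m 0) leq0n /qbinom subn0 {2}/qpoch big_ord0 mul1r.
by rewrite divff// qpoch_neq0.
Qed.

Lemma qbin_nn (m : nat) : qbin m m = 1.
Proof.
rewrite qbin_nat leqnn /qbinom subnn [qpoch q q 0]/qpoch big_ord0 mulr1.
by rewrite divff// qpoch_neq0.
Qed.

Lemma qbin_m0 m : 0 <= m -> qbin m 0 = 1.
Proof. by case: m => m // _; exact: qbin_n0. Qed.

Lemma qbin_mm m : 0 <= m -> qbin m m = 1.
Proof. by case: m => m // _; exact: qbin_nn. Qed.

(** The absorption identities hold for all integers m and k, the vanishing
    factor 1 - q ^ 0 compensating for the cut-off at the boundary. *)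
Lemma qbin_absorb1 m k : (1 - q ^ m) * qbin (m - 1) (k - 1) = (1 - q ^ k) * qbin m k.
Proof.
have [k0|k0] := ltrP k 0; first by rewrite !qbin_out ?mulr0//; lia.
case: k k0 => [[|k]|]// _.
  by rewrite expr0z subrr mul0r qbin_out ?mulr0//.
have [mk|km] := ltrP m k.+1; first by rewrite !qbin_out ?mulr0//; lia.
case: m km => [[|m]|]// km.
have -> : (m.+1 : int) - 1 = m by lia.
have -> : (k.+1 : int) - 1 = k by lia.
have km' : (k <= m)%N by lia.
rewrite !qbin_nat km' ltnS km' /qbinom subSS !qpochS -!exprnP.
have := qpoch_neq0 k; have := qpoch_neq0 (m - k).
have := q_nroot k; have := q_nroot m.
by move=> *; field; apply/and3P.
Qed.

Lemma qbin_absorb2 m k : (1 - q ^ m) * qbin (m - 1) k = (1 - q ^ (m - k)) * qbin m k.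
Proof.
rewrite -(qbin_sym m k) -qbin_absorb1 -(qbin_sym (m - 1) k).
by congr (_ * qbin _ _); lia.
Qed.

Lemma qbin_absorb3 m k : (1 - q ^ (m - k + 1)) * qbin m (k - 1) = (1 - q ^ k) * qbin m k.
Proof.
have [m0|m0] := ltrP m 0; first by rewrite !qbin_out ?mulr0//; lia.
have [->|k0] := eqVneq k 0.
  by rewrite expr0z subrr mul0r qbin_out ?mulr0//.
have [kbig|kle] := ltrP (m + 1) k; first by rewrite !qbin_out ?mulr0//; lia.
rewrite -qbin_absorb1.
have := qbin_absorb2 m (k - 1).
have -> : m - (k - 1) = m - k + 1 by lia.
by move=> <-.
Qed.

Lemma qbin_pascal1 m k : 0 <= m -> qbin (m + 1) (k + 1) = qbin m k + q ^ (k + 1) * qbin m (k + 1).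
Proof.
move=> m0.
have [m1|m1] := eqVneq (m + 1) (k + 1).
  have -> : k = m by lia.
  by rewrite !qbin_mm ?(@qbin_out m (m + 1)) ?mulr0 ?addr0//; lia.
have [kneg|k0] := ltrP (k + 1) 0; first by rewrite !qbin_out ?mulr0 ?addr0//; lia.
have [kbig|kle] := ltrP m k; first by rewrite !qbin_out ?mulr0 ?addr0//; lia.
have E1 := qbin_absorb2 (m + 1) (k + 1).
have E2 := qbin_absorb1 (m + 1) (k + 1).
rewrite !addrK in E1 E2.
have nz : 1 - q ^ (m + 1) != 0.
  case: m m0 {m1 kle E1 E2} => // m _.
  have -> : (m : int) + 1 = m.+1 :> int by rewrite -addn1 PoszD.
  by rewrite -exprnP q_nroot.
apply: (mulfI nz).
rewrite mulrDr E2 mulrCA E1 mulrA -mulrDl; congr (_ * _).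
rewrite mulrBr mulr1 -expfzDr//.
have -> : (k + 1 + (m + 1 - (k + 1))) = m + 1 by lia.
by rewrite addrA subrK.
Qed.

Lemma qbin_pascal2 m k : 0 <= m -> qbin (m + 1) (k + 1) = q ^ (m - k) * qbin m k + qbin m (k + 1).
Proof.
move=> m0; rewrite -qbin_sym.
have -> : m + 1 - (k + 1) = (m - k - 1) + 1 by lia.
rewrite qbin_pascal1// addrC; congr (_ * _ + _).
- by congr (q ^ _); lia.
- by rewrite -(qbin_sym m k); congr qbin; lia.
- by rewrite -(qbin_sym m (k + 1)); congr qbin; lia.
Qed.

(** The two q-Pascal rules are used with weights 1 and q ^ c: the terms that
    carry the shifted coefficient cancel. *)
Lemma qbin_up m k c : 0 <= m ->
  (1 - q ^ c) * qbin (m + 1) (k + 1) - (1 - q ^ (c + k + 1)) * qbin m (k + 1)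
  = qbin m k * (q ^ (m - k) - q ^ c).
Proof.
move=> m0; rewrite mulrBl mul1r {1}qbin_pascal2// qbin_pascal1//.
have -> : c + k + 1 = c + (k + 1) by lia.
by rewrite (expfzDr c (k + 1))//; ring.
Qed.

(** Same cancellation as in [qbin_up], for the opposite shift. *)
Lemma qbin_down m k c : 0 <= m ->
  (1 - q ^ c) * qbin (m + 1) k - (1 - q ^ (c + m - k + 1)) * qbin m (k - 1)
  = qbin m k * (q ^ k - q ^ c).
Proof.
move=> m0.
have E1 := qbin_pascal1 (k - 1) m0; have E2 := qbin_pascal2 (k - 1) m0.
rewrite !subrK in E1 E2.
rewrite mulrBl mul1r {1}E1 E2.
have -> : c + m - k + 1 = c + (m - (k - 1)) by lia.
by rewrite (expfzDr c (m - (k - 1)))//; ring.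
Qed.

End QBinomial.

(** * Local identities for products of q-binomials *)

Section Weights.
Variables (F : fieldType) (q : F).
Hypotheses (q_neq0 : q != 0) (q_nroot : forall k, 1 - q ^+ k.+1 != 0).
Local Notation qbin := (qbin q).

(** Coordinates are sequences on nat, so that one identity serves both branching
    kernels, whose numbers of coordinates differ by one. *)
Definition nudge (z : nat -> int) (i : nat) (s : int) : nat -> int :=
  fun j => if j == i then z j + s else z j.

Lemma nudge_eq z i s : nudge z i s i = z i + s.
Proof. by rewrite /nudge eqxx. Qed.

Lemma nudge_neq z i s j : j != i -> nudge z i s j = z j.
Proof. by rewrite /nudge => /negbTE ->. Qed.

Definition bfactor (nu mu : nat -> int) (i : nat) : F := qbin (mu i - mu i.+1) (mu i - nu i).

Definition bweight (m : nat) (nu mu : nat -> int) : F := \prod_(i < m) bfactor nu mu i.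

Definition up_rate (z : nat -> int) (i : nat) : F :=
  if i is k.+1 then 1 - q ^ (z k - z k.+1) else 1.

Definition down_rate (z : nat -> int) (i : nat) : F := 1 - q ^ (z i - z i.+1).

Lemma bweight_pull m nu mu (i : nat) : (i < m)%N ->
  bweight m nu mu = bfactor nu mu i * \prod_(j < m | j != i :> nat) bfactor nu mu j.
Proof. by move=> im; rewrite /bweight (bigD1 (Ordinal im)). Qed.

(** A shift of mu at i+1 is seen by the two factors i and i+1. *)
Lemma bweight_pull2 m nu mu (i : nat) : (i.+1 < m)%N ->
  bweight m nu mu = bfactor nu mu i * bfactor nu mu i.+1
    * \prod_(j < m | (j != i :> nat) && (j != i.+1 :> nat)) bfactor nu mu j.
Proof.
move=> im; rewrite (bweight_pull nu mu (ltnW im)) -mulrA; congr (_ * _).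
rewrite (bigD1 (Ordinal im)); last by rewrite /= eqn_leq ltnn.
rewrite /=.
by congr (_ * _); apply: eq_bigl => j; rewrite andbC.
Qed.

(** The discrete flux whose differences are the local defects of commutation in
    [bweight_up]; the value 0 at the first coordinate stands for q ^ (+oo). *)
Definition up_flux (nu mu : nat -> int) (i : nat) : F :=
  if i is k.+1 then q ^ (nu k - mu k.+1) else 0.

Definition down_flux (nu mu : nat -> int) (i : nat) : F := q ^ (mu i - nu i).

(** Raising mu at i and lowering nu at i compensate each other up to a
    difference of fluxes: absorption makes the factor i-1 common to both terms
    and [qbin_up] treats the factor i. *)
Lemma bweight_up m (nu mu : nat -> int) i : (i < m)%N -> mu i.+1 <= mu i ->
  up_rate mu i * bweight m nu (nudge mu i 1) - up_rate (nudge nu i (-1)) i * bweight m (nudge nu i (-1)) mu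
  = (up_flux nu mu i.+1 - up_flux nu mu i) * bweight m nu mu.
Proof.
case: i => [|i] im mui.
  rewrite /= !mul1r subr0 !(bweight_pull _ _ im).
  have E g1 g2 : (forall j, j != 0%N -> g1 j = bfactor nu mu j) ->
     (forall j, j != 0%N -> g2 j = bfactor nu mu j) -> 
     \prod_(j < m | j != 0%N :> nat) g1 j = \prod_(j < m | j != 0%N :> nat) g2 j :> F.
    by move=> h1 h2; apply: eq_bigr => j j0; rewrite h1// h2.
  rewrite (E (bfactor nu (nudge mu 0 1)) (bfactor nu mu))//; last first.
    by move=> j j0; rewrite /bfactor !nudge_neq.
  rewrite (E (bfactor (nudge nu 0 (-1)) mu) (bfactor nu mu))//; last first.
    by move=> j j0; rewrite /bfactor !nudge_neq.
  rewrite mulrA -mulrBl; congr (_ * _).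
  rewrite /bfactor !nudge_eq nudge_neq//.
  have -> : mu 0%N + 1 - mu 1%N = (mu 0%N - mu 1%N) + 1 by lia.
  have -> : mu 0%N + 1 - nu 0%N = (mu 0%N - nu 0%N) + 1 by lia.
  have -> : mu 0%N - (nu 0%N - 1) = (mu 0%N - nu 0%N) + 1 by lia.
  rewrite (qbin_pascal2 q_neq0 q_nroot); last lia.
  by rewrite addrK; congr (q ^ _ * _); lia.
rewrite !(bweight_pull2 _ _ im).
set R1 := \prod_(j < m | _) bfactor nu (nudge mu i.+1 1) j.
set R2 := \prod_(j < m | _) bfactor (nudge nu i.+1 (-1)) mu j.
set R := \prod_(j < m | _) bfactor nu mu j.
have -> : R1 = R.
  apply: eq_bigr => j /andP[j1 j2]; rewrite /bfactor !nudge_neq//.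
have -> : R2 = R.
  by apply: eq_bigr => j /andP[j1 j2]; rewrite /bfactor !nudge_neq.
rewrite !mulrA -mulrBl; congr (_ * _).
rewrite /up_rate /up_flux /bfactor !(nudge_eq, nudge_neq)//; try by rewrite -?(addn1 i) ?neq_ltn; lia.
have E := qbin_absorb2 q_neq0 q_nroot (mu i - mu i.+1) (mu i - nu i).
have -> : mu i - (mu i.+1 + 1) = mu i - mu i.+1 - 1 by lia.
rewrite E.
have U := @qbin_up F q q_neq0 q_nroot (mu i.+1 - mu i.+2) (mu i.+1 - nu i.+1) (nu i - mu i.+1).
have {}U := U ltac:(lia).
have -> : mu i.+1 + 1 - mu i.+2 = (mu i.+1 - mu i.+2) + 1 by lia.
have -> : mu i.+1 + 1 - nu i.+1 = (mu i.+1 - nu i.+1) + 1 by lia.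
have -> : mu i.+1 - (nu i.+1 - 1) = (mu i.+1 - nu i.+1) + 1 by lia.
have -> : mu i - mu i.+1 - (mu i - nu i) = nu i - mu i.+1 by lia.
have -> : nu i - (nu i.+1 - 1) = nu i - mu i.+1 + (mu i.+1 - nu i.+1) + 1 by lia.
have -> : nu i.+1 - mu i.+2 = mu i.+1 - mu i.+2 - (mu i.+1 - nu i.+1) by lia.
transitivity (qbin (mu i - mu i.+1) (mu i - nu i) *
  (qbin (mu i.+1 - mu i.+2) (mu i.+1 - nu i.+1) * (q ^ (mu i.+1 - mu i.+2 - (mu i.+1 - nu i.+1)) - q ^ (nu i - mu i.+1)))).
  by rewrite -U; ring.
by ring.
Qed.

(** The last coordinate of mu has no partner in nu and no factor of its own. *)
Lemma bweight_up_last m nu mu :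
  up_rate mu m * bweight m nu (nudge mu m 1) = (1 - up_flux nu mu m) * bweight m nu mu.
Proof.
case: m => [|m]; first by rewrite /= subr0 /bweight !big_ord0.
rewrite !(bweight_pull _ _ (ltnSn m)) !mulrA /=.
congr (_ * _); last first.
  apply: eq_bigr => j jm; rewrite /bfactor !nudge_neq//; rewrite neq_ltn; have := ltn_ord j; lia.
have E := qbin_absorb2 q_neq0 q_nroot (mu m - mu m.+1) (mu m - nu m).
rewrite /bfactor !(nudge_eq, nudge_neq)//; try by rewrite neq_ltn; lia.
have -> : mu m - (mu m.+1 + 1) = mu m - mu m.+1 - 1 by lia.
by rewrite E; congr ((1 - q ^ _) * _); lia.
Qed.

(** Lowering mu at j+1 is paired with raising nu at j, both acting on the
    factor j.  When j is the last index, the condition on nu and mu says that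
    both sequences vanish past their ends. *)
Lemma bweight_down m (nu mu : nat -> int) j : (j < m)%N -> mu j.+1 <= mu j ->
  (j.+1 = m -> nu m = mu m.+1) ->
  down_rate mu j.+1 * bweight m nu (nudge mu j.+1 (-1)) - down_rate (nudge nu j 1) j * bweight m (nudge nu j 1) mu
  = (down_flux nu mu j - down_flux nu mu j.+1) * bweight m nu mu.
Proof.
move=> jm muj nul.
have D := @qbin_down F q q_neq0 q_nroot (mu j - mu j.+1) (mu j - nu j) (mu j.+1 - nu j.+1).
have {}D := D ltac:(lia).
have [jm1|jm1] := eqVneq j.+1 m.
  rewrite !(bweight_pull _ _ jm).
  set R1 := \prod_(i < m | _) bfactor nu (nudge mu j.+1 (-1)) i.
  set R2 := \prod_(i < m | _) bfactor (nudge nu j 1) mu i.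
  set R := \prod_(i < m | _) bfactor nu mu i.
  have -> : R1 = R.
    apply: eq_bigr => i ij; rewrite /bfactor !nudge_neq//; have := ltn_ord i; lia.
  have -> : R2 = R by apply: eq_bigr => i ij; rewrite /bfactor !nudge_neq.
  rewrite !mulrA -mulrBl; congr (_ * _).
  rewrite /down_rate /down_flux /bfactor !(nudge_eq, nudge_neq)//; try by rewrite neq_ltn; lia.
  have -> : mu j.+1 - mu j.+2 = mu j.+1 - nu j.+1 by rewrite jm1 nul.
  have -> : mu j - (mu j.+1 + -1) = mu j - mu j.+1 + 1 by lia.
  have -> : mu j - (nu j + 1) = mu j - nu j - 1 by lia.
  have -> : nu j + 1 - nu j.+1 = mu j.+1 - nu j.+1 + (mu j - mu j.+1) - (mu j - nu j) + 1 by lia.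
  by rewrite D mulrC.
have jm2 : (j.+1 < m)%N by lia.
rewrite !(bweight_pull2 _ _ jm2).
set R1 := \prod_(i < m | _) bfactor nu (nudge mu j.+1 (-1)) i.
set R2 := \prod_(i < m | _) bfactor (nudge nu j 1) mu i.
set R := \prod_(i < m | _) bfactor nu mu i.
have -> : R1 = R.
  by apply: eq_bigr => i /andP[ij ij2]; rewrite /bfactor !nudge_neq//; lia.
have -> : R2 = R by apply: eq_bigr => i /andP[ij ij2]; rewrite /bfactor !nudge_neq.
rewrite !mulrA -mulrBl; congr (_ * _).
rewrite /down_rate /down_flux /bfactor !(nudge_eq, nudge_neq)//; try by rewrite neq_ltn; lia.
have -> : mu j - (mu j.+1 + -1) = mu j - mu j.+1 + 1 by lia.
have -> : mu j - (nu j + 1) = mu j - nu j - 1 by lia.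
have -> : nu j + 1 - nu j.+1 = mu j.+1 - nu j.+1 + (mu j - mu j.+1) - (mu j - nu j) + 1 by lia.
have E := qbin_absorb1 q_neq0 q_nroot (mu j.+1 - mu j.+2) (mu j.+1 - nu j.+1).
have -> : mu j.+1 + -1 - mu j.+2 = mu j.+1 - mu j.+2 - 1 by lia.
have -> : mu j.+1 + -1 - nu j.+1 = mu j.+1 - nu j.+1 - 1 by lia.
rewrite mulrAC E.
rewrite [X in _ = X * _]mulrC -D; ring.
Qed.

Lemma bweight_down_first m nu mu : (0 < m)%N \/ nu 0%N = mu 1%N ->
  down_rate mu 0 * bweight m nu (nudge mu 0 (-1)) = (1 - down_flux nu mu 0) * bweight m nu mu.
Proof.
case: m => [|m] h; first by rewrite /bweight !big_ord0 /down_rate /down_flux; case: h => // ->.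
rewrite !(bweight_pull _ _ (ltn0Sn m)) !mulrA /=; congr (_ * _); last first.
  by apply: eq_bigr => j jm; rewrite /bfactor !nudge_neq.
rewrite /bfactor !(nudge_eq, nudge_neq)//.
have E := qbin_absorb1 q_neq0 q_nroot (mu 0%N - mu 1%N) (mu 0%N - nu 0%N).
have -> : mu 0%N + -1 - mu 1%N = mu 0%N - mu 1%N - 1 by lia.
have -> : mu 0%N + -1 - nu 0%N = mu 0%N - nu 0%N - 1 by lia.
by rewrite E.
Qed.

(** The last coordinate of nu, when mu has as many coordinates, is left without
    partner by [bweight_down]. *)
Lemma bweight_down_last m nu mu : nu m.+1 = mu m.+1 ->
  down_rate (nudge nu m 1) m * bweight m.+1 (nudge nu m 1) mu = (1 - down_flux nu mu m) * bweight m.+1 nu mu.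
Proof.
move=> nul; rewrite !(bweight_pull _ _ (ltnSn m)) !mulrA /=; congr (_ * _); last first.
  by apply: eq_bigr => j jm; rewrite /bfactor !nudge_neq.
rewrite /down_rate /bfactor !(nudge_eq, nudge_neq)//; try by rewrite neq_ltn; lia.
rewrite nul.
have E := qbin_absorb3 q_neq0 q_nroot (mu m - mu m.+1) (mu m - nu m).
have -> : mu m - (nu m + 1) = mu m - nu m - 1 by lia.
rewrite -E; congr ((1 - q ^ _) * _); lia.
Qed.

(** The sum of [bweight_up] over all coordinates telescopes.  Here mu and nu
    have the same number m of coordinates; in the long versions mu has one
    more. *)
Lemma bweight_up_short m (nu mu : nat -> int) : (forall i, mu i.+1 <= mu i) ->
  \sum_(i < m) up_rate mu i * bweight m nu (nudge mu i 1)
  = \sum_(i < m) up_rate (nudge nu i (-1)) i * bweight m (nudge nu i (-1)) mu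
    + up_flux nu mu m * bweight m nu mu.
Proof.
move=> mud; apply/eqP; rewrite addrC -subr_eq -sumrB; apply/eqP.
under eq_bigr do rewrite bweight_up// mulrBl.
rewrite -(big_mkord xpredT (fun i => up_flux nu mu i.+1 * bweight m nu mu - up_flux nu mu i * bweight m nu mu)).
by rewrite (telescope_sumr (fun i => up_flux nu mu i * bweight m nu mu))//= mul0r subr0.
Qed.

Lemma bweight_up_long m (nu mu : nat -> int) : (forall i, mu i.+1 <= mu i) ->
  \sum_(i < m.+1) up_rate mu i * bweight m nu (nudge mu i 1)
  = \sum_(i < m) up_rate (nudge nu i (-1)) i * bweight m (nudge nu i (-1)) mu + bweight m nu mu.
Proof. by move=> mud; rewrite big_ord_recr/= bweight_up_short// bweight_up_last; ring. Qed.

Lemma bweight_down_long m (nu mu : nat -> int) : (forall i, mu i.+1 <= mu i) -> nu m = mu m.+1 ->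
  \sum_(i < m.+1) down_rate mu i * bweight m nu (nudge mu i (-1))
  = \sum_(i < m) down_rate (nudge nu i 1) i * bweight m (nudge nu i 1) mu
    + (1 - down_flux nu mu m) * bweight m nu mu.
Proof.
move=> mud nul.
rewrite -(big_mkord xpredT (fun i => down_rate mu i * bweight m nu (nudge mu i (-1)))).
rewrite big_nat_recl// big_mkord bweight_down_first; last first.
  by case: m nul => [|m] nul; [right|left].
apply/eqP; rewrite -subr_eq0; apply/eqP.
set S1 := \sum_(i < m) _; set S2 := \sum_(i < m) _.
have : S1 - S2 = (down_flux nu mu 0 - down_flux nu mu m) * bweight m nu mu.
  rewrite -sumrB.
  under eq_bigr do rewrite bweight_down// mulrBl.
  rewrite -(big_mkord xpredT (fun i => down_flux nu mu i * bweight m nu mu - down_flux nu mu i.+1 * bweight m nu mu)).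
  rewrite (@telescope_sumr_eq _ _ _ (fun i => - (down_flux nu mu i * bweight m nu mu)))//; first by ring.
  by move=> i _; rewrite opprK addrC.
by move=> E; transitivity (S1 - S2 - (down_flux nu mu 0 - down_flux nu mu m) * bweight m nu mu); [ring | rewrite E subrr].
Qed.

Lemma bweight_down_short m (nu mu : nat -> int) : (forall i, mu i.+1 <= mu i) -> nu m = mu m ->
  \sum_(i < m) down_rate mu i * bweight m nu (nudge mu i (-1))
  = \sum_(i < m) down_rate (nudge nu i 1) i * bweight m (nudge nu i 1) mu.
Proof.
case: m => [|m] mud nul; first by rewrite !big_ord0.
rewrite -(big_mkord xpredT (fun i => down_rate mu i * bweight m.+1 nu (nudge mu i (-1)))).
rewrite big_nat_recl// big_mkord [RHS]big_ord_recr/= bweight_down_first ?bweight_down_last//; last by left.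
set S1 := \sum_(i < m) _; set S2 := \sum_(i < m) _.
have E : S1 - S2 = (down_flux nu mu 0 - down_flux nu mu m) * bweight m.+1 nu mu.
  rewrite -sumrB.
  under eq_bigr => i _.
    rewrite bweight_down//; [|exact: ltnW (ltn_ord _)|by have := ltn_ord i; lia].
    rewrite mulrBl; over.
  rewrite -(big_mkord xpredT (fun i => down_flux nu mu i * bweight m.+1 nu mu - down_flux nu mu i.+1 * bweight m.+1 nu mu)).
  rewrite (@telescope_sumr_eq _ _ _ (fun i => - (down_flux nu mu i * bweight m.+1 nu mu)))//; first by ring.
  by move=> i _; rewrite opprK addrC.
apply/eqP; rewrite -subr_eq0; apply/eqP.
by transitivity (S1 - S2 - (down_flux nu mu 0 - down_flux nu mu m) * bweight m.+1 nu mu); [ring | rewrite E subrr].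
Qed.

End Weights.

(** * Finite boxes of integer vectors *)

Section Boxes.
Variable n : nat.

Definition in_box (N : nat) (z : 'rV[int]_n) : bool :=
  [forall i, `|z ord0 i| <= N%:Z].

(** A box is listed explicitly, so that sums over it are ordinary big sums whose
    order can be exchanged. *)
Definition box (N : nat) : seq 'rV[int]_n :=
  [seq (\row_i ((f i : nat)%:Z - N%:Z) : 'rV[int]_n)
     | f : {ffun 'I_n -> 'I_(N + N).+1} <- enum {: {ffun 'I_n -> 'I_(N + N).+1}}].

Lemma box_uniq N : uniq (box N).
Proof.
rewrite map_inj_uniq ?enum_uniq// => f g /rowP E; apply/ffunP => i.
by apply/val_inj; have := E i; rewrite !mxE /=; lia.
Qed.

Lemma mem_box N z : (z \in box N) = in_box N z.
Proof.
apply/mapP/forallP => [[f _ ->] i|h].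
  by rewrite mxE; move: (ltn_ord (f i)); move: (nat_of_ord (f i)) => k; lia.
exists [ffun i => inord (absz (z ord0 i + N%:Z))]; first by rewrite mem_enum.
apply/rowP => i; rewrite mxE ffunE; move: (z ord0 i) (h i) => w hw.
by rewrite inordK; lia.
Qed.

Lemma in_box_exists z : exists N, in_box N z.
Proof.
exists (\sum_i `|z ord0 i|)%N; apply/forallP => i.
by rewrite (bigD1 i)//=; lia.
Qed.

Lemma in_box_le N M z : (N <= M)%N -> in_box N z -> in_box M z.
Proof. by move=> NM /forallP h; apply/forallP => i; have := h i; lia. Qed.

Lemma part_ord (z : 'rV[int]_n) (i : 'I_n) : part z i = z ord0 i.
Proof. by rewrite /part valK. Qed.

Lemma part_ge (z : 'rV[int]_n) i : (n <= i)%N -> part z i = 0.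
Proof. by move=> ni; rewrite /part insubN// -leqNgt. Qed.

Lemma in_boxP N z : reflect (forall i : nat, `|part z i| <= N%:Z) (in_box N z).
Proof.
apply: (iffP forallP) => h i; last by rewrite -part_ord.
have [ni|ni] := leqP n i; first by rewrite part_ge.
by have /= -> := part_ord z (Ordinal ni); exact: h.
Qed.

Lemma dominantP (z : 'rV[int]_n) : reflect (forall i : nat, part z i.+1 <= part z i) (dominant z).
Proof.
apply: (iffP forallP) => h i; last exact: h.
by have [ni|ni] := leqP n i; [rewrite !part_ge//; lia | exact: (h (Ordinal ni))].
Qed.

Lemma dominant_part_ge0 (z : 'rV[int]_n) i : dominant z -> 0 <= part z i.
Proof.
move=> /dominantP d; have : forall j, part z (j + i) <= part z i.
  by elim=> // j IH; rewrite addSn; apply: le_trans (d _) IH.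
by move=> /(_ n); rewrite part_ge// leq_addr.
Qed.

Lemma part_unit (z : 'rV[int]_n) (i : 'I_n) (s : int) :
  part (z + s *: unit_vec i) = nudge (part z) i s.
Proof.
apply/funext => j; rewrite /nudge.
have [ni|ni] := leqP n j.
  by rewrite !part_ge// ifN//; have := ltn_ord i; lia.
rewrite !(part_ord _ (Ordinal ni)) !mxE /= -val_eqE /=.
by case: eqP => _; rewrite /= ?mulr1 ?mulr0 ?addr0.
Qed.

Lemma part_unitD z (i : 'I_n) : part (z + unit_vec i) = nudge (part z) i 1.
Proof. by rewrite -part_unit scale1r. Qed.

Lemma part_unitB z (i : 'I_n) : part (z - unit_vec i) = nudge (part z) i (-1).
Proof. by rewrite -part_unit scaleN1r. Qed.

Lemma wsizeD (z w : 'rV[int]_n) : wsize (z + w) = wsize z + wsize w.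
Proof. by rewrite /wsize -big_split; apply: eq_bigr => i _; rewrite mxE. Qed.

Lemma wsizeN (z : 'rV[int]_n) : wsize (- z) = - wsize z.
Proof. by rewrite /wsize -sumrN; apply: eq_bigr => i _; rewrite mxE. Qed.

Lemma wsize_unit (i : 'I_n) : wsize (unit_vec i) = 1.
Proof.
rewrite /wsize (bigD1 i)//= mxE !eqxx big1 ?addr0// => j ji.
by rewrite mxE (negbTE ji).
Qed.

Lemma in_box_unitD N z (i : 'I_n) : in_box N z -> in_box N.+1 (z + unit_vec i).
Proof.
by move=> /in_boxP h; apply/in_boxP => j; rewrite part_unitD /nudge; have := h j; case: ifP; lia.
Qed.

Lemma in_box_unitB N z (i : 'I_n) : in_box N z -> in_box N.+1 (z - unit_vec i).
Proof.
by move=> /in_boxP h; apply/in_boxP => j; rewrite part_unitB /nudge; have := h j; case: ifP; lia.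
Qed.

End Boxes.

(** * Finitely supported sums over a lattice *)

Section FiniteSums.
Variables (F : fieldType) (V : zmodType).
Implicit Types (s : seq V) (f : V -> F).

Lemma fsum_seq s f : uniq s -> (forall v, f v != 0 -> v \in s) ->
  \sum_(v \in [set: V]) f v = \sum_(v <- s) f v.
Proof.
move=> us fs; rewrite (fsbigE s)//=.
- by apply: eq_bigl => v; rewrite in_setT.
- by move=> v _; apply: contraNeq; exact: fs.
Qed.

Lemma eq_sum_supp s s' f : uniq s -> uniq s' ->
  (forall v, f v != 0 -> v \in s) -> (forall v, f v != 0 -> v \in s') ->
  \sum_(v <- s) f v = \sum_(v <- s') f v.
Proof. by move=> us us' fs fs'; rewrite -(fsum_seq us)// (fsum_seq us'). Qed.

(** Translation invariance, read on a list that contains both the support and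
    the translated support. *)
Lemma sum_shift s f (e : V) : uniq s ->
  (forall v, f v != 0 -> (v \in s) && (v + e \in s)) ->
  \sum_(v <- s) f v = \sum_(v <- s) f (v - e).
Proof.
move=> us fs; rewrite -(fsum_seq us); last by move=> v /fs /andP[].
rewrite -(fsum_seq us); last by move=> v /fs /andP[_]; rewrite subrK.
apply: reindex_fsbigT; exists (fun v => v + e) => v; [exact: subrK|exact: addrK].
Qed.

End FiniteSums.

(** * Branching kernels and the q-Toda operator *)

Section Pieri.
Variables (F : fieldType) (q : F).

(** The coefficients vanish when the shifted vector leaves the cone, so
    at a dominant z only the values of g on the cone enter. *)
Definition qtoda (n : nat) (g : 'rV[int]_n -> F) (z : 'rV[int]_n) : F :=
  \sum_(i < n) (up_rate q (part z) i * g (z + unit_vec i)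
              + down_rate q (part z) i * g (z - unit_vec i)).

(** First half of the branching, from la down to mu with as many coordinates. *)
Definition upper_ker (n : nat) (x : F) (mu la : 'rV[int]_n) : F :=
  x ^ (wsize mu - wsize la) * bweight q n (part mu) (part la).

(** Second half of the branching, from mu down to nu with one coordinate less. *)
Definition lower_ker (n : nat) (x : F) (nu : 'rV[int]_n) (mu : 'rV[int]_n.+1) : F :=
  x ^ (wsize mu - wsize nu) * bweight q n (part nu) (part mu).

Lemma bweight_supp m nu mu : bweight q m nu mu != 0 ->
  forall i, (i < m)%N -> mu i.+1 <= nu i <= mu i.
Proof.
move=> W0 i im; apply: contraNT W0 => h; rewrite (bweight_pull _ _ _ im) /bfactor qbin_out ?mul0r//.
by move: h; apply: contra; lia.
Qed.

Lemma upper_ker_supp n x (mu la : 'rV[int]_n) : upper_ker x mu la != 0 ->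
  forall i, (i < n)%N -> part la i.+1 <= part mu i <= part la i.
Proof. by rewrite mulf_eq0 negb_or => /andP[_ /bweight_supp]. Qed.

Lemma lower_ker_supp n x (nu : 'rV[int]_n) (mu : 'rV[int]_n.+1) : lower_ker x nu mu != 0 ->
  forall i, (i < n)%N -> part mu i.+1 <= part nu i <= part mu i.
Proof. by rewrite mulf_eq0 negb_or => /andP[_ /bweight_supp]. Qed.

Lemma upper_ker_box n x N (mu la : 'rV[int]_n) : upper_ker x mu la != 0 -> in_box N la -> in_box N mu.
Proof.
move=> /upper_ker_supp h /in_boxP hla; apply/in_boxP => i.
have [ni|ni] := leqP n i; first by rewrite part_ge.
by have := h _ ni; have := hla i; have := hla i.+1; lia.
Qed.

Lemma lower_ker_box n x N (nu : 'rV[int]_n) (mu : 'rV[int]_n.+1) :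
  lower_ker x nu mu != 0 -> in_box N mu -> in_box N nu.
Proof.
move=> /lower_ker_supp h /in_boxP hla; apply/in_boxP => i.
have [ni|ni] := leqP n i; first by rewrite part_ge.
by have := h _ ni; have := hla i; have := hla i.+1; lia.
Qed.

Lemma upper_ker_dom n x (mu la : 'rV[int]_n) : upper_ker x mu la != 0 -> dominant la -> dominant mu.
Proof.
move=> /upper_ker_supp h /dominantP d; apply/dominantP => i.
have [ni|ni] := leqP n i; first by rewrite !part_ge//; lia.
have [ni1|ni1] := leqP n i.+1.
  by have := h _ ni; rewrite [part mu i.+1]part_ge// [part la i.+1]part_ge//; lia.
by have := h _ ni; have := h _ ni1; lia.
Qed.

Lemma lower_ker_dom n x (nu : 'rV[int]_n) (mu : 'rV[int]_n.+1) :
  lower_ker x nu mu != 0 -> dominant mu -> dominant nu.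
Proof.
move=> /lower_ker_supp h /dominantP d; apply/dominantP => i.
have [ni|ni] := leqP n i; first by rewrite !part_ge//; lia.
have pos k : 0 <= part mu k by apply: dominant_part_ge0; exact/dominantP.
have [ni1|ni1] := leqP n i.+1.
  by have := h _ ni; have := pos i.+1; rewrite [part nu i.+1]part_ge//; lia.
by have := h _ ni; have := h _ ni1; lia.
Qed.

Lemma up_rate_eq0 n (z : 'rV[int]_n) (i : 'I_n) : dominant z ->
  ~~ dominant (z + unit_vec i) -> up_rate q (part z) i = 0.
Proof.
move=> /dominantP d /negP nd; rewrite /up_rate; case: i nd => [[|k] ik] nd /=.
  case: nd; apply/dominantP => j; rewrite part_unitD /nudge /=.
  by have := d j; do ?[case: ifP => ?]; lia.
have [E|E] := eqVneq (part z k) (part z k.+1); first by rewrite E subrr expr0z subrr.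
case: nd; apply/dominantP => j; rewrite part_unitD /nudge /=.
have := d j; have [->|jk] := eqVneq j k; last by do ?[case: ifP => ?]; lia.
by do ?[case: ifP => ?]; lia.
Qed.

Lemma down_rate_eq0 n (z : 'rV[int]_n) (i : 'I_n) : dominant z ->
  ~~ dominant (z - unit_vec i) -> down_rate q (part z) i = 0.
Proof.
move=> /dominantP d /negP nd; rewrite /down_rate.
have [E|E] := eqVneq (part z i) (part z i.+1); first by rewrite E subrr expr0z subrr.
case: nd; apply/dominantP => j; rewrite part_unitB /nudge /=.
have := d j; have [->|jk] := eqVneq j (i : nat); last by rewrite ?(negbTE jk); case: ifP; lia.
by rewrite ?eqxx; case: ifP; lia.
Qed.

Hypotheses (q_neq0 : q != 0) (q_nroot : forall k, 1 - q ^+ k.+1 != 0).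

(** The q-Toda operator passes through the upper kernel, its action on la being
    exchanged for the transposed action on mu.  The flux left at the last
    coordinate produces the term in q ^ mu_n. *)
Lemma upper_ker_qtoda n x (mu la : 'rV[int]_n.+1) : x != 0 -> dominant la ->
  \sum_(i < n.+1) (up_rate q (part la) i * upper_ker x mu (la + unit_vec i)
                 + down_rate q (part la) i * upper_ker x mu (la - unit_vec i))
  = \sum_(i < n.+1)
      (up_rate q (part (mu - unit_vec i)) i * upper_ker x (mu - unit_vec i) la
     + down_rate q (part (mu + unit_vec i)) i * upper_ker x (mu + unit_vec i) la)
    + x^-1 * q ^ part mu n * upper_ker x mu la.
Proof.
move=> x0 /dominantP d; rewrite !big_split /= addrAC; congr (_ + _).
  transitivity (x ^ (wsize mu - wsize la - 1) *
     \sum_(i < n.+1) up_rate q (part la) i * bweight q n.+1 (part mu) (nudge (part la) i 1)).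
    rewrite mulr_sumr; apply: eq_bigr => i _.
    rewrite /upper_ker part_unitD wsizeD wsize_unit mulrCA; congr (x ^ _ * _); lia.
  rewrite bweight_up_short// mulrDr; congr (_ + _).
    rewrite mulr_sumr; apply: eq_bigr => i _.
    rewrite /upper_ker part_unitB wsizeD wsizeN wsize_unit mulrCA; congr (_ * (x ^ _ * _)); lia.
  rewrite /up_flux (@part_ge n.+1 la n.+1)// subr0 expfzDr// exprN1 /upper_ker.
  have regroup (u v f w : F) : u * v * (f * w) = v * f * (u * w) by ring.
  exact: regroup.
transitivity (x ^ (wsize mu - wsize la + 1) *
   \sum_(i < n.+1) down_rate q (part la) i * bweight q n.+1 (part mu) (nudge (part la) i (-1))).
  rewrite mulr_sumr; apply: eq_bigr => i _.
  rewrite /upper_ker part_unitB wsizeD wsizeN wsize_unit mulrCA; congr (x ^ _ * _); lia.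
rewrite bweight_down_short//; last by rewrite !part_ge.
rewrite mulr_sumr; apply: eq_bigr => i _.
rewrite /upper_ker part_unitD wsizeD wsize_unit mulrCA; congr (_ * (x ^ _ * _)); lia.
Qed.

(** The lower kernel absorbs the term in q ^ mu_n left by the upper one: raising
    contributes x and lowering contributes (1 - q ^ mu_n) / x. *)
Lemma lower_ker_qtoda n x (nu : 'rV[int]_n) (mu : 'rV[int]_n.+1) : x != 0 -> dominant mu ->
  \sum_(i < n.+1) (up_rate q (part mu) i * lower_ker x nu (mu + unit_vec i)
                 + down_rate q (part mu) i * lower_ker x nu (mu - unit_vec i))
    + x^-1 * q ^ part mu n * lower_ker x nu mu
  = \sum_(i < n)
      (up_rate q (part (nu - unit_vec i)) i * lower_ker x (nu - unit_vec i) mu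
     + down_rate q (part (nu + unit_vec i)) i * lower_ker x (nu + unit_vec i) mu)
    + (x + x^-1) * lower_ker x nu mu.
Proof.
move=> x0 /dominantP d; rewrite !big_split /=.
have -> : \sum_(i < n.+1) up_rate q (part mu) i * lower_ker x nu (mu + unit_vec i)
    = \sum_(i < n) up_rate q (part (nu - unit_vec i)) i * lower_ker x (nu - unit_vec i) mu
      + x * lower_ker x nu mu.
  transitivity (x ^ (wsize mu - wsize nu + 1) *
     \sum_(i < n.+1) up_rate q (part mu) i * bweight q n (part nu) (nudge (part mu) i 1)).
    rewrite mulr_sumr; apply: eq_bigr => i _.
    rewrite /lower_ker part_unitD wsizeD wsize_unit mulrCA; congr (x ^ _ * _); lia.
  rewrite bweight_up_long// mulrDr; congr (_ + _).
    rewrite mulr_sumr; apply: eq_bigr => i _.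
    rewrite /lower_ker part_unitB wsizeD wsizeN wsize_unit mulrCA; congr (_ * (x ^ _ * _)); lia.
  by rewrite expfzDr// expr1z /lower_ker [x ^ _ * x]mulrC mulrA.
have -> : \sum_(i < n.+1) down_rate q (part mu) i * lower_ker x nu (mu - unit_vec i)
    = \sum_(i < n) down_rate q (part (nu + unit_vec i)) i * lower_ker x (nu + unit_vec i) mu
      + x^-1 * (1 - q ^ part mu n) * lower_ker x nu mu.
  transitivity (x ^ (wsize mu - wsize nu - 1) *
     \sum_(i < n.+1) down_rate q (part mu) i * bweight q n (part nu) (nudge (part mu) i (-1))).
    rewrite mulr_sumr; apply: eq_bigr => i _.
    rewrite /lower_ker part_unitB wsizeD wsizeN wsize_unit mulrCA; congr (x ^ _ * _); lia.
  rewrite bweight_down_long//; last by rewrite !part_ge.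
  rewrite mulrDr; congr (_ + _).
    rewrite mulr_sumr; apply: eq_bigr => i _.
    rewrite /lower_ker part_unitD wsizeD wsize_unit mulrCA; congr (_ * (x ^ _ * _)); lia.
  rewrite /down_flux (@part_ge n nu n)// subr0 expfzDr// exprN1 /lower_ker.
  have regroup (u v f w : F) : u * v * (f * w) = v * f * (u * w) by ring.
  exact: regroup.
have combine (b c k y f : F) :
  b + x * k + (c + y * (1 - f) * k) + y * f * k = b + c + (x + y) * k by ring.
exact: combine.
Qed.

(** Summation by parts; enlarging the box by one makes room for the shifts. *)
Lemma qtoda_adjoint n N (k G : 'rV[int]_n -> F) :
  (forall v, k v != 0 -> in_box N v) ->
  \sum_(v <- box n N.+1)
     (\sum_(i < n) (up_rate q (part (v - unit_vec i)) i * k (v - unit_vec i)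
                  + down_rate q (part (v + unit_vec i)) i * k (v + unit_vec i))) * G v
  = \sum_(v <- box n N.+1) k v * qtoda G v.
Proof.
move=> kN; under eq_bigr do rewrite mulr_suml.
under [RHS]eq_bigr do rewrite mulr_sumr.
rewrite exchange_big [RHS]exchange_big /=; apply: eq_bigr => i _.
under eq_bigr do rewrite mulrDl.
under [RHS]eq_bigr do rewrite mulrDr.
rewrite !big_split /=; congr (_ + _).
  rewrite [RHS](sum_shift (e := unit_vec i)) ?box_uniq//.
    by apply: eq_bigr => v _; rewrite subrK; ring.
  move=> v; rewrite mulf_eq0 negb_or => /andP[/kN kv _].
  by rewrite !mem_box in_box_unitD// (in_box_le _ kv).
rewrite [RHS](sum_shift (e := - unit_vec i)) ?box_uniq//.
  by apply: eq_bigr => v _; rewrite opprK addrK; ring.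
move=> v; rewrite mulf_eq0 negb_or => /andP[/kN kv _].
by rewrite !mem_box in_box_unitB// (in_box_le _ kv).
Qed.

(** The size N is only there to make the sums finite: on vectors of the box of
    size N the kernels vanish at mu and nu outside this box. *)
Definition branch_op n (x : F) (N : nat) (g : 'rV[int]_n -> F) (la : 'rV[int]_n.+1) : F :=
  \sum_(mu <- box n.+1 N) upper_ker x mu la * \sum_(nu <- box n N) lower_ker x nu mu * g nu.

(** The two commutations combine into the recursion for E: each new variable x
    adds x + 1 / x. *)
Lemma branch_op_qtoda n (x : F) N (g : 'rV[int]_n -> F) la : x != 0 -> dominant la -> in_box N la ->
  qtoda (branch_op x N.+1 g) la = branch_op x N.+1 (fun nu => qtoda g nu + (x + x^-1) * g nu) la.
Proof.
move=> x0 dla bla.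
set GB := fun mu : 'rV[int]_n.+1 => \sum_(nu <- box n N.+1) lower_ker x nu mu * g nu.
transitivity (\sum_(mu <- box n.+1 N.+1) 
   (\sum_(i < n.+1) (up_rate q (part la) i * upper_ker x mu (la + unit_vec i)
                 + down_rate q (part la) i * upper_ker x mu (la - unit_vec i))) * GB mu).
  rewrite /qtoda /branch_op.
  under eq_bigr do rewrite !mulr_sumr -big_split.
  rewrite exchange_big; apply: eq_bigr => mu _; rewrite mulr_suml; apply: eq_bigr => i _.
  by rewrite /= -/(GB mu); ring.
under eq_bigr do rewrite upper_ker_qtoda// mulrDl.
rewrite big_split /= (qtoda_adjoint (k := fun m => upper_ker x m la) GB); last first.
  by move=> v kv; exact: upper_ker_box kv bla.
rewrite -big_split /branch_op; apply: eq_bigr => mu _ /=.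
have [->|kn] := eqVneq (upper_ker x mu la) 0; first by rewrite mulr0 !mul0r addr0.
have dmu := upper_ker_dom kn dla; have bmu := upper_ker_box kn bla.
transitivity (upper_ker x mu la * (qtoda GB mu + x^-1 * q ^ part mu n * GB mu)); first by ring.
congr (_ * _).
transitivity (\sum_(nu <- box n N.+1) 
   (\sum_(i < n.+1) (up_rate q (part mu) i * lower_ker x nu (mu + unit_vec i)
                 + down_rate q (part mu) i * lower_ker x nu (mu - unit_vec i))
     + x^-1 * q ^ part mu n * lower_ker x nu mu) * g nu).
  under [RHS]eq_bigr do rewrite mulrDl.
  rewrite [RHS]big_split /= /qtoda /GB; congr (_ + _).
    rewrite [RHS](eq_bigr _ (fun nu _ => mulr_suml _ _ _ _)) exchange_big.
    apply: eq_bigr => i _; rewrite !mulr_sumr -big_split; apply: eq_bigr => nu _ /=.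
    by ring.
  by rewrite mulr_sumr; apply: eq_bigr => nu _; rewrite mulrA.
rewrite (eq_bigr (fun nu : 'rV[int]_n =>
    (\sum_(i < n)
      (up_rate q (part (nu - unit_vec i)) i * lower_ker x (nu - unit_vec i) mu
     + down_rate q (part (nu + unit_vec i)) i * lower_ker x (nu + unit_vec i) mu)) * g nu
    + (x + x^-1) * lower_ker x nu mu * g nu)); last first.
  by move=> nu _; rewrite lower_ker_qtoda// mulrDl.
rewrite big_split /= (qtoda_adjoint (k := fun m => lower_ker x m mu) g); last first.
  by move=> v kv; exact: lower_ker_box kv bmu.
by rewrite -big_split; apply: eq_bigr => nu _ /=; ring.
Qed.

End Pieri.

(** * The Pieri rule *)

Section CalP.
Variables (F : fieldType) (q : F).

Lemma qbinomz_qbin m k : (0 <= k) && (k <= m) -> qbinomz q m k = qbin q m k.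
Proof. by rewrite /qbin => ->. Qed.

Lemma big_box1 n N (f : 'rV[int]_n -> F) :
  (forall v, v \in box n N -> f v != 0 -> v = 0) -> 
  \sum_(v <- box n N) f v = f 0.
Proof.
move=> h; rewrite (big_rem 0)/=; last by rewrite mem_box; apply/forallP => i; rewrite mxE.
rewrite big1_seq ?addr0// => v /=; rewrite (mem_rem_uniq _ (box_uniq n N)) inE /=.
move=> /andP[v0 vb]; apply/eqP; apply: contraNT v0 => fv.
by apply/eqP; exact: h.
Qed.

Lemma branch_ker n x N (nu : 'rV[int]_n) (la : 'rV[int]_n.+1) :
  x != 0 -> dominant la -> in_box N la ->
  branch q x nu la = \sum_(mu <- box n.+1 N) upper_ker q x mu la * lower_ker q x nu mu.
Proof.
move=> x0 dla bla; rewrite /branch.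
set D := [set mu | _].
rewrite (eq_fsbigr (fun mu => upper_ker q x mu la * lower_ker q x nu mu)); last first.
  move=> mu; rewrite inE => -[dmu inu imu].
  rewrite /upper_ker /lower_ker /bweight big_ord_recr /= big_split /= /bfactor.
  rewrite (_ : 2 * wsize mu - wsize nu - wsize la = (wsize mu - wsize la) + (wsize mu - wsize nu)); last by ring.
  rewrite (expfzDr (wsize mu - wsize la))//.
  rewrite qbinomz_qbin; last by have := imu n; rewrite part_ge//; lia.
  rewrite (@part_ge n.+1 la n.+1)// subr0.
  rewrite (eq_bigr (fun i : 'I_n => qbin q (part la i - part la i.+1) (part la i - part mu i))); last first.
    by move=> i _; rewrite qbinomz_qbin//; have := imu i; lia.
  rewrite [X in _ * (_ * X)](eq_bigr (fun i : 'I_n => qbin q (part mu i - part mu i.+1) (part mu i - part nu i))); last first.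
    by move=> i _; rewrite qbinomz_qbin//; have := inu i; lia.
  have regroup (u v w s t : F) : u * v * (w * s) * t = u * (w * t) * (v * s) by ring.
  exact: regroup.
apply: (fsbig_fwiden (box n.+1 N)); last 2 first.
- exact: box_uniq.
- move=> mu [_ nD] /=; apply/eqP; apply: contra_notT nD.
  rewrite mulf_eq0 negb_or => /andP[ka0 kb0].
  have dmu := upper_ker_dom ka0 dla.
  split=> // i.
    have [ni|ni] := leqP n i; last by have := lower_ker_supp kb0 ni; lia.
    have dnu := lower_ker_dom kb0 dmu.
    rewrite (@part_ge n.+1 mu i.+1)// (@part_ge n nu i)//; split => //.
    have [ni'|ni'] := leqP n.+1 i; first by rewrite part_ge.
    have -> : i = n by lia.
    have /dominantP/(_ n) := dmu; rewrite (@part_ge n.+1 mu n.+1)//.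
  have [ni|ni] := leqP n.+1 i; last by have := upper_ker_supp ka0 ni; lia.
  by rewrite !part_ge//; lia.
- move=> mu [dmu inu imu] /=; rewrite mem_box; apply/in_boxP => i.
  have /in_boxP h := bla; have := h i; have := h i.+1; have := imu i; lia.
Qed.

Lemma kernels_dominant n x (nu : 'rV[int]_n) mu (la : 'rV[int]_n.+1) :
  dominant la -> upper_ker q x mu la * lower_ker q x nu mu != 0 -> dominant nu.
Proof.
move=> dla; rewrite mulf_eq0 negb_or => /andP[ka0 kb0].
by apply: (lower_ker_dom kb0); exact: (upper_ker_dom ka0).
Qed.

Definition init_row n (a : 'rV[F]_n.+1) : 'rV[F]_n :=
  \row_(i < n) a ord0 (widen_ord (leqnSn n) i).

(** One variable is added by the two kernels; this also covers the first
    variable, with calP equal to 1 in no variables, although the case of one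
    variable has its own formula in the recursion. *)
Lemma calPS n N (la : 'rV[int]_n.+1) (a : 'rV[F]_n.+1) :
  a ord0 ord_max != 0 -> dominant la -> in_box N la ->
  calP q la a = branch_op q (a ord0 ord_max) N (fun nu => calP q nu (init_row a)) la.
Proof.
move=> x0 dla bla; set x := a ord0 ord_max in x0 *.
case: n la a @x x0 dla bla => [|n] la a x x0 dla bla.
  (* The single variable: the outer sum runs over vectors with one coordinate, the
     inner one over the empty vector. *)
  rewrite /branch_op /= -/x.
  pose f (mu : 'rV[int]_1) := x ^ (2 * part mu 0 - part la 0)
     * qbin q (part la 0) (part la 0 - part mu 0).
  have w1 (z : 'rV[int]_1) : wsize z = part z 0.
    by rewrite /wsize big_ord1 -part_ord.
  rewrite (eq_bigr f); last first.
    move=> mu _; rewrite big_box1; last by move=> v _ _; exact: thinmx0.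
    rewrite /upper_ker /lower_ker /bweight big_ord0 big_ord1 /bfactor /f !mulr1 !w1.
    rewrite (@part_ge 1 la 1)// subr0 [wsize 0]big_ord0 subr0 mulrAC -expfzDr//.
    by congr (x ^ _ * _); ring.
  have la0 : 0 <= part la 0.
    by have /dominantP/(_ 0%N) := dla; rewrite (@part_ge 1 la 1).
  pose r := [seq (const_mx (m%:Z) : 'rV[int]_1) | m <- iota 0 `|part la 0|.+1].
  have pc (c : int) : part (const_mx c : 'rV[int]_1) 0 = c.
    by rewrite (part_ord (const_mx c : 'rV[int]_1) ord0) mxE.
  have ur : uniq r.
    rewrite map_inj_uniq ?iota_uniq// => m1 m2 /(congr1 (fun z => part z 0)).
    by rewrite !pc => -[].
  have fr v : f v != 0 -> 0 <= part v 0 <= part la 0.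
    rewrite /f; apply: contraNT => h; rewrite qbin_out ?mulr0//.
    by move: h; apply: contra; lia.
  rewrite (eq_sum_supp (s' := r)) ?box_uniq//; last 2 first.
  - move=> v /fr h; rewrite mem_box; apply/in_boxP => -[|i]; last by rewrite part_ge.
    by have /in_boxP/(_ 0%N) := bla; lia.
  - move=> v /fr h; apply/mapP; exists `|part v 0|%N; first by rewrite mem_iota; lia.
    apply/rowP => i; rewrite ord1 mxE; move: h; rewrite (part_ord v ord0).
    by move: (v ord0 ord0) => w; lia.
  rewrite /r big_map -(big_mkord xpredT (fun m => qbinom q `|part la 0| m * x ^ (2 * m%:Z - part la 0))).
  rewrite /index_iota subn0 big_seq [RHS]big_seq; apply: eq_bigr => m.
  rewrite mem_iota => h; rewrite /f pc qbin_sym -?qbinomz_qbin; last lia.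
  by rewrite mulrC.
rewrite [LHS]/= -/x.
have -> : (\row_(i < n.+1) a ord0 (widen_ord (leqnSn n.+1) i)) = init_row a by [].
set D := [set nu | _].
rewrite (eq_fsbigr (fun nu => \sum_(mu <- box n.+2 N) upper_ker q x mu la * lower_ker q x nu mu * calP q nu (init_row a))); last first.
  by move=> nu _; rewrite (branch_ker _ x0 dla bla) mulr_suml.
rewrite (fsbig_widen D setT)//; last first.
  move=> nu [_ nD] /=; rewrite big1_seq// => mu _; apply/eqP.
  apply: contra_notT nD; rewrite mulf_eq0 negb_or => /andP[h _].
  exact: kernels_dominant dla h.
rewrite (fsum_seq (box_uniq n.+1 N)); last first.
  move=> nu; apply: contraNT => nb; rewrite big1_seq// => mu _; apply/eqP.
  apply: contraNT nb; rewrite mulf_eq0 negb_or mem_box => /andP[+ _].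
  rewrite mulf_eq0 negb_or => /andP[h1 h2].
  by apply: (lower_ker_box h2); exact: (upper_ker_box h1).
rewrite exchange_big /branch_op; apply: eq_bigr => mu _.
by rewrite mulr_sumr; apply: eq_bigr => nu _; rewrite mulrA.
Qed.

Lemma init_row_neq0 n (a : 'rV[F]_n.+1) :
  (forall i, a ord0 i != 0) -> forall i, init_row a ord0 i != 0.
Proof. by move=> h i; rewrite mxE. Qed.

Lemma sum_init_row n (a : 'rV[F]_n.+1) (f : F -> F) :
  \sum_(i < n.+1) f (a ord0 i) = \sum_(i < n) f (init_row a ord0 i) + f (a ord0 ord_max).
Proof.
by rewrite big_ord_recr; congr (_ + _); apply: eq_bigr => i _; rewrite mxE.
Qed.

Hypotheses (q_neq0 : q != 0) (q_nroot : forall k, 1 - q ^+ k.+1 != 0).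

(** Induction on the number of variables along [branch_op_qtoda]. *)
Theorem Pieri n (a : 'rV[F]_n) (la : 'rV[int]_n) :
  (forall i, a ord0 i != 0) -> dominant la ->
  qtoda q (fun z => calP q z a) la
  = (\sum_(i < n) (a ord0 i + (a ord0 i)^-1)) * calP q la a.
Proof.
elim: n a la => [|n IH] a la a0 dla; first by rewrite /qtoda !big_ord0 mul0r.
have [N bla] := in_box_exists la.
set x := a ord0 ord_max; have x0 : x != 0 by exact: a0.
have T z : dominant z -> in_box N.+1 z ->
   calP q z a = branch_op q x N.+1 (fun nu => calP q nu (init_row a)) z.
  by move=> dz bz; exact: calPS.
transitivity (qtoda q (branch_op q x N.+1 (fun nu => calP q nu (init_row a))) la).
  apply: eq_bigr => i _; congr (_ + _).
    have [d|nd] := boolP (dominant (la + unit_vec i)).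
      by rewrite T// in_box_unitD.
    by rewrite (up_rate_eq0 _ dla nd) !mul0r.
  have [d|nd] := boolP (dominant (la - unit_vec i)).
    by rewrite T// in_box_unitB.
  by rewrite (down_rate_eq0 _ dla nd) !mul0r.
rewrite branch_op_qtoda// T//; last exact: in_box_le bla.
rewrite (sum_init_row a (fun y => y + y^-1)) -/x /branch_op mulr_sumr.
apply: eq_bigr => mu _.
have [->|kn] := eqVneq (upper_ker q x mu la) 0; first by rewrite !mul0r mulr0.
rewrite mulrCA; congr (_ * _); rewrite mulr_sumr; apply: eq_bigr => nu _.
have [->|kn'] := eqVneq (lower_ker q x nu mu) 0; first by rewrite !mul0r mulr0.
rewrite mulrCA; congr (_ * _).
rewrite IH//; [ring|exact: init_row_neq0|].
by apply: (lower_ker_dom kn'); exact: (upper_ker_dom kn).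
Qed.

Lemma calP0 n (a : 'rV[F]_n) : (forall i, a ord0 i != 0) -> calP q 0 a = 1.
Proof.
elim: n a => [|n IH] a a0 //.
have b0 m : in_box 0 (0 : 'rV[int]_m) by apply/forallP => i; rewrite mxE.
have z0 m (v : 'rV[int]_m) : v \in box m 0 -> v = 0.
  rewrite mem_box => /forallP h; apply/rowP => i; rewrite mxE.
  by move: (h i); move: (v ord0 i) => w; lia.
have p0 m i : part (0 : 'rV[int]_m) i = 0.
  have [ni|ni] := leqP m i; first by rewrite part_ge.
  by have /= -> := part_ord (0 : 'rV[int]_m) (Ordinal ni); rewrite mxE.
have w0 m : wsize (0 : 'rV[int]_m) = 0 by rewrite /wsize big1// => i _; rewrite mxE.
have W0 m k l : bweight q m (part (0 : 'rV[int]_k)) (part (0 : 'rV[int]_l)) = 1.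
  by rewrite /bweight big1// => i _; rewrite /bfactor !p0 subrr (qbin_n0 q_nroot 0).
rewrite (@calPS _ 0)//; last exact: dominant0.
rewrite /branch_op big_box1; last by move=> v /z0.
rewrite big_box1; last by move=> v /z0.
by rewrite IH ?mulr1; [rewrite /upper_ker /lower_ker !w0 !W0 subrr !expr0z !mulr1|exact: init_row_neq0].
Qed.

End CalP.

(** * Change of base field *)

Section Morphism.
Variables (F G : fieldType) (f : {rmorphism F -> G}) (q : F).

Lemma qpoch_morph x m : qpoch (f q) (f x) m = f (qpoch q x m).
Proof.
rewrite /qpoch rmorph_prod; apply: eq_bigr => i _.
by rewrite rmorphB rmorph1 rmorphM rmorphXn.
Qed.

Lemma qbin_morph m k : qbin (f q) m k = f (qbin q m k).
Proof.
rewrite /qbin; case: ifP => _; last by rewrite rmorph0.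
by rewrite /qbinomz /qbinom !qpoch_morph fmorph_div rmorphM.
Qed.

Lemma bweight_morph m nu mu : bweight (f q) m nu mu = f (bweight q m nu mu).
Proof. by rewrite /bweight rmorph_prod; apply: eq_bigr => i _; rewrite /bfactor qbin_morph. Qed.

(** calP is a rational expression in q and a, so it commutes with field
    morphisms.  This identifies the values at real a of the complex polynomial
    with those of the real one. *)
Lemma calP_morph n (a : 'rV[F]_n) la : (forall i, a ord0 i != 0) -> dominant la ->
  calP (f q) la (map_mx f a) = f (calP q la a).
Proof.
elim: n a la => [|n IH] a la a0 dla; first by rewrite /= rmorph1.
have [N bla] := in_box_exists la.
rewrite (calPS _ _ dla bla) ?mxE ?fmorph_eq0//.
rewrite (calPS _ _ dla bla)//.
rewrite /branch_op rmorph_sum; apply: eq_bigr => mu _.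
have [k0|kn] := eqVneq (upper_ker q (a ord0 ord_max) mu la) 0.
  rewrite k0 mul0r rmorph0; move: k0; rewrite /upper_ker bweight_morph => k0.
  by rewrite -fmorphXz -rmorphM k0 rmorph0 mul0r.
rewrite rmorphM /= /upper_ker bweight_morph rmorphM fmorphXz; congr (_ * _).
rewrite rmorph_sum; apply: eq_bigr => nu _.
have [k0|kn'] := eqVneq (lower_ker q (a ord0 ord_max) nu mu) 0.
  rewrite k0 mul0r rmorph0; move: k0; rewrite /lower_ker bweight_morph => k0.
  by rewrite -fmorphXz -rmorphM k0 rmorph0 mul0r.
rewrite /= rmorphM /= /lower_ker bweight_morph rmorphM fmorphXz; congr (_ * _).
rewrite -IH//; last 2 first.
- exact: init_row_neq0.
- by apply: (lower_ker_dom kn'); exact: (upper_ker_dom kn).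
by congr calP; apply/rowP => i; rewrite !mxE.
Qed.

End Morphism.

(** * Positivity *)

Section Positivity.
Variables (R : realFieldType) (q : R).
Hypotheses (q0 : 0 < q) (q1 : q < 1).

Lemma onem_expr_gt0 k : 0 < 1 - q ^+ k.+1.
Proof. by rewrite subr_gt0 exprn_ilt1// ltW. Qed.

Lemma lt01_nroot k : 1 - q ^+ k.+1 != 0.
Proof. by rewrite gt_eqF// onem_expr_gt0. Qed.

Lemma lt01_neq0 : q != 0.
Proof. by rewrite gt_eqF. Qed.

Lemma qbin_ge0 m k : 0 <= qbin q m k.
Proof.
have h j : 0 <= qpoch q q j.
  by rewrite /qpoch prodr_ge0// => i _; rewrite -exprS ltW// onem_expr_gt0.
by rewrite /qbin; case: ifP => // _; rewrite /qbinomz /qbinom divr_ge0// mulr_ge0.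
Qed.

Lemma bweight_ge0 m nu mu : 0 <= bweight q m nu mu.
Proof. by rewrite /bweight prodr_ge0// => i _; rewrite qbin_ge0. Qed.

Lemma bweight_same m (nu mu : nat -> int) : (forall i, (i < m)%N -> nu i = mu i) ->
  (forall i, mu i.+1 <= mu i) -> bweight q m nu mu = 1.
Proof.
move=> h d; rewrite /bweight big1// => i _.
by rewrite /bfactor h// subrr (qbin_m0 lt01_nroot)// subr_ge0.
Qed.

Lemma sum_gt0_mem (I : eqType) (s : seq I) (g : I -> R) i : i \in s ->
  (forall j, 0 <= g j) -> 0 < g i -> 0 < \sum_(j <- s) g j.
Proof.
move=> si g0 gi; rewrite (big_rem i)//=; apply: (lt_le_trans gi).
by rewrite lerDl sumr_ge0.
Qed.

(** All terms are nonnegative, and the term where la, mu and nu agree has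
    kernels equal to a power of the variable. *)
Lemma calP_gt0 n (a : 'rV[R]_n) la : (forall i, 0 < a ord0 i) -> dominant la ->
  0 < calP q la a.
Proof.
elim: n a la => [|n IH] a la a0 dla; first by rewrite /= ltr01.
have [N bla] := in_box_exists la.
have an0 i : a ord0 i != 0 by rewrite gt_eqF.
have T z : dominant z -> in_box N z ->
   calP q z a = branch_op q (a ord0 ord_max) N (fun nu => calP q nu (init_row a)) z.
  by move=> dz bz; exact: calPS.
rewrite T// /branch_op.
have ta0 i : 0 < init_row a ord0 i by rewrite mxE.
have x0 := a0 ord_max; set x := a ord0 ord_max in x0 *.
have ka0 mu : 0 <= upper_ker q x mu la by rewrite mulr_ge0 ?bweight_ge0// exprz_ge0// ltW.
have kb0 nu (mu : 'rV_n.+1) : 0 <= lower_ker q x nu mu by rewrite mulr_ge0 ?bweight_ge0// exprz_ge0// ltW.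
have inner_ge0 mu : upper_ker q x mu la != 0 ->
    forall nu, 0 <= lower_ker q x nu mu * calP q nu (init_row a).
  move=> kn nu; have [->|kn'] := eqVneq (lower_ker q x nu mu) 0; first by rewrite mul0r.
  rewrite mulr_ge0// ltW// IH//.
  by apply: (lower_ker_dom kn'); exact: (upper_ker_dom kn).
apply: (@sum_gt0_mem _ _ _ la); first by rewrite mem_box.
  move=> mu; have [->|kn] := eqVneq (upper_ker q x mu la) 0; first by rewrite mul0r.
  by rewrite mulr_ge0// sumr_ge0// => nu _; exact: inner_ge0.
have d := elimT (dominantP _) dla.
have kAll : upper_ker q x la la = 1 by rewrite /upper_ker subrr expr0z bweight_same ?mulr1.
rewrite kAll mul1r.
pose nu : 'rV[int]_n := \row_i la ord0 (widen_ord (leqnSn n) i).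
have nuE i : (i < n)%N -> part nu i = part la i.
  move=> ni; have /= -> := part_ord nu (Ordinal ni).
  have /= -> := part_ord la (Ordinal (leq_trans ni (leqnSn n))).
  by rewrite mxE; congr (la _ _); exact/val_inj.
apply: (@sum_gt0_mem _ _ _ nu).
- rewrite mem_box; apply/in_boxP => i; have [ni|ni] := leqP n i; first by rewrite part_ge.
  by rewrite nuE//; exact: (elimT (in_boxP _ _) bla).
- by apply: inner_ge0; rewrite kAll oner_neq0.
have kBn : 0 < lower_ker q x nu la by rewrite /lower_ker bweight_same ?mulr1 ?exprz_gt0.
rewrite mulr_gt0// IH//.
by apply: (lower_ker_dom (lt0r_neq0 kBn)).
Qed.

End Positivity.

(** * A monotonicity criterion *)

Section Dini.
Variables (R : realType) (f : R -> R).

(** A function with nonnegative lower right derivative and no downward jump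
    from the left cannot decrease.  For each slope -e, the supremum of the times
    up to which f stays above the line of slope -e is the end of the interval. *)
Lemma dini_nondecreasing (T : R) : 0 <= T ->
  (forall t e, 0 <= t -> 0 < e -> \forall h \near (0 : R)^'+, f t - e * h <= f (t + h)) ->
  (forall t e, 0 < t -> 0 < e -> \forall h \near (0 : R)^'+, 0 <= t - h -> f (t - h) - e <= f t) ->
  f 0 <= f T.
Proof.
move=> T0 right left; apply/ler_addgt0Pr => e0 e0_gt0.
(* A slope -e loses at most e * T <= e0 over the whole interval. *)
pose e := e0 / (T + 1).
have T1 : 0 < T + 1 by lra.
have e_gt0 : 0 < e by rewrite divr_gt0.
pose S := [set s | 0 <= s <= T /\ forall r, 0 <= r <= s -> f 0 - e * r <= f r].
have S0 : S 0.
  split=> [|r r0]; first by rewrite lexx.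
  have -> : r = 0 by lra.
  by rewrite mulr0 subr0.
have supS : has_sup S by split; [exists 0|exists T => s [/andP[]]].
set c := sup S.
have c0 : 0 <= c by apply: (ub_le_sup supS.2).
have cT : c <= T by apply: (ge_sup supS.1) => s [/andP[]].
have below r : 0 <= r -> r < c -> f 0 - e * r <= f r.
  move=> r0 rc; have cr : 0 < c - r by lra.
  have [s [sT hs] rs] := sup_adherent cr supS.
  by apply: hs; rewrite r0/= ltW//; rewrite /c in rs *; lra.
have fc : f 0 - e * c <= f c.
  have [->|c_neq0] := eqVneq c 0; first by rewrite mulr0 subr0.
  have c_gt0 : 0 < c by rewrite lt_neqAle eq_sym c_neq0.
  apply/ler_addgt0Pr => d d0.
  near (0 : R)^'+ => h.
  have h0 : 0 < h by near: h; exact: nbhs_right_gt.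
  have hc : h < c by near: h; exact: nbhs_right_lt.
  have : 0 <= c - h -> f (c - h) - d <= f c by near: h; exact: left.
  move=> /(_ ltac:(lra)) hl.
  have := below (c - h) ltac:(lra) ltac:(lra).
  have eh0 : 0 <= e * h by rewrite mulr_ge0// ltW.
  by rewrite mulrBr; lra.
have [cT'|cT'] := ltP c T; last first.
  have -> : T = c by lra.
  rewrite -lerBlDr; apply: le_trans fc; rewrite lerB// /e mulrAC ler_pdivrMr//.
  by rewrite ler_pM2l//; lra.
have [d /= d0 hd] := right c e c0 e_gt0.
pose m := Num.min (d / 2) (T - c).
have m0 : 0 < m by rewrite lt_min; apply/andP; split; lra.
have md : m < d by rewrite gt_min; apply/orP; left; lra.
have mT : m <= T - c by rewrite ge_min lexx orbT.
suff Scm : S (c + m) by have := ub_le_sup supS.2 Scm; rewrite -/c; lra.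
split=> [|r /andP[r0 rcm]]; first lra.
have [rc|rc] := ltP r c; first exact: below.
have [->//|rc'] := eqVneq r c.
have rc_gt0 : 0 < r - c by rewrite lt_neqAle eq_sym subr_eq0 rc'/=; lra.
have := hd (r - c); rewrite /= sub0r normrN gtr0_norm// => /(_ ltac:(lra) rc_gt0).
have -> : c + (r - c) = r by ring.
by rewrite mulrBr; lra.
Unshelve. all: by end_near. Qed.

End Dini.

(** * Partial sums of exponential series *)

Section ExpPartial.
Variable R : realType.

Definition exp_partial (k : nat) (x : R) : R := \sum_(j < k) x ^+ j / j`!%:R.

(** Truncated exponential generating function of the sequence c. *)
Definition egf_partial (c : nat -> R) (k : nat) (x : R) : R := \sum_(j < k) x ^+ j / j`!%:R * c j.

Lemma egf_partialS c k x : egf_partial c k.+1 x = egf_partial c k x + x ^+ k / k`!%:R * c k.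
Proof. by rewrite /egf_partial big_ord_recr. Qed.

Lemma egf_partial0 c k : egf_partial c k.+1 0 = c 0%N.
Proof.
rewrite /egf_partial big_ord_recl /= expr0 fact0 divr1 mul1r big1 ?addr0// => i _.
by rewrite exprS !mul0r.
Qed.

Lemma is_derive_egf_partial c k (x : R) :
  is_derive x 1 (egf_partial c k.+1) (egf_partial (fun j => c j.+1) k x).
Proof.
elim: k => [|k IH].
  have -> : egf_partial c 1 = cst (c 0%N).
    by apply/funext => y; rewrite /egf_partial big_ord1 expr0 fact0 divr1 mul1r.
  by rewrite /egf_partial big_ord0; exact: is_derive_cst.
have -> : egf_partial c k.+2 = egf_partial c k.+1 + (c k.+1 / k.+1`!%:R) \*: (id ^+ k.+1).
  apply/funext => y; rewrite egf_partialS fctE /= /GRing.scale /= fctE; congr (_ + _).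
  by ring.
rewrite egf_partialS; apply: is_deriveD.
apply: is_derive_eq.
rewrite factS natrM /GRing.scale /=.
have k0 : k.+1%:R != 0 :> R by rewrite pnatr_eq0.
have f0 : k`!%:R != 0 :> R by rewrite pnatr_eq0 -lt0n fact_gt0.
by field; apply/andP.
Qed.

Lemma exp_partial_cvg (x : R) : exp_partial k x @[k --> \oo] --> expR x.
Proof.
have := is_cvg_series_exp_coeff x; rewrite /expR.
suff -> : series (exp_coeff x) = (fun k => exp_partial k x) by [].
by apply/funext => k; rewrite /series /exp_coeff /exp_partial /= big_mkord.
Qed.

(** The tail of the series at x is dominated term by term by the tail at y; this
    gives uniform convergence on bounded sets. *)
Lemma exp_partial_remainder (x y : R) k : `|x| <= y ->
  `|expR x - exp_partial k x| <= expR y - exp_partial k y.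
Proof.
move=> xy.
have H m : `|exp_partial (m + k) x - exp_partial k x| <= exp_partial (m + k) y - exp_partial k y.
  rewrite addnC /exp_partial !big_split_ord /= !(addrC (\sum_(i < k) _)) !addrK.
  apply: le_trans (ler_norm_sum _ _ _) _; apply: ler_sum => i _.
  rewrite normrM normrX normfV normr_nat ler_wpM2r ?invr_ge0//.
  by apply: lerXn2r; rewrite ?nnegrE// (le_trans _ xy).
have c1 z : exp_partial (m + k) z @[m --> \oo] --> expR z.
  by have := exp_partial_cvg (x := z); rewrite -(cvg_shiftn k).
have c2 : `|exp_partial (m + k) x - exp_partial k x| @[m --> \oo] --> `|expR x - exp_partial k x|.
  by apply: cvg_norm; apply: cvgB => //; exact: cvg_cst.
have c3 : exp_partial (m + k) y - exp_partial k y @[m --> \oo] --> expR y - exp_partial k y.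
  by apply: cvgB => //; exact: cvg_cst.
by apply: (ler_cvg_to c2 c3); exact: nearW.
Qed.

End ExpPartial.

(** * Markov chains with bounded conservative rates *)

Section BoundedRates.
Variables (R : realType) (S : countType) (p : R -> S -> S -> R) (Q : S -> S -> R).
Variables (E : R) (nbr : S -> seq S).
Hypotheses (p_trans : transition_function p) (p_rates : has_rates p Q).
Hypotheses (nbr_uniq : forall x, uniq (nbr x)) (nbr_irr : forall x, x \notin nbr x).
Hypotheses (Q_diag : forall x, Q x x = - E).
Hypotheses (Q_ge0 : forall x w, w \in nbr x -> 0 <= Q x w).
Hypotheses (Q_sum : forall x, \sum_(w <- nbr x) Q x w = E).

(** The k-th power of the off-diagonal part of Q. *)
Fixpoint jumps (k : nat) (x y : S) : R :=
  if k is k'.+1 then \sum_(w <- nbr x) Q x w * jumps k' w y else (x == y)%:R.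

(** A finite list containing the states that k jumps from x can reach. *)
Fixpoint reach (k : nat) (x : S) : seq S :=
  if k is k'.+1 then flatten [seq reach k' w | w <- nbr x] else [:: x].

Local Notation J x y := (egf_partial (fun k => jumps k x y)).

Lemma exit_rate_ge0 (x : S) : 0 <= E.
Proof. by rewrite -(Q_sum x) big_seq sumr_ge0// => w; exact: Q_ge0. Qed.

Lemma jumps_mass k x s : uniq s -> {subset reach k x <= s} ->
  \sum_(y <- s) jumps k x y = E ^+ k.
Proof.
move=> us; elim: k x => [|k IH] x sub /=.
  rewrite (bigD1_seq x)//=; last by apply: sub; rewrite inE.
  by rewrite eqxx big1 ?addr0// => w /negbTE; rewrite eq_sym => ->.
rewrite exchange_big /= exprS -{1}(Q_sum x) mulr_suml.
rewrite big_seq [RHS]big_seq; apply: eq_bigr => w wx.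
rewrite -mulr_sumr IH// => v vw; apply: sub => /=.
by apply/flatten_mapP; exists w.
Qed.

Lemma transition_ge0 t x y : 0 <= t -> 0 <= p t x y.
Proof. by case: p_trans => h _ _ _; exact: h. Qed.

Lemma le_esum_seq (a : S -> R) s : uniq s -> (forall y, 0 <= a y) ->
  ((\sum_(y <- s) a y)%:E <= \esum_(y in [set: S]) (a y)%:E)%E.
Proof.
move=> us a0; apply: esum_ge; exists [set` s].
  by split; [exact: finite_seq|].
by rewrite -(fsbig_seq _ _ us) sumEFin.
Qed.

Lemma transition_sum_le1 t x s : 0 <= t -> uniq s -> \sum_(y <- s) p t x y <= 1.
Proof.
move=> t0 us; rewrite -lee_fin; case: p_trans => _ h _ _; rewrite -(h t x t0).
by apply: le_esum_seq => // y; exact: transition_ge0.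
Qed.

Lemma transition_le1 t x y : 0 <= t -> p t x y <= 1.
Proof. by move=> t0; have := @transition_sum_le1 t x [:: y] t0 isT; rewrite big_seq1. Qed.

Lemma transition0 x y : p 0 x y = (x == y)%:R.
Proof. by case: p_trans. Qed.

(** The Chapman-Kolmogorov sum has nonnegative terms, so any finite part of it
    is a lower bound. *)
Lemma transition_CK_ge u t x y s : 0 <= u -> 0 <= t -> uniq s ->
  \sum_(w <- s) p u x w * p t w y <= p (u + t) x y.
Proof.
move=> u0 t0 us; rewrite -lee_fin; case: p_trans => _ _ _ ->//.
by apply: le_esum_seq => // w; rewrite mulr_ge0// transition_ge0.
Qed.

Lemma transition_diag_cvg x : p h x x @[h --> (0 : R)^'+] --> (1 : R).
Proof.
have h1 : h * ((p h x x - (x == x)%:R) / h) + 1 @[h --> (0 : R)^'+] --> 0 * Q x x + 1.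
  apply: cvgD; last exact: cvg_cst.
  apply: cvgM; last exact: p_rates.
  by apply: cvg_at_right_filter; exact: cvg_id.
rewrite mul0r add0r in h1; apply: cvg_trans h1; apply: near_eq_cvg.
near=> h; have h0 : h != 0 by rewrite gt_eqF//; near: h; exact: nbhs_right_gt.
by rewrite eqxx mulrC divfK// subrK.
Unshelve. all: by end_near. Qed.

Lemma egf_partial_quotient c k (t : R) :
  (egf_partial c k.+1 (t + h) - egf_partial c k.+1 t) / h @[h --> (0 : R)^'+]
    --> egf_partial (fun j => c j.+1) k t.
Proof.
have [d1 d2] := is_derive_egf_partial c k t.
have : h^-1 *: (egf_partial c k.+1 (h *: 1 + t) - egf_partial c k.+1 t) @[h --> (0:R)^'] --> egf_partial (fun j => c j.+1) k t.
  by rewrite -d2; exact: d1.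
move=> /cvg_dnbhs_at_right; apply: cvg_trans; apply: near_eq_cvg.
near=> h; rewrite /GRing.scale /= mulr1 mulrC (addrC t) //.
Unshelve. all: by end_near. Qed.

Lemma egf_partial_continuous c k : continuous (egf_partial c k : R -> R).
Proof.
move=> t; apply: differentiable_continuous; apply/derivable1_diffP.
case: k => [|k]; last by case: (is_derive_egf_partial c k t).
have -> : egf_partial c 0 = cst 0 by apply/funext => y; rewrite /egf_partial big_ord0.
exact: derivable_cst.
Qed.

Lemma egf_partial_jumps k x y t :
  egf_partial (fun j => jumps j.+1 x y) k t = \sum_(w <- nbr x) Q x w * J w y k t.
Proof.
rewrite /egf_partial; under eq_bigr do rewrite /= mulr_sumr.
rewrite exchange_big; apply: eq_bigr => w _; rewrite mulr_sumr.
by apply: eq_bigr => j _; rewrite /= mulrCA.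
Qed.

(** Induction on the number of jumps.  For the function
    f(t) = exp(t E) p_t(x, y) - (partial sum), the Chapman-Kolmogorov bound over x
    and its neighbours shows that the lower right derivative is at least
    sum_w Q(x, w) (exp(t E) p_t(w, y) - (shorter partial sum at w)), which is
    nonnegative by induction, and f has no downward jump since p_h(x, x) tends
    to 1. *)
Lemma transition_ge_partial k t x y : 0 <= t -> J x y k t <= expR (t * E) * p t x y.
Proof.
elim: k t x => [|k IH] t x t0.
  by rewrite /egf_partial big_ord0 mulr_ge0 ?expR_ge0 ?transition_ge0.
have Ege0 := exit_rate_ge0 x.
pose f s := expR (s * E) * p s x y - J x y k.+1 s.
suff : f 0 <= f t.
  by rewrite /f egf_partial0 mul0r expR0 mul1r transition0 subrr subr_ge0.
apply: dini_nondecreasing => // {t0} {}t e t0 e0.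
- pose g h := expR (t * E) *
      ((((p h x x - (x == x)%:R) / h + E * p h x x) * p t x y)
       + \sum_(w <- nbr x) (p h x w - (x == w)%:R) / h * p t w y)
      - (J x y k.+1 (t + h) - J x y k.+1 t) / h.
  pose L := expR (t * E) * (((- E + E * 1) * p t x y) + \sum_(w <- nbr x) Q x w * p t w y)
     - egf_partial (fun j => jumps j.+1 x y) k t.
  have gL : g h @[h --> (0 : R)^'+] --> L.
    apply: cvgB; last exact: egf_partial_quotient.
    apply: cvgM; first exact: cvg_cst.
    apply: cvgD.
      apply: cvgM; last exact: cvg_cst.
      apply: cvgD; first by rewrite -(Q_diag x); exact: p_rates.
      by apply: cvgM; [exact: cvg_cst|exact: transition_diag_cvg].
    elim: (nbr x) => [|w r IHr].
      by under eq_cvg do rewrite big_nil; rewrite big_nil; exact: cvg_cst.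
    under eq_cvg do rewrite big_cons; rewrite big_cons; apply: cvgD => //.
    by apply: cvgM; [exact: p_rates|exact: cvg_cst].
  (* The contributions of the state x itself cancel in the limit, as
     Q x x + E = 0. *)
  have L0 : 0 <= L.
    rewrite /L mulr1 addNr mul0r add0r egf_partial_jumps mulr_sumr -sumrB big_seq.
    rewrite sumr_ge0// => w wx; rewrite mulrCA -mulrBr mulr_ge0 ?Q_ge0// subr_ge0.
    exact: IH.
  near=> h.
  have h0 : 0 < h by near: h; exact: nbhs_right_gt.
  have ge : - e <= g h.
    near: h; apply: (cvgr_ge _ gL); lra.
  have th : 0 <= t + h by lra.
  have CK := @transition_CK_ge h t x y (x :: nbr x) (ltW h0) t0.
  have {}CK := CK ltac:(by rewrite /= nbr_irr nbr_uniq).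
  rewrite big_cons in CK.
  rewrite [h + t]addrC in CK.
  set A := p h x x in CK *; set B := p t x y in CK *.
  set C := \sum_(w <- _) _ in CK.
  have B0 : 0 <= B by exact: transition_ge0.
  have A0 : 0 <= A by apply: transition_ge0; exact: ltW.
  have C0 : 0 <= C by rewrite sumr_ge0// => w _; rewrite mulr_ge0// transition_ge0// ltW.
  have gE : h * g h = expR (t * E) * ((A - 1 + h * E * A) * B + C)
      - (J x y k.+1 (t + h) - J x y k.+1 t).
    have hn : h != 0 by rewrite gt_eqF.
    rewrite /g eqxx -/A -/B.
    have -> : \sum_(w <- nbr x) (p h x w - (x == w)%:R) / h * p t w y = C / h.
      rewrite /C mulr_suml big_seq [RHS]big_seq; apply: eq_bigr => w wx.
      have -> : (x == w) = false.
        by apply/eqP => xw; have := nbr_irr x; rewrite {1}xw wx.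
      by rewrite subr0 mulrAC.
    rewrite (_ : true%:R = 1 :> R)//; clearbody A B C.
    by field.
  have exph : 1 + h * E <= expR (h * E) by exact: expR_ge1Dx.
  have hE : 0 <= h * E by rewrite mulr_ge0// ltW.
  (* Either no jump, or one jump to a neighbour, during the time h. *)
  have step : expR (t * E) * ((A - 1 + h * E * A) * B + C) + expR (t * E) * B
      <= expR ((t + h) * E) * p (t + h) x y.
    rewrite [(t + h) * E]mulrDl expRD -mulrDr -[leRHS]mulrA ler_wpM2l ?expR_ge0//.
    apply: (@le_trans _ _ ((1 + h * E) * (A * B + C))).
      have : 0 <= h * E * C by rewrite mulr_ge0.
      by lra.
    apply: ler_pM => //; first by rewrite addr_ge0.
    by rewrite addr_ge0// mulr_ge0.
  have : h * - e <= h * g h by rewrite ler_wpM2l// ltW.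
  rewrite gE /f -/B; lra.
- have c1 : (1 - p h x x) * expR (t * E) + `|J x y k.+1 t - J x y k.+1 (t - h)|
      @[h --> (0 : R)^'+] --> (1 - 1) * expR (t * E) + `|J x y k.+1 t - J x y k.+1 (t - 0)|.
    apply: cvgD.
      apply: cvgM; last exact: cvg_cst.
      by apply: cvgB; [exact: cvg_cst|exact: transition_diag_cvg].
    apply: cvg_norm; apply: cvgB; first exact: cvg_cst.
    apply: cvg_at_right_filter.
    apply: (@cvg_comp _ _ _ (fun h => t - h) (J x y k.+1)); last exact: egf_partial_continuous.
    by apply: cvgB; [exact: cvg_cst|exact: cvg_id].
  rewrite subr0 !subrr normr0 mul0r addr0 in c1.
  near=> h => th.
  have h0 : 0 < h by near: h; exact: nbhs_right_gt.
  have small : (1 - p h x x) * expR (t * E) + `|J x y k.+1 t - J x y k.+1 (t - h)| <= e.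
    by near: h; apply: (cvgr_le _ c1).
  have CK := @transition_CK_ge h (t - h) x y [:: x] (ltW h0) th isT.
  rewrite big_seq1 [h + _]addrC subrK in CK.
  set A := p h x x in CK small; set B := p (t - h) x y in CK.
  have A0 : 0 <= A by apply: transition_ge0; exact: ltW.
  have A1 : A <= 1 by apply: transition_le1; exact: ltW.
  have B0 : 0 <= B by exact: transition_ge0.
  have B1 : B <= 1 by exact: transition_le1.
  rewrite /f -/B.
  have tt : expR (t * E) = expR ((t - h) * E) * expR (h * E).
    by rewrite -expRD; congr expR; ring.
  have exph : 1 <= expR (h * E).
    by have := expR_ge1Dx (h * E); have : 0 <= h * E by [rewrite mulr_ge0// ltW]; lra.
  have m0 : 0 <= expR ((t - h) * E) by exact: expR_ge0.
  have m1 : expR ((t - h) * E) <= expR (t * E) by rewrite tt ler_peMr.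
  have : expR ((t - h) * E) * (A * B) <= expR (t * E) * p t x y.
    by apply: ler_pM => //; rewrite mulr_ge0.
  have : expR ((t - h) * E) * ((1 - A) * B) <= expR (t * E) * (1 - A).
    apply: ler_pM => //; first by rewrite mulr_ge0// subr_ge0.
    by rewrite ler_piMr// subr_ge0.
  have := ler_norm (J x y k.+1 t - J x y k.+1 (t - h)).
  by lra.
Unshelve. all: by end_near. Qed.

(** Both sides of [transition_ge_partial] are summed over y: the total masses
    are at most exp(t E) and exactly its partial sum, so each gap is at most the
    gap of the masses. *)
Lemma transition_le_partial k t x y : 0 <= t ->
  expR (t * E) * p t x y - J x y k t <= expR (t * E) - exp_partial k (t * E).
Proof.
move=> t0.
(* The states within k jumps carry all of the partial sum; y is added so that
   its gap is one of the terms. *)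
pose s := undup (y :: flatten [seq reach j x | j <- iota 0 k]).
have us : uniq s by exact: undup_uniq.
have ys : y \in s by rewrite mem_undup inE eqxx.
have : \sum_(w <- s) (expR (t * E) * p t x w - J x w k t) <= expR (t * E) - exp_partial k (t * E).
  rewrite sumrB -mulr_sumr lerB//.
    by rewrite -[leRHS]mulr1 ler_wpM2l ?expR_ge0// transition_sum_le1.
  rewrite /exp_partial /egf_partial exchange_big /=; apply: ler_sum => j _.
  rewrite -mulr_sumr jumps_mass//; first by rewrite exprMn mulrAC.
  move=> w wj; rewrite mem_undup inE; apply/orP; right; apply/flatten_mapP.
  by exists (j : nat) => //; rewrite mem_iota /= add0n ltn_ord.
apply: le_trans; rewrite (bigD1_seq y)//= lerDl sumr_ge0// => w _.
by rewrite subr_ge0 transition_ge_partial.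
Qed.

(** The transition function with bounded conservative rates is the exponential
    of its rate matrix. *)
Theorem transition_exponential t x y : 0 <= t ->
  J x y k t @[k --> \oo] --> expR (t * E) * p t x y.
Proof.
move=> t0.
have c : expR (t * E) * p t x y - (expR (t * E) - exp_partial k (t * E)) @[k --> \oo]
    --> expR (t * E) * p t x y.
  rewrite -[X in _ --> X]subr0; apply: cvgB; first exact: cvg_cst.
  rewrite -(subrr (expR (t * E))); apply: cvgB; first exact: cvg_cst.
  exact: exp_partial_cvg.
apply: (squeeze_cvgr _ c (cvg_cst _)).
near=> k; apply/andP; split; last exact: transition_ge_partial.
by have := @transition_le_partial k t x y t0; lra.
Unshelve. all: by end_near. Qed.

End BoundedRates.

(** * Iterated integrals of bounded Lipschitz functions *)

Section BoundedLipschitz.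
Variable R : realType.

(** The Lipschitz condition refers to the sup distance, tested against an upper
    bound d so that it also makes sense without coordinates. *)
Definition blip n (f : 'rV[R]_n -> R) : Prop := exists K : R,
  [/\ 0 <= K, forall u, `|f u| <= K
    & forall (u v : 'rV[R]_n) d, 0 <= d -> (forall j, `|u ord0 j - v ord0 j| <= d) ->
        `|f u - f v| <= K * d].

Lemma blip_cst n (c : R) : blip (fun _ : 'rV[R]_n => c).
Proof.
exists `|c|; split=> // u v d d0 _.
by rewrite subrr normr0 mulr_ge0.
Qed.

Lemma blipD n (f g : 'rV[R]_n -> R) : blip f -> blip g -> blip (fun u => f u + g u).
Proof.
move=> [K [K0 Kb Kl]] [L [L0 Lb Ll]]; exists (K + L); split=> [|u|u v d d0 uv].
- exact: addr_ge0.
- by apply: le_trans (ler_normD _ _) _; exact: lerD.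
- rewrite opprD addrACA mulrDl; apply: le_trans (ler_normD _ _) _.
  by apply: lerD; [exact: Kl|exact: Ll].
Qed.

Lemma blipM n (f g : 'rV[R]_n -> R) : blip f -> blip g -> blip (fun u => f u * g u).
Proof.
move=> [K [K0 Kb Kl]] [L [L0 Lb Ll]]; exists (K * L + K * L); split=> [|u|u v d d0 uv].
- by rewrite addr_ge0// mulr_ge0.
- rewrite normrM; have : `|f u| * `|g u| <= K * L by exact: ler_pM.
  have : 0 <= K * L by exact: mulr_ge0.
  by lra.
- have -> : f u * g u - f v * g v = f u * (g u - g v) + (f u - f v) * g v by ring.
  apply: le_trans (ler_normD _ _) _; rewrite !normrM mulrDl.
  have Lu := Ll u v d d0 uv; have Ku := Kl u v d d0 uv.
  apply: lerD.
    by rewrite -mulrA; apply: ler_pM.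
  by rewrite -mulrA [L * d]mulrC mulrA; apply: ler_pM.
Qed.

Lemma blipZ n c (f : 'rV[R]_n -> R) : blip f -> blip (fun u => c * f u).
Proof. by move=> bf; apply: blipM => //; exact: blip_cst. Qed.

Lemma blipN n (f : 'rV[R]_n -> R) : blip f -> blip (fun u => - f u).
Proof.
by move=> /(blipZ (-1)); congr (blip _); apply/funext => u; rewrite mulN1r.
Qed.

Lemma blipB n (f g : 'rV[R]_n -> R) : blip f -> blip g -> blip (fun u => f u - g u).
Proof. by move=> bf bg; apply: blipD => //; exact: blipN. Qed.

Lemma blip_sum n (I : Type) (r : seq I) (f : I -> 'rV[R]_n -> R) :
  (forall i, blip (f i)) -> blip (fun u => \sum_(i <- r) f i u).
Proof.
move=> bf; elim: r => [|i r IH].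
  by under eq_fun do rewrite big_nil; exact: blip_cst.
by under eq_fun do rewrite big_cons; exact: blipD.
Qed.

Lemma blip_prod n (I : Type) (r : seq I) (P : pred I) (f : I -> 'rV[R]_n -> R) :
  (forall i, blip (f i)) -> blip (fun u => \prod_(i <- r | P i) f i u).
Proof.
move=> bf; elim: r => [|i r IH].
  by under eq_fun do rewrite big_nil; exact: blip_cst.
under eq_fun do rewrite big_cons.
by case: (P i) => //; exact: blipM.
Qed.

(** The inner function l need not be bounded; it is an angle such as
    th_j + th_k in the applications. *)
Lemma blip_comp n (g : R -> R) (l : 'rV[R]_n -> R) K c :
  0 <= K -> (forall x, `|g x| <= K) -> (forall x y, `|g x - g y| <= K * `|x - y|) ->
  0 <= c -> (forall (u v : 'rV[R]_n) d, 0 <= d -> (forall j, `|u ord0 j - v ord0 j| <= d) ->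
        `|l u - l v| <= c * d) ->
  blip (fun u => g (l u)).
Proof.
move=> K0 Kb Kl c0 lc; exists (K * (1 + c)); split=> [|u|u v d d0 uv].
- by rewrite mulr_ge0// addr_ge0.
- by apply: le_trans (Kb _) _; rewrite ler_peMr// lerDl.
- apply: le_trans (Kl _ _) _; rewrite -mulrA ler_wpM2l//.
  by apply: le_trans (lc _ _ _ d0 uv) _; rewrite ler_wpM2r// lerDr.
Qed.

Definition slice n (f : 'rV[R]_n.+1 -> R) (x : R) : 'rV[R]_n -> R :=
  fun v => f (row_mx (x%:M : 'rV[R]_1) v).

Lemma slice_blip n (f : 'rV[R]_n.+1 -> R) x : blip f -> blip (slice f x).
Proof.
move=> [K [K0 Kb Kl]]; exists K; split=> [//|u|u v d d0 uv]; first exact: Kb.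
apply: Kl => // j; rewrite !mxE; case: split_ordP => k _.
  by rewrite subrr normr0.
exact: uv.
Qed.

Lemma slice_dist n (f : 'rV[R]_n.+1 -> R) K x y v :
  (forall (u v : 'rV[R]_n.+1) d, 0 <= d -> (forall j, `|u ord0 j - v ord0 j| <= d) ->
        `|f u - f v| <= K * d) ->
  `|slice f x v - slice f y v| <= K * `|x - y|.
Proof.
move=> Kl; apply: Kl => // j; rewrite !mxE; case: split_ordP => k _.
  by rewrite !mxE (ord1 k) eqxx !mulr1n.
by rewrite subrr normr0.
Qed.

Definition lipschitz1 (h : R -> R) : Prop :=
  exists2 K, 0 <= K & forall x y, `|h x - h y| <= K * `|x - y|.

Lemma lipschitz1_continuous h : lipschitz1 h -> continuous h.
Proof.
move=> [K K0 Kl] x; apply/cvgrPdist_lt => e e0.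
have K1 : 0 < K + 1 by lra.
near=> y; apply: le_lt_trans (Kl _ _) _.
have xy : `|x - y| < e / (K + 1).
  by near: y; apply: cvgr_dist_lt; [exact: cvg_id|rewrite divr_gt0].
apply: (@le_lt_trans _ _ ((K + 1) * `|x - y|)).
  by rewrite ler_wpM2r//; lra.
by rewrite mulrC -ltr_pdivlMr.
Unshelve. all: by end_near. Qed.

Local Notation mu := (@lebesgue_measure R).
Local Notation D := (`[0, 2 * pi]%classic : set R).

Lemma lipschitz1_integrable h a b : lipschitz1 h ->
  mu.-integrable `[a, b] (EFin \o h).
Proof.
move=> /lipschitz1_continuous ch; apply: continuous_compact_integrable.
  exact: segment_compact.
by apply: continuous_subspaceT.
Qed.

Lemma fine_itv (a b : R) : a <= b -> fine (mu `[a, b]) = b - a.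
Proof.
move=> ab; rewrite lebesgue_measure_itv /= lte_fin.
have [ab'|ab'] := ltP a b => //=.
by apply/esym/eqP; rewrite subr_eq0 eq_le ab' ab.
Qed.

Lemma twopi_ge0 : 0 <= 2 * pi :> R.
Proof. by rewrite mulr_ge0// pi_ge0. Qed.

(** Bundled for the induction on n: integrability of the outer variable comes
    from the Lipschitz bound of the inner integral, which in turn uses
    monotonicity and the integral of constants one level below. *)
Definition box_facts n : Prop :=
  [/\ forall f g : 'rV[R]_n -> R, blip f -> blip g ->
        box_integral (fun u => f u + g u) = box_integral f + box_integral g,
      forall c (f : 'rV[R]_n -> R), blip f ->
        box_integral (fun u => c * f u) = c * box_integral f,
      forall f g : 'rV[R]_n -> R, blip f -> blip g -> (forall u, f u <= g u) ->
        box_integral f <= box_integral g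
    & forall c, box_integral (fun _ : 'rV[R]_n => c) = c * (2 * pi) ^+ n].

Lemma box_slice_lipschitz n (f : 'rV[R]_n.+1 -> R) : box_facts n -> blip f ->
  lipschitz1 (fun x => box_integral (slice f x)).
Proof.
move=> [bD bZ ble bc] bf; have [K [K0 Kb Kl]] := bf.
exists (K * (2 * pi) ^+ n) => [|x y]; first by rewrite mulr_ge0// exprn_ge0// twopi_ge0.
have half s t : box_integral (slice f s) <=
     box_integral (slice f t) + K * (2 * pi) ^+ n * `|s - t|.
  have -> : K * (2 * pi) ^+ n * `|s - t| = (K * `|s - t|) * (2 * pi) ^+ n by ring.
  rewrite -bc -bD; [|exact: slice_blip|exact: blip_cst].
  apply: ble => [||u]; [exact: slice_blip|apply: blipD; [exact: slice_blip|exact: blip_cst]|].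
  have := slice_dist s t u Kl; have := ler_norm (slice f s u - slice f t u); lra.
have h1 := half x y; have h2 := half y x.
by rewrite ler_norml [`|x - y|]distrC; rewrite distrC in h1; apply/andP; split; lra.
Qed.

Lemma box_factsP n : box_facts n.
Proof.
elim: n => [|n IH].
  by split=> //= c; rewrite expr0 mulr1.
have int (f : 'rV[R]_n.+1 -> R) : blip f -> mu.-integrable D (EFin \o (fun x => box_integral (slice f x))).
  by move=> bf; apply: lipschitz1_integrable; exact: box_slice_lipschitz.
have mD : measurable D by exact: measurable_itv.
have [bD bZ ble bc] := IH; split => [f g bf bg|c f bf|f g bf bg fg|c] /=.
- rewrite -RintegralD//; [|exact: int|exact: int].
  by apply: eq_Rintegral => x _; rewrite -bD; [|exact: slice_blip|exact: slice_blip].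
- rewrite -RintegralZl//; last exact: int.
  by apply: eq_Rintegral => x _; rewrite -bZ//; exact: slice_blip.
- apply: le_Rintegral => //; [exact: int|exact: int|] => x _.
  by apply: ble; [exact: slice_blip|exact: slice_blip|move=> u; exact: fg].
- under eq_Rintegral do rewrite bc.
  rewrite Rintegral_cst//.
  by rewrite [X in _ * X](_ : _ = 2 * pi) ?exprSr ?mulrA// (fine_itv twopi_ge0) subr0.
Qed.

Lemma box_integralD n (f g : 'rV[R]_n -> R) : blip f -> blip g ->
  box_integral (fun u => f u + g u) = box_integral f + box_integral g.
Proof. by case: (box_factsP n) => h _ _ _; exact: h. Qed.

Lemma box_integralZ n c (f : 'rV[R]_n -> R) : blip f ->
  box_integral (fun u => c * f u) = c * box_integral f.
Proof. by case: (box_factsP n) => _ h _ _; exact: h. Qed.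

Lemma box_integral_norm n (f : 'rV[R]_n -> R) e : blip f ->
  (forall u, `|f u| <= e) -> `|box_integral f| <= e * (2 * pi) ^+ n.
Proof.
case: (box_factsP n) => _ _ ble bc bf fe; rewrite ler_norml -mulNr -!bc.
by apply/andP; split; apply: ble => //; try exact: blip_cst;
  move=> u; have := fe u; rewrite ler_norml => /andP[].
Qed.

(** By induction the inner integral is positive at the first coordinate of u0,
    hence bounded below on an interval around it by the Lipschitz bound. *)
Lemma box_integral_gt0 n (f : 'rV[R]_n -> R) (u0 : 'rV[R]_n) : blip f ->
  (forall u, 0 <= f u) -> (forall j, 0 < u0 ord0 j < 2 * pi) -> 0 < f u0 ->
  0 < box_integral f.
Proof.
elim: n f u0 => [|n IH] f u0 bf f0 u0j fu0 /=.
  by rewrite (_ : 0 = u0)//; apply/rowP => -[].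
pose h x := box_integral (slice f x).
have h_ge0 x : 0 <= h x.
  have [_ _ ble bc] := box_factsP n.
  rewrite -(mul0r ((2 * pi) ^+ n)) -bc; apply: ble => [||u]; last exact: f0.
    exact: blip_cst.
  exact: slice_blip.
have lh : lipschitz1 h by apply: box_slice_lipschitz => //; exact: box_factsP.
pose x0 := u0 ord0 ord0.
pose v0 : 'rV[R]_n := \row_j u0 ord0 (lift ord0 j).
have u0E : row_mx (x0%:M : 'rV[R]_1) v0 = u0.
  apply/rowP => j; rewrite mxE; case: split_ordP => k ->.
    by rewrite !mxE (ord1 k) eqxx mulr1n; congr (u0 _ _); exact/val_inj.
  by rewrite mxE; congr (u0 _ _); exact/val_inj.
have hx0 : 0 < h x0.
  apply: (IH _ v0); [exact: slice_blip|by move=> u; exact: f0| |by rewrite /slice u0E].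
  by move=> j; rewrite mxE.
have [K K0 Kl] := lh.
have /andP[x0_gt0 x0_lt] := u0j ord0.
(* With this radius h stays above c / 2 on the interval, which is contained in
   the domain of integration. *)
pose c := h x0; pose r := Num.min (c / (2 * (K + 1))) (Num.min x0 (2 * pi - x0)).
have K1 : 0 < K + 1 by lra.
have r0 : 0 < r by rewrite !lt_min divr_gt0 ?mulr_gt0// x0_gt0 subr_gt0.
have rc : r <= c / (2 * (K + 1)) by rewrite ge_min lexx.
have rx : r <= x0 by rewrite !ge_min lexx orbT.
have rx' : r <= 2 * pi - x0 by rewrite !ge_min lexx !orbT.
have low x : `|x - x0| <= r -> c / 2 <= h x.
  move=> xr; have := Kl x0 x; rewrite distrC => hk.
  have : K * `|x0 - x| <= c / 2.
    rewrite distrC; apply: (@le_trans _ _ ((K + 1) * r)).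
      by apply: ler_pM => //; lra.
    move: rc; rewrite ler_pdivlMr ?mulr_gt0//; lra.
  have := ler_norm (h x0 - h x); rewrite distrC in hk; rewrite -/c; lra.
pose D' := `[x0 - r, x0 + r]%classic : set R.
have sub : D' `<=` D.
  move=> x; rewrite /D' /= !in_itv /= => /andP[h1 h2]; apply/andP; split; lra.
have mD' : measurable D' by exact: measurable_itv.
have mD : measurable D by exact: measurable_itv.
have DE : D = D' `|` (D `\` D') by rewrite setDUK.
rewrite -[X in 0 < X]/(Rintegral mu D h) DE Rintegral_setU//; first last.
- apply/disj_setPS => x [] // xD' [_]; exact.
- by rewrite -DE; exact: lipschitz1_integrable.
- exact: measurableD.
have : 0 <= Rintegral mu (D `\` D') h.
  by apply: Rintegral_ge0 => x _; exact: h_ge0.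
have : (c / 2) * (r * 2) <= Rintegral mu D' h.
  have -> : (c / 2) * (r * 2) = Rintegral mu D' (fun=> c / 2).
    rewrite Rintegral_cst//; congr (_ * _); rewrite fine_itv; lra.
  apply: le_Rintegral => //; [| exact: lipschitz1_integrable|].
    apply: lipschitz1_integrable; exists 0 => // x y.
    by rewrite subrr normr0 mul0r.
  move=> x; rewrite /D' /= in_itv /= => /andP[h1 h2]; apply: low.
  by rewrite ler_norml; apply/andP; split; lra.
have : 0 < (c / 2) * (r * 2) by rewrite mulr_gt0//; rewrite /c; lra.
lra.
Qed.

End BoundedLipschitz.

(** * The unit circle *)

Section ComplexModulus.
Variable R : realType.
Local Notation C := R[i].
Local Notation normc := (@ComplexField.Normc.normc R).

Lemma normcE (z : C) : normc z = Num.sqrt (complex.Re z ^+ 2 + complex.Im z ^+ 2).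
Proof. by case: z. Qed.

Lemma normc_ge0 (z : C) : 0 <= normc z.
Proof. by rewrite normcE sqrtr_ge0. Qed.

Lemma normc_triangle (z w : C) : normc (z + w) <= normc z + normc w.
Proof. exact: (@le_normcD R). Qed.

Lemma normcB_triangle (z w : C) : normc z - normc w <= normc (z - w).
Proof. by have := normc_triangle (z - w) w; rewrite subrK; lra. Qed.

Lemma Re_le_normc (z : C) : `|complex.Re z| <= normc z.
Proof. by rewrite normcE -sqrtr_sqr ler_wsqrtr// lerDl sqr_ge0. Qed.

Lemma Im_le_normc (z : C) : `|complex.Im z| <= normc z.
Proof. by rewrite normcE -sqrtr_sqr ler_wsqrtr// lerDr sqr_ge0. Qed.

Lemma normc_le_ReIm (z : C) : normc z <= `|complex.Re z| + `|complex.Im z|.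
Proof.
rewrite normcE -[leRHS]ger0_norm ?addr_ge0// -sqrtr_sqr ler_wsqrtr//.
rewrite sqrrD !real_normK ?num_real//; have : 0 <= `|complex.Re z| * `|complex.Im z| by rewrite mulr_ge0.
lra.
Qed.

Lemma normc_sqr (z : C) : normc z ^+ 2 = complex.Re z ^+ 2 + complex.Im z ^+ 2.
Proof. by rewrite normcE sqr_sqrtr// addr_ge0// sqr_ge0. Qed.

Lemma normc_toC (x : R) : normc (toC x) = `|x|.
Proof. by rewrite normcE /= expr0n addr0 sqrtr_sqr. Qed.

Lemma norm_toC_normc (z : C) : `|z| = toC (normc z).
Proof. by rewrite normcE normc_def. Qed.

(** Convergence of real and imaginary parts, in the topology given by the
    complex modulus. *)
Lemma cvg_complex (u : nat -> C) (a b : R) :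
  complex.Re (u m) @[m --> \oo] --> a -> complex.Im (u m) @[m --> \oo] --> b ->
  (fun m => u m : C^o) @ \oo --> ((a +i* b)%C : C^o).
Proof.
move=> ca cb; apply/cvgrPdist_lt => e.
case: e => e1 e2; rewrite ltcE /= => /andP[/eqP -> e0].
near=> m.
rewrite [X in X < _]norm_toC_normc ltcR.
apply: le_lt_trans (normc_le_ReIm _) _.
have h1 : `|a - complex.Re (u m)| < e1 / 2.
  by near: m; apply: cvgr_dist_lt => //; rewrite divr_gt0.
have h2 : `|b - complex.Im (u m)| < e1 / 2.
  by near: m; apply: cvgr_dist_lt => //; rewrite divr_gt0.
move: h1 h2; case: (u m) => r i /=; lra.
Unshelve. all: by end_near. Qed.

Definition cis (x : R) : C := (cos x +i* sin x)%C.

Lemma cisD x y : cis (x + y) = cis x * cis y.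
Proof.
rewrite /cis cosD sinD; apply/eqP; rewrite eq_complex /=.
by apply/andP; split; apply/eqP; ring.
Qed.

Lemma cis0 : cis 0 = 1.
Proof. by rewrite /cis cos0 sin0. Qed.

Lemma normc_cis x : normc (cis x) = 1.
Proof. by rewrite normcE /= cos2Dsin2 sqrtr1. Qed.

Lemma cis_neq0 x : cis x != 0.
Proof.
apply/eqP => h; have := normc_cis x; rewrite h ComplexField.Normc.normc0 => /eqP.
by rewrite eq_sym oner_eq0.
Qed.

Lemma cisN x : cis (- x) = (cis x)^-1.
Proof. by apply: (mulfI (cis_neq0 x)); rewrite -cisD subrr cis0 divff// cis_neq0. Qed.

Lemma cisNE x : cis (- x) = (Num.conj (cis x) : C).
Proof. by rewrite /cis cosN sinN. Qed.

(** Mean value theorem. *)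
Lemma derive_le1_lipschitz (f df : R -> R) : (forall x : R, is_derive x 1 f (df x)) ->
  (forall x, `|df x| <= 1) -> forall x y, `|f x - f y| <= `|x - y|.
Proof.
move=> down_rate db; have cf : continuous f.
  move=> z; apply: differentiable_continuous; apply/derivable1_diffP.
  by case: (down_rate z).
have half x y : x <= y -> `|f y - f x| <= `|y - x|.
  move=> xy.
  have dd z : z \in `]x, y[%R -> is_derive z 1 f (df z) by [].
  have cc : {within `[x, y], continuous f} by exact: continuous_subspaceT.
  have [c _ ->] := MVT_segment xy dd cc.
  by rewrite normrM ler_piMl.
move=> x y; have [xy|/ltW yx] := leP x y; last exact: half.
by rewrite distrC [leRHS]distrC half.
Qed.

Lemma cos_lipschitz (x y : R) : `|cos x - cos y| <= `|x - y|.
Proof.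
apply: (@derive_le1_lipschitz cos (fun x => - sin x)).
by move=> z; rewrite normrN sin_max.
Qed.

Lemma sin_lipschitz (x y : R) : `|sin x - sin y| <= `|x - y|.
Proof.
apply: (@derive_le1_lipschitz sin cos).
exact: cos_max.
Qed.

Lemma cis_lipschitz x y : normc (cis x - cis y) <= 2 * `|x - y|.
Proof.
apply: le_trans (normc_le_ReIm _) _ => /=.
have := cos_lipschitz x y; have := sin_lipschitz x y; lra.
Qed.

Lemma cos_lt1 (x : R) : 0 < x < 2 * pi -> cos x < 1.
Proof.
move=> /andP[x0 x2]; have -> : x = (x / 2) *+ 2 by rewrite -mulr_natr; field.
rewrite cos_mulr2n cos2sin2.
have : 0 < sin (x / 2) by apply: sin_gt0_pi; apply/andP; split; lra.
by move=> /(exprn_gt0 2); lra.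
Qed.

End ComplexModulus.

(** * The infinite q-Pochhammer symbol on the unit circle *)

Section QPochhammer.
Variables (R : realType) (q : R).
Hypotheses (q0 : 0 < q) (q1 : q < 1).
Local Notation C := R[i].
Local Notation normc := (@ComplexField.Normc.normc R).

Local Notation P x m := (qpoch (toC q) (cis x) m).
Local Notation S := ((1 - q)^-1).

Definition geosum (m : nat) : R := \sum_(k < m) q ^+ k.

Lemma toCX (x : R) k : toC x ^+ k = toC (x ^+ k).
Proof. by rewrite /toC rmorphXn. Qed.

Lemma qpoch_cisS x m : P x m.+1 = P x m * (1 - cis x * toC (q ^+ m)).
Proof. by rewrite /qpoch big_ord_recr /= toCX. Qed.

Lemma geosumS m : geosum m.+1 = geosum m + q ^+ m.
Proof. by rewrite /geosum big_ord_recr. Qed.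

Lemma geosum_ge0 m : 0 <= geosum m.
Proof. by rewrite /geosum sumr_ge0// => k _; rewrite exprn_ge0// ltW. Qed.

Lemma geosum_le m : geosum m <= S.
Proof.
have h : geosum m * (1 - q) = 1 - q ^+ m.
  elim: m => [|m IH]; first by rewrite /geosum big_ord0 mul0r expr0 subrr.
  by rewrite geosumS mulrDl IH exprS; ring.
rewrite -[leRHS]mul1r ler_pdivlMr ?subr_gt0// h.
by rewrite lerBlDr lerDl exprn_ge0// ltW.
Qed.

Lemma qfactor_le x m : normc (1 - cis x * toC (q ^+ m)) <= expR (q ^+ m).
Proof.
apply: (@le_trans _ _ (1 + q ^+ m)); last exact: expR_ge1Dx.
apply: le_trans (normc_triangle _ _) _.
rewrite ComplexField.Normc.normc1 normcN ComplexField.Normc.normcM normc_cis mul1r normc_toC.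
by rewrite ger0_norm// exprn_ge0// ltW.
Qed.

(** The factors of the product are at most exp(q ^ k) in modulus. *)
Lemma qpoch_cis_le_geo x m : normc (P x m) <= expR (geosum m).
Proof.
elim: m => [|m IH].
  by rewrite /qpoch big_ord0 /geosum big_ord0 expR0 ComplexField.Normc.normc1.
rewrite qpoch_cisS geosumS expRD ComplexField.Normc.normcM.
by apply: ler_pM; rewrite ?normc_ge0// qfactor_le.
Qed.

(** Product rule for differences, by induction on the number of factors; the
    constant stays bounded as the number of factors grows. *)
Lemma qpoch_cis_lipschitz x y m :
  normc (P x m - P y m) <= geosum m * expR (geosum m) * normc (cis x - cis y).
Proof.
elim: m => [|m IH].
  by rewrite /qpoch /geosum !big_ord0 subrr !mul0r ComplexField.Normc.normc0.
have qm : 0 <= q ^+ m by rewrite exprn_ge0// ltW.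
have -> : P x m.+1 - P y m.+1 = (P x m - P y m) * (1 - cis x * toC (q ^+ m))
    + P y m * (toC (q ^+ m) * (cis y - cis x)).
  by rewrite !qpoch_cisS; ring.
apply: le_trans (normc_triangle _ _) _.
rewrite !ComplexField.Normc.normcM normc_toC ger0_norm// -(normcN (cis y - _)) opprB.
rewrite geosumS expRD.
set d := normc (cis x - cis y) in IH *.
have d0 : 0 <= d by exact: normc_ge0.
have h1 : normc (P x m - P y m) * normc (1 - cis x * toC (q ^+ m))
   <= (geosum m * expR (geosum m) * d) * expR (q ^+ m).
  by apply: ler_pM; rewrite ?normc_ge0// qfactor_le.
have h2 : normc (P y m) * (q ^+ m * d) <= expR (geosum m) * expR (q ^+ m) * (q ^+ m * d).
  rewrite ler_wpM2r ?mulr_ge0//; apply: le_trans (qpoch_cis_le_geo _ _) _.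
  rewrite ler_peMr ?expR_ge0//.
  by have := expR_ge1Dx (q ^+ m); lra.
by lra.
Qed.

Lemma qpoch_cis_step x m : normc (P x m.+1 - P x m) <= expR S * q ^+ m.
Proof.
have -> : P x m.+1 - P x m = - (P x m * (cis x * toC (q ^+ m))).
  by rewrite qpoch_cisS; ring.
have qm : 0 <= q ^+ m by rewrite exprn_ge0// ltW.
rewrite normcN !ComplexField.Normc.normcM normc_toC normc_cis mul1r ger0_norm//.
by rewrite ler_wpM2r//; apply: le_trans (qpoch_cis_le_geo _ _) _; rewrite ler_expR geosum_le.
Qed.

(** The telescoping series of u is dominated by a geometric series. *)
Lemma geometric_steps_cvg (u : nat -> R) (K : R) : 0 <= K ->
  (forall m, `|u m.+1 - u m| <= K * q ^+ m) -> cvgn u.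
Proof.
move=> K0 h.
have ct : cvgn (series (telescope u)).
  apply: normed_cvg; apply: (@series_le_cvg _ _ (geometric K q)).
  - by move=> m; exact: normr_ge0.
  - by move=> m; rewrite /geometric /= mulr_ge0// exprn_ge0// ltW.
  - by move=> m; exact: h.
  - by apply: is_cvg_geometric_series; rewrite ger0_norm// ltW.
have -> : u = cst (u 0%N) + series (telescope u).
  by apply/funext => m; rewrite {1}(eq_sum_telescope u m).
by apply: is_cvgD => //; exact: is_cvg_cst.
Qed.

Definition qpochoo_Re (x : R) : R := limn (fun m => complex.Re (P x m)).
Definition qpochoo_Im (x : R) : R := limn (fun m => complex.Im (P x m)).

Lemma qpochoo_Re_cvg x : complex.Re (P x m) @[m --> \oo] --> qpochoo_Re x.
Proof.
apply: (@geometric_steps_cvg _ (expR S)); first exact: expR_ge0.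
move=> m; apply: le_trans (qpoch_cis_step x m); apply: le_trans (Re_le_normc _).
by case: (P x m.+1) (P x m) => ? ? [].
Qed.

Lemma qpochoo_Im_cvg x : complex.Im (P x m) @[m --> \oo] --> qpochoo_Im x.
Proof.
apply: (@geometric_steps_cvg _ (expR S)); first exact: expR_ge0.
move=> m; apply: le_trans (qpoch_cis_step x m); apply: le_trans (Im_le_normc _).
by case: (P x m.+1) (P x m) => ? ? [].
Qed.

(** The infinite product has a limit because consecutive partial products
    differ by O(q ^ m). *)
Lemma qpochooE x : qpochoo q (cis x) = (qpochoo_Re x +i* qpochoo_Im x)%C.
Proof.
rewrite /qpochoo; apply: (@cvg_lim C^o); first exact: norm_hausdorff.
by apply: cvg_complex; [exact: qpochoo_Re_cvg|exact: qpochoo_Im_cvg].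
Qed.

Lemma qpoch_cisN x m : P (- x) m = Num.conj (P x m).
Proof.
rewrite /qpoch rmorph_prod; apply: eq_bigr => i _.
rewrite rmorphB rmorph1 rmorphM cisNE toCX; congr (_ - _ * _).
by rewrite /toC /= [RHS]conjc_real.
Qed.

Lemma qpochoo_ReN x : qpochoo_Re (- x) = qpochoo_Re x.
Proof.
congr (limn _); apply/funext => m; rewrite qpoch_cisN.
by case: (P x m).
Qed.

Lemma qpochoo_ImN x : qpochoo_Im (- x) = - qpochoo_Im x.
Proof.
apply: cvg_lim => //.
have -> : (fun m => complex.Im (P (- x) m)) = (fun m => - complex.Im (P x m)).
  by apply/funext => m; rewrite qpoch_cisN; case: (P x m).
by apply: cvgN; exact: qpochoo_Im_cvg.
Qed.

Lemma cvg_norm_le (u : nat -> R) l K : u m @[m --> \oo] --> l ->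
  (forall m, `|u m| <= K) -> `|l| <= K.
Proof.
move=> ul uK; have h1 : `|u m| @[m --> \oo] --> `|l| by exact: cvg_norm.
have h2 : K @[_ --> \oo] --> K by exact: cvg_cst.
by apply: (ler_cvg_to h1 h2); exact: nearW.
Qed.

Local Notation K1 := (expR S).
Local Notation K2 := (2 * (S * expR S)).

Lemma qpoch_cis_le x m : normc (P x m) <= K1.
Proof. by apply: le_trans (qpoch_cis_le_geo x m) _; rewrite ler_expR geosum_le. Qed.

Lemma qpoch_cis_lipschitz_uniform x y m : normc (P x m - P y m) <= K2 * `|x - y|.
Proof.
apply: le_trans (qpoch_cis_lipschitz x y m) _.
rewrite [2 * _]mulrC -[leRHS]mulrA; apply: ler_pM; rewrite ?normc_ge0 ?cis_lipschitz//.
  by rewrite mulr_ge0 ?geosum_ge0 ?expR_ge0.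
by apply: ler_pM; rewrite ?geosum_ge0 ?expR_ge0 ?geosum_le// ler_expR geosum_le.
Qed.

Lemma qpochoo_Re_bound x : `|qpochoo_Re x| <= K1.
Proof.
apply: (cvg_norm_le (qpochoo_Re_cvg (x := x))) => m.
exact: le_trans (Re_le_normc _) (qpoch_cis_le x m).
Qed.

Lemma qpochoo_Im_bound x : `|qpochoo_Im x| <= K1.
Proof.
apply: (cvg_norm_le (qpochoo_Im_cvg (x := x))) => m.
exact: le_trans (Im_le_normc _) (qpoch_cis_le x m).
Qed.

Lemma qpochoo_Re_lipschitz x y : `|qpochoo_Re x - qpochoo_Re y| <= K2 * `|x - y|.
Proof.
apply: (cvg_norm_le (cvgB (qpochoo_Re_cvg (x := x)) (qpochoo_Re_cvg (x := y)))) => m.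
apply: le_trans (qpoch_cis_lipschitz_uniform x y m); apply: le_trans (Re_le_normc _).
rewrite -[X in X <= _]/(`|complex.Re (P x m) - complex.Re (P y m)|).
by case: (P x m) (P y m) => ? ? [].
Qed.

Lemma qpochoo_Im_lipschitz x y : `|qpochoo_Im x - qpochoo_Im y| <= K2 * `|x - y|.
Proof.
apply: (cvg_norm_le (cvgB (qpochoo_Im_cvg (x := x)) (qpochoo_Im_cvg (x := y)))) => m.
apply: le_trans (qpoch_cis_lipschitz_uniform x y m); apply: le_trans (Im_le_normc _).
rewrite -[X in X <= _]/(`|complex.Im (P x m) - complex.Im (P y m)|).
by case: (P x m) (P y m) => ? ? [].
Qed.

(** Squared modulus of the infinite product at the point of angle x. *)
Definition qpochoo_sqr (x : R) : R := qpochoo_Re x * qpochoo_Re x + qpochoo_Im x * qpochoo_Im x.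

Lemma qpochoo_sqr_ge0 x : 0 <= qpochoo_sqr x.
Proof. by rewrite /qpochoo_sqr -!expr2 addr_ge0// sqr_ge0. Qed.

(** Opposite angles are conjugate points, so the density is a product of squared
    moduli. *)
Lemma qpochoo_conj_mul x : qpochoo q (cis x) * qpochoo q (cis (- x)) = toC (qpochoo_sqr x).
Proof.
rewrite !qpochooE qpochoo_ReN qpochoo_ImN; apply/eqP; rewrite eq_complex /=.
by apply/andP; split; apply/eqP; rewrite /qpochoo_sqr; ring.
Qed.

(** Follows from 1 / (1 - y) = 1 + y / (1 - y) <= exp(y / (1 - y)). *)
Lemma qfactor_ge x m : expR (- (q ^+ m / (1 - q))) <= normc (1 - cis x * toC (q ^+ m.+1)).
Proof.
have q1' : 0 < 1 - q by rewrite subr_gt0.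
have y0 : 0 <= q ^+ m.+1 by rewrite exprn_ge0// ltW.
have ym : q ^+ m.+1 <= q ^+ m by rewrite exprS ler_piMl// ?exprn_ge0// ltW.
have yq : q ^+ m.+1 <= q by rewrite exprS ler_piMr ?exprn_ile1// ltW.
have y1 : 0 < 1 - q ^+ m.+1 by rewrite subr_gt0 (le_lt_trans yq).
apply: (@le_trans _ _ (1 - q ^+ m.+1)); last first.
  have := normcB_triangle 1 (cis x * toC (q ^+ m.+1)).
  by rewrite ComplexField.Normc.normc1 ComplexField.Normc.normcM normc_cis normc_toC mul1r ger0_norm.
rewrite expRN -[leRHS]invrK lef_pV2 ?posrE ?invr_gt0 ?expR_gt0//.
apply: le_trans (expR_ge1Dx _).
have -> : (1 - q ^+ m.+1)^-1 = 1 + q ^+ m.+1 / (1 - q ^+ m.+1) by field; rewrite gt_eqF.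
rewrite lerD2l; apply: ler_pM => //; first by rewrite invr_ge0 ltW.
by rewrite lef_pV2 ?posrE//; lra.
Qed.

(** All factors but the first are bounded below by a convergent product. *)
Lemma qpoch_cis_ge x m :
  normc (1 - cis x) * expR (- (geosum m / (1 - q))) <= normc (P x m.+1).
Proof.
elim: m => [|m IH].
  rewrite qpoch_cisS /qpoch !big_ord0 /geosum big_ord0 mul0r oppr0 expR0 mulr1 mul1r expr0.
  by rewrite [toC 1](_ : _ = 1)// mulr1.
rewrite geosumS mulrDl opprD expRD mulrA qpoch_cisS ComplexField.Normc.normcM.
by apply: ler_pM => //; rewrite ?mulr_ge0 ?normc_ge0 ?expR_ge0// qfactor_ge.
Qed.

(** The only zero of the infinite product on the unit circle is the point 1. *)
Lemma qpochoo_sqr_gt0 x : cos x < 1 -> 0 < qpochoo_sqr x.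
Proof.
move=> cx; pose d := normc (1 - cis x) * expR (- (S / (1 - q))).
have n0 : 0 < normc (1 - cis x).
  rewrite lt_neqAle normc_ge0 andbT eq_sym; apply/eqP => /ComplexField.Normc.eq0_normc.
  by move=> /(congr1 (fun z => complex.Re z)) /=; lra.
have d0 : 0 < d by rewrite mulr_gt0// expR_gt0.
apply: (@lt_le_trans _ _ (d ^+ 2)); first exact: exprn_gt0.
have cG : normc (P x m.+1) ^+ 2 @[m --> \oo] --> qpochoo_sqr x.
  under eq_cvg do rewrite normc_sqr !expr2.
  have cR : complex.Re (P x m.+1) @[m --> \oo] --> qpochoo_Re x.
    by have := qpochoo_Re_cvg (x := x); rewrite -cvg_shiftS.
  have cI : complex.Im (P x m.+1) @[m --> \oo] --> qpochoo_Im x.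
    by have := qpochoo_Im_cvg (x := x); rewrite -cvg_shiftS.
  by apply: cvgD; apply: cvgM.
have h2 : d ^+ 2 @[_ --> \oo] --> d ^+ 2 by exact: cvg_cst.
apply: (ler_cvg_to h2 cG); apply: nearW => m.
rewrite lerXn2r ?nnegrE ?normc_ge0 ?(ltW d0)//.
apply: le_trans (qpoch_cis_ge x m); rewrite ler_wpM2l ?normc_ge0//.
rewrite ler_expR lerN2 ler_wpM2r ?geosum_le// invr_ge0 subr_ge0 ltW//.
Qed.

End QPochhammer.

(** * The inner product on the torus *)

Section TorusFunctions.
Variable R : realType.
Local Notation C := R[i].
Local Notation normc := (@ComplexField.Normc.normc R).

Definition cblip n (F : 'rV[R]_n -> C) : Prop :=
  blip (fun th => complex.Re (F th)) /\ blip (fun th => complex.Im (F th)).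

Lemma cblip_cst n (c : C) : cblip (fun _ : 'rV[R]_n => c).
Proof. by split; exact: blip_cst. Qed.

Lemma cblip_real n (f : 'rV[R]_n -> R) : blip f -> cblip (fun th => toC (f th)).
Proof. by move=> bf; split=> //=; exact: blip_cst. Qed.

Lemma cblipD n (F G : 'rV[R]_n -> C) : cblip F -> cblip G -> cblip (fun th => F th + G th).
Proof.
move=> [F1 F2] [G1 G2]; split.
  have := blipD F1 G1; congr (blip _); apply/funext => th.
  by case: (F th) (G th) => ? ? [].
have := blipD F2 G2; congr (blip _); apply/funext => th.
by case: (F th) (G th) => ? ? [].
Qed.

Lemma cblipM n (F G : 'rV[R]_n -> C) : cblip F -> cblip G -> cblip (fun th => F th * G th).
Proof.
move=> [F1 F2] [G1 G2]; split.
  have := blipB (blipM F1 G1) (blipM F2 G2); congr (blip _); apply/funext => th.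
  by case: (F th) (G th) => ? ? [].
have := blipD (blipM F1 G2) (blipM F2 G1); congr (blip _); apply/funext => th.
by case: (F th) (G th) => ? ? [].
Qed.

Lemma cblip_conj n (F : 'rV[R]_n -> C) : cblip F -> cblip (fun th => Num.conj (F th)).
Proof.
move=> [F1 F2]; split.
  by move: F1; congr (blip _); apply/funext => th; case: (F th).
have := blipN F2; congr (blip _); apply/funext => th.
by case: (F th).
Qed.

Lemma cblip_sum n (I : Type) (r : seq I) (F : I -> 'rV[R]_n -> C) :
  (forall i, cblip (F i)) -> cblip (fun th => \sum_(i <- r) F i th).
Proof.
move=> bF; elim: r => [|i r IH].
  by under eq_fun do rewrite big_nil; exact: cblip_cst.
by under eq_fun do rewrite big_cons; exact: cblipD.
Qed.

Lemma cblipX n (F : 'rV[R]_n -> C) k : cblip F -> cblip (fun th => F th ^+ k).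
Proof.
move=> bF; elim: k => [|k IH]; first by under eq_fun do rewrite expr0; exact: cblip_cst.
by under eq_fun do rewrite exprS; exact: cblipM.
Qed.

Lemma blip_coord n (g : R -> R) (j : 'I_n) : (forall x, `|g x| <= 1) ->
  (forall x y, `|g x - g y| <= `|x - y|) -> blip (fun th : 'rV[R]_n => g (th ord0 j)).
Proof.
move=> gb gl; apply: (@blip_comp _ _ g (fun th => th ord0 j) 1 1) => //.
  by move=> x y; rewrite mul1r.
by move=> u v d _ uv; rewrite mul1r.
Qed.

Lemma blip_cos n (j : 'I_n) : blip (fun th : 'rV[R]_n => cos (th ord0 j)).
Proof. by apply: blip_coord; [exact: cos_max|exact: cos_lipschitz]. Qed.

Lemma blip_sin n (j : 'I_n) : blip (fun th : 'rV[R]_n => sin (th ord0 j)).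
Proof. by apply: blip_coord; [exact: sin_max|exact: sin_lipschitz]. Qed.

Lemma circleE n (th : 'rV[R]_n) j : circle th ord0 j = cis (th ord0 j).
Proof. by rewrite mxE. Qed.

Lemma circle_neq0 n (th : 'rV[R]_n) j : circle th ord0 j != 0.
Proof. by rewrite circleE cis_neq0. Qed.

Lemma cblip_circle n (j : 'I_n) : cblip (fun th => circle th ord0 j).
Proof.
by under eq_fun do rewrite circleE; split=> /=; [exact: blip_cos|exact: blip_sin].
Qed.

Lemma circleV n (th : 'rV[R]_n) j : (circle th ord0 j)^-1 = Num.conj (circle th ord0 j).
Proof. by rewrite circleE -cisN cisNE. Qed.

Lemma cblip_circleXz n (j : 'I_n) (k : int) : cblip (fun th => circle th ord0 j ^ k).
Proof.
case: k => k; first exact/cblipX/cblip_circle.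
have -> : (fun th : 'rV[R]_n => circle th ord0 j ^ Negz k)
   = (fun th => Num.conj (circle th ord0 j) ^+ k.+1).
  by apply/funext => th; rewrite NegzE -exprnN -exprVn circleV.
exact/cblipX/cblip_conj/cblip_circle.
Qed.

Lemma cblip_init_row n (F : 'rV[R]_n -> C) : cblip F ->
  cblip (fun th : 'rV[R]_n.+1 => F (init_row th)).
Proof.
have aux (f : 'rV[R]_n -> R) : blip f -> blip (fun th : 'rV[R]_n.+1 => f (init_row th)).
  move=> [K [K0 Kb Kl]]; exists K; split=> // u v d d0 uv.
  by apply: Kl => // j; rewrite !mxE.
by move=> [F1 F2]; split; [exact: aux F1|exact: aux F2].
Qed.

Lemma init_row_circle n (th : 'rV[R]_n.+1) : init_row (circle th) = circle (init_row th).
Proof. by apply/rowP => j; rewrite !mxE. Qed.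

(** By the branching recursion calP is a finite combination of products of
    integer powers of the coordinates. *)
Lemma cblip_calP (q : C) n (z : 'rV[int]_n) : dominant z ->
  cblip (fun th => calP q z (circle th)).
Proof.
elim: n z => [|n IH] z dz; first exact: cblip_cst.
have [N bz] := in_box_exists z.
have -> : (fun th : 'rV[R]_n.+1 => calP q z (circle th))
    = (fun th => branch_op q (circle th ord0 ord_max) N (fun nu => calP q nu (init_row (circle th))) z).
  by apply/funext => th; rewrite (calPS _ (circle_neq0 th ord_max) dz bz).
rewrite /branch_op; apply: cblip_sum => mu; have [h|kn] := eqVneq (bweight q n.+1 (part mu) (part z)) 0.
  have -> : (fun th : 'rV[R]_n.+1 => upper_ker q (circle th ord0 ord_max) mu z
     * (\sum_(nu <- box n N) lower_ker q (circle th ord0 ord_max) nu mu * calP q nu (init_row (circle th))))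
     = (fun => 0) by apply/funext => th; rewrite /upper_ker h mulr0 mul0r.
  exact: cblip_cst.
apply: cblipM; first by apply: cblipM; [exact: cblip_circleXz|exact: cblip_cst].
apply: cblip_sum => nu; have [h|kn'] := eqVneq (bweight q n (part nu) (part mu)) 0.
  under eq_fun do rewrite /lower_ker h mulr0 mul0r.
  exact: cblip_cst.
apply: cblipM; first by apply: cblipM; [exact: cblip_circleXz|exact: cblip_cst].
under eq_fun do rewrite init_row_circle.
apply: (cblip_init_row (F := fun th => calP q nu (circle th))); apply: IH.
apply: (@lower_ker_dom _ q n 1 nu mu); first by rewrite /lower_ker exp1rz mul1r.
by apply: (@upper_ker_dom _ q n.+1 1 mu z) => //; rewrite /upper_ker exp1rz mul1r.
Qed.

Lemma conj_toC (x : R) : Num.conj (toC x : C) = toC x.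
Proof. exact: conjc_real. Qed.

Definition angle_integral n (F : 'rV[R]_n -> C) : C :=
  toC ((2 * pi) ^- n) * (box_integral (fun th => complex.Re (F th))
    +i* box_integral (fun th => complex.Im (F th)))%C.

Lemma torus_integralE n (f : 'rV[C]_n -> C) :
  torus_integral f = angle_integral (fun th => f (circle th)).
Proof. by []. Qed.

Lemma angle_integralD n (F G : 'rV[R]_n -> C) : cblip F -> cblip G ->
  angle_integral (fun th => F th + G th) = angle_integral F + angle_integral G.
Proof.
move=> [F1 F2] [G1 G2]; rewrite /angle_integral -mulrDr; congr (_ * _).
have -> : (fun th => complex.Re (F th + G th)) = (fun th => complex.Re (F th) + complex.Re (G th)).
  by apply/funext => th; case: (F th) (G th) => ? ? [].
have -> : (fun th => complex.Im (F th + G th)) = (fun th => complex.Im (F th) + complex.Im (G th)).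
  by apply/funext => th; case: (F th) (G th) => ? ? [].
by rewrite !box_integralD.
Qed.

Lemma angle_integralZ n c (F : 'rV[R]_n -> C) : cblip F -> angle_integral (fun th => c * F th) = c * angle_integral F.
Proof.
move=> [F1 F2]; rewrite /angle_integral mulrCA; congr (_ * _); case: c => r i.
have -> : (fun th => complex.Re ((r +i* i)%C * F th))
   = (fun th => r * complex.Re (F th) + (- i) * complex.Im (F th)).
  by apply/funext => th; case: (F th) => a b /=; ring.
have -> : (fun th => complex.Im ((r +i* i)%C * F th))
   = (fun th => r * complex.Im (F th) + i * complex.Re (F th)).
  by apply/funext => th; case: (F th) => a b.
rewrite !box_integralD ?box_integralZ//; try exact: blipZ.
by apply/eqP; rewrite eq_complex /=; apply/andP; split; apply/eqP; ring.
Qed.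

Lemma angle_integral0 n : angle_integral (fun _ : 'rV[R]_n => 0) = 0.
Proof.
have := @angle_integralZ n 0 (fun=> 0) (cblip_cst _ _); rewrite [X in _ = X -> _]mul0r => {2}<-.
by congr angle_integral; apply/funext => th; rewrite mul0r.
Qed.

Lemma angle_integral_sum n (I : Type) (r : seq I) (c : I -> C) (F : I -> 'rV[R]_n -> C) :
  (forall i, cblip (F i)) ->
  angle_integral (fun th => \sum_(i <- r) c i * F i th) = \sum_(i <- r) c i * angle_integral (F i).
Proof.
move=> bF; elim: r => [|i r IH].
  by rewrite big_nil -[RHS](angle_integral0 n); congr angle_integral; apply/funext => th; rewrite big_nil.
rewrite big_cons -IH -angle_integralZ// -angle_integralD.
- by congr angle_integral; apply/funext => th; rewrite big_cons.
- by apply: cblipM => //; exact: cblip_cst.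
- by apply: cblip_sum => j; apply: cblipM => //; exact: cblip_cst.
Qed.

Lemma angle_integral_bound n (F : 'rV[R]_n -> C) e : cblip F -> (forall th, normc (F th) <= e) ->
  normc (angle_integral F) <= 2 * e.
Proof.
move=> [F1 F2] Fe; rewrite /angle_integral ComplexField.Normc.normcM normc_toC.
have p0 : 0 < (2 * pi) ^+ n :> R by rewrite exprn_gt0// mulr_gt0// pi_gt0.
have ninv : 0 <= (2 * pi : R) ^- n by rewrite invr_ge0 ltW.
rewrite (ger0_norm ninv) mulrC ler_pdivrMr//.
apply: le_trans (normc_le_ReIm _) _ => /=.
have h1 := box_integral_norm F1 (fun u => le_trans (Re_le_normc _) (Fe u)).
have h2 := box_integral_norm F2 (fun u => le_trans (Im_le_normc _) (Fe u)).
lra.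
Qed.

Section Density.
Variable q : R.
Hypotheses (q0 : 0 < q) (q1 : q < 1).

(** The density on the torus as a real function of the angles. *)
Definition angle_weight n (th : 'rV[R]_n) : R :=
  (\prod_(j < n) qpochoo_sqr q (th ord0 j *+ 2))
  * (\prod_(j < n) \prod_(k < n | (j < k)%N)
       (qpochoo_sqr q (th ord0 j + th ord0 k) * qpochoo_sqr q (th ord0 k - th ord0 j))).

Lemma density_circle n (th : 'rV[R]_n) : density q (circle th) = toC (angle_weight th).
Proof.
have cc := qpochoo_conj_mul q0 q1.
rewrite /density /angle_weight /toC rmorphM !rmorph_prod; congr (_ * _).
  apply: eq_bigr => j _; rewrite circleE -exprVn -cisN !expr2 -!cisD.
  by rewrite -opprD -mulr2n cc.
apply: eq_bigr => j _; rewrite rmorph_prod; apply: eq_bigr => k _.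
rewrite !circleE -!cisN -!cisD rmorphM.
transitivity (toC (qpochoo_sqr q (th ord0 j + th ord0 k)) * toC (qpochoo_sqr q (th ord0 k - th ord0 j))); last by [].
(* The first factor is conjugate to the fourth, the second to the third. *)
have m4 (x y u v s t : C) : x * v = s -> y * u = t -> x * y * u * v = s * t.
  by move=> <- <-; ring.
rewrite -opprD [- th ord0 j + _]addrC -(opprB (th ord0 k)).
by apply: m4; exact: cc.
Qed.

Lemma blip_qpochoo_sqr n (l : 'rV[R]_n -> R) c : 0 <= c ->
  (forall (u v : 'rV[R]_n) d, 0 <= d -> (forall j, `|u ord0 j - v ord0 j| <= d) ->
        `|l u - l v| <= c * d) -> blip (fun th => qpochoo_sqr q (l th)).
Proof.
move=> c0 lc.
have S0 : 0 <= (1 - q)^-1 by rewrite invr_ge0 subr_ge0 ltW.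
have k2 : 0 <= 2 * ((1 - q)^-1 * expR (1 - q)^-1) by rewrite !mulr_ge0 ?expR_ge0.
have aux g : (forall x, `|g x| <= expR (1 - q)^-1) ->
  (forall x y, `|g x - g y| <= 2 * ((1 - q)^-1 * expR (1 - q)^-1) * `|x - y|) ->
  blip (fun th => g (l th)).
  move=> gb gl; apply: (blip_comp (K := expR (1 - q)^-1 + 2 * ((1 - q)^-1 * expR (1 - q)^-1)) _ _ _ c0 lc).
  - by rewrite addr_ge0 ?expR_ge0.
  - by move=> x; apply: le_trans (gb x) _; rewrite lerDl.
  - by move=> x y; apply: le_trans (gl x y) _; rewrite ler_wpM2r// lerDr expR_ge0.
have bR := aux _ (qpochoo_Re_bound q0 q1) (qpochoo_Re_lipschitz q0 q1).
have bI := aux _ (qpochoo_Im_bound q0 q1) (qpochoo_Im_lipschitz q0 q1).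
exact: (blipD (blipM bR bR) (blipM bI bI)).
Qed.

Lemma blip_angle_weight n : blip (@angle_weight n).
Proof.
have norm2 (x y : R) d : `|x| <= d -> `|y| <= d -> `|x + y| <= 2 * d.
  by move=> xd yd; have := ler_normD x y; lra.
apply: blipM; first apply: blip_prod => j.
  apply: (@blip_qpochoo_sqr _ (fun th => th ord0 j *+ 2) 2) => // u v d d0 uv.
  by rewrite -mulrnBl mulr2n; exact: norm2.
apply: blip_prod => j; apply: blip_prod => k; apply: blipM.
  apply: (@blip_qpochoo_sqr _ (fun th => th ord0 j + th ord0 k) 2) => // u v d d0 uv.
  by rewrite opprD addrACA; exact: norm2.
apply: (@blip_qpochoo_sqr _ (fun th => th ord0 k - th ord0 j) 2) => // u v d d0 uv.
rewrite opprD addrACA -opprD; by apply: norm2 => //; rewrite normrN.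
Qed.

Lemma angle_weight_ge0 n (th : 'rV[R]_n) : 0 <= angle_weight th.
Proof.
rewrite /angle_weight mulr_ge0// prodr_ge0// => j _; first exact: qpochoo_sqr_ge0.
by rewrite prodr_ge0// => k _; rewrite mulr_ge0// qpochoo_sqr_ge0.
Qed.

(** At angles that increase strictly inside the interval from 0 to pi, none of
    2 th_j, th_j + th_k, th_k - th_j is a multiple of 2 pi. *)
Lemma box_angle_weight_gt0 n : 0 < box_integral (@angle_weight n).
Proof.
(* Equally spaced angles in the open interval from 0 to pi. *)
pose u0 : 'rV[R]_n := \row_j (pi * (j.+1%:R / n.+1%:R)).
have pi0 : 0 < pi :> R by exact: pi_gt0.
have n0 : 0 < n.+1%:R :> R by rewrite ltr0n.
have u0lt (j k : 'I_n) : (j < k)%N -> u0 ord0 j < u0 ord0 k.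
  by move=> jk; rewrite !mxE ltr_pM2l// ltr_pM2r ?invr_gt0// ltr_nat.
have u0j (j : 'I_n) : 0 < u0 ord0 j < pi.
  rewrite mxE mulr_gt0 ?divr_gt0//= gtr_pMr// ltr_pdivrMr// mul1r ltr_nat ltnS.
  exact: ltn_ord.
apply: (@box_integral_gt0 _ _ _ u0); first exact: blip_angle_weight.
- exact: angle_weight_ge0.
- by move=> j; have /andP[h1 h2] := u0j j; rewrite h1 /=; lra.
have G0 x : 0 < x < 2 * pi -> 0 < qpochoo_sqr q x.
  by move=> hx; apply: qpochoo_sqr_gt0 => //; exact: cos_lt1.
rewrite /angle_weight mulr_gt0// prodr_gt0// => j _.
  by apply: G0; have := u0j j; rewrite mulr2n; lra.
rewrite prodr_gt0// => k jk; rewrite mulr_gt0//; apply: G0.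
  by have := u0j j; have := u0j k; lra.
by have := u0lt j k jk; have := u0j j; have := u0j k; lra.
Qed.

Definition angle_inner n (F G : 'rV[R]_n -> C) : C :=
  (n`!%:R)^-1 * angle_integral (fun th => F th * Num.conj (G th) * toC (angle_weight th)).

Lemma innerE n (f g : 'rV[C]_n -> C) :
  inner q f g = angle_inner (fun th => f (circle th)) (fun th => g (circle th)).
Proof.
rewrite /inner /angle_inner torus_integralE; congr (_ * angle_integral _).
by apply/funext => th; rewrite density_circle.
Qed.

Lemma angle_inner_suml n (I : Type) (r : seq I) (c : I -> C) (F : I -> 'rV[R]_n -> C) G :
  (forall i, cblip (F i)) -> cblip G ->
  angle_inner (fun th => \sum_(i <- r) c i * F i th) G = \sum_(i <- r) c i * angle_inner (F i) G.
Proof.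
move=> bF bG; rewrite /angle_inner.
have -> : (fun th => (\sum_(i <- r) c i * F i th) * Num.conj (G th) * toC (angle_weight th))
   = (fun th => \sum_(i <- r) c i * (F i th * Num.conj (G th) * toC (angle_weight th))).
  apply/funext => th; rewrite !mulr_suml; apply: eq_bigr => i _; ring.
rewrite angle_integral_sum; first by rewrite mulr_sumr; apply: eq_bigr => i _; rewrite mulrCA.
move=> i; apply: cblipM; last exact/cblip_real/blip_angle_weight.
by apply: cblipM => //; exact: cblip_conj.
Qed.

Lemma angle_inner_sumr n (I : Type) (r : seq I) (c : I -> R) (F : I -> 'rV[R]_n -> C) G :
  (forall i, cblip (F i)) -> cblip G ->
  angle_inner G (fun th => \sum_(i <- r) toC (c i) * F i th)
  = \sum_(i <- r) toC (c i) * angle_inner G (F i).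
Proof.
move=> bF bG; rewrite /angle_inner.
have -> : (fun th => G th * Num.conj (\sum_(i <- r) toC (c i) * F i th) * toC (angle_weight th))
   = (fun th => \sum_(i <- r) toC (c i) * (G th * Num.conj (F i th) * toC (angle_weight th))).
  apply/funext => th; rewrite rmorph_sum mulr_sumr mulr_suml; apply: eq_bigr => i _.
  by rewrite rmorphM /= conj_toC; ring.
rewrite angle_integral_sum; first by rewrite mulr_sumr; apply: eq_bigr => i _; rewrite mulrCA.
move=> i; apply: cblipM; last exact/cblip_real/blip_angle_weight.
by apply: cblipM => //; exact: cblip_conj.
Qed.

Lemma angle_inner_real_sym n (rho : 'rV[R]_n -> R) (F G : 'rV[R]_n -> C) :
  angle_inner (fun th => toC (rho th) * F th) G = angle_inner F (fun th => toC (rho th) * G th).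
Proof.
rewrite /angle_inner; congr (_ * angle_integral _); apply/funext => th.
by rewrite rmorphM /= conj_toC; ring.
Qed.

(** Continuity of the inner product for the uniform norm. *)
Lemma angle_inner_bound n (G : 'rV[R]_n -> C) : cblip G -> exists2 K : R, 0 <= K &
  forall (rho : 'rV[R]_n -> R) e, blip rho -> (forall th, `|rho th| <= e) ->
    normc (angle_inner (fun th => toC (rho th)) G) <= K * e.
Proof.
move=> bG; have [[K1 [K10 K1b _]] [K2 [K20 K2b _]]] := bG.
have [K3 [K30 K3b _]] := blip_angle_weight n.
exists (2 * ((K1 + K2) * K3)) => [|rho e brho re].
  by rewrite !mulr_ge0// addr_ge0.
rewrite /angle_inner ComplexField.Normc.normcM.
have fl : normc (n`!%:R)^-1 <= 1.
  have -> : (n`!%:R)^-1 = toC (n`!%:R)^-1 :> C by rewrite /toC fmorphV rmorph_nat.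
  rewrite normc_toC ger0_norm ?invr_ge0// invf_le1 ?ltr0n ?fact_gt0//.
  by rewrite ler1n fact_gt0.
rewrite -[leRHS]mul1r; apply: ler_pM => //; try exact: normc_ge0.
rewrite -mulrA; apply: angle_integral_bound.
  apply: cblipM; last exact/cblip_real/blip_angle_weight.
  by apply: cblipM; [exact: cblip_real|exact: cblip_conj].
move=> th; rewrite !ComplexField.Normc.normcM !normc_toC.
have Gb : normc (Num.conj (G th)) <= K1 + K2.
  apply: le_trans (normc_le_ReIm _) _; apply: lerD.
    by have := K1b th; case: (G th).
  by have := K2b th; case: (G th) => a b /=; rewrite normrN.
have -> : (K1 + K2) * K3 * e = e * (K1 + K2) * K3 by ring.
apply: ler_pM => //; first by rewrite mulr_ge0// normc_ge0.
by apply: ler_pM => //; exact: normc_ge0.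
Qed.

Lemma angle_inner1_neq0 n : angle_inner (fun _ : 'rV[R]_n => 1) (fun=> 1) != 0.
Proof.
rewrite /angle_inner mulf_neq0 ?invr_eq0 ?pnatr_eq0 -?lt0n ?fact_gt0//.
have -> : (fun th : 'rV[R]_n => 1 * Num.conj 1 * toC (angle_weight th)) = (fun th => toC (angle_weight th)).
  by apply/funext => th; rewrite rmorph1 !mul1r.
rewrite /angle_integral /= mulf_neq0//.
  rewrite /toC fmorph_eq0 invr_eq0 expf_neq0// mulf_neq0 ?pnatr_eq0//.
  by rewrite gt_eqF// pi_gt0.
by rewrite eq_complex /= negb_and gt_eqF// box_angle_weight_gt0.
Qed.

End Density.

End TorusFunctions.

(** * The rates and the spectral expansion *)

Section Neighbours.
Variables (R : realType) (q : R) (n : nat).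
Hypotheses (q0 : 0 < q) (q1 : q < 1).
Local Notation C := R[i].

Definition unit_steps (z : 'rV[int]_n) : seq 'rV[int]_n :=
  [seq z + unit_vec i | i <- enum 'I_n] ++ [seq z - unit_vec i | i <- enum 'I_n].

Definition nbrs (z : cone n) : seq (cone n) := pmap insub (unit_steps (val z)).

Lemma unit_vec_inj : injective (@unit_vec n).
Proof.
move=> i j /rowP/(_ i); rewrite !mxE !eqxx /=.
by case: eqP => // ->.
Qed.

Lemma unit_vecN (i j : 'I_n) : unit_vec i != - unit_vec j.
Proof.
apply/eqP => /rowP/(_ i); rewrite !mxE !eqxx /=.
by case: eqP.
Qed.

Lemma unit_vec_neq0 (i : 'I_n) : unit_vec i != 0.
Proof. by apply/eqP => /rowP/(_ i); rewrite !mxE !eqxx. Qed.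

Lemma unit_steps_uniq z : uniq (unit_steps z).
Proof.
have e := enum_uniq 'I_n.
rewrite cat_uniq; apply/and3P; split.
- by rewrite map_inj_uniq// => i j /addrI/unit_vec_inj.
- apply/hasPn => v /mapP[i _ ->]; apply/mapP => -[j _ /addrI E].
  by have := unit_vecN j i; rewrite E eqxx.
- by rewrite map_inj_uniq// => i j /addrI/oppr_inj/unit_vec_inj.
Qed.

Lemma nbrs_uniq z : uniq (nbrs z).
Proof. by apply: pmap_sub_uniq; exact: unit_steps_uniq. Qed.

Lemma mem_nbrs (z w : cone n) : (w \in nbrs z) = (val w \in unit_steps (val z)).
Proof. by rewrite mem_pmap_sub. Qed.

Lemma nbrs_irr z : z \notin nbrs z.
Proof.
rewrite mem_nbrs mem_cat; apply/negP => /orP[] /mapP[i _].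
  by rewrite -{1}[val z]addr0 => /addrI/eqP; rewrite eq_sym (negbTE (unit_vec_neq0 i)).
by rewrite -{1}[val z]addr0 => /addrI/eqP; rewrite eq_sym oppr_eq0 (negbTE (unit_vec_neq0 i)).
Qed.

Lemma big_nbrs (F : zmodType) (z : cone n) (h : 'rV[int]_n -> F) :
  (forall i, ~~ dominant (val z + unit_vec i) -> h (val z + unit_vec i) = 0) ->
  (forall i, ~~ dominant (val z - unit_vec i) -> h (val z - unit_vec i) = 0) ->
  \sum_(w <- nbrs z) h (val w)
  = \sum_(i < n) (h (val z + unit_vec i) + h (val z - unit_vec i)).
Proof.
move=> hD hB; rewrite /nbrs big_pmap /unit_steps big_cat [RHS]big_split /=; congr (_ + _);
  rewrite big_map big_enum /=; apply: eq_bigr => i _; case: insubP => //=.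
- by move=> u _ ->.
- by move=> nd; rewrite hD.
- by move=> u _ ->.
- by move=> nd; rewrite hB.
Qed.

Lemma f_rate_up z (i : 'I_n) : f_rate q z (z + unit_vec i) = up_rate q (part z) i.
Proof.
rewrite /f_rate (big_pred1 i) => [|j]; last first.
  apply/eqP/eqP => [/addrI/unit_vec_inj//|->//].
rewrite big1 ?addr0// => j /eqP/addrI E.
by have := unit_vecN i j; rewrite E eqxx.
Qed.

Lemma f_rate_down z (i : 'I_n) : f_rate q z (z - unit_vec i) = down_rate q (part z) i.
Proof.
rewrite /f_rate addrC (big_pred1 i) => [|j]; last first.
  by apply/eqP/eqP => [/addrI/oppr_inj/unit_vec_inj//|->//].
rewrite big1 ?addr0// => j /eqP/addrI E.
by have := unit_vecN j i; rewrite E eqxx.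
Qed.

(** Stated along a field morphism, so as to cover both the real parameter a and
    the complex points of the torus. *)
Lemma qtoda_nbrs (F : fieldType) (f : {rmorphism R -> F}) (g : 'rV[int]_n -> F) (z : cone n) :
  qtoda (f q) g (val z) = \sum_(w <- nbrs z) f (f_rate q (val z) (val w)) * g (val w).
Proof.
have fuf i : up_rate (f q) (part (val z)) i = f (up_rate q (part (val z)) i).
  by case: i => [|i] /=; rewrite ?rmorphB ?rmorph1 ?fmorphXz.
have fdf i : down_rate (f q) (part (val z)) i = f (down_rate q (part (val z)) i).
  by rewrite /down_rate rmorphB rmorph1 fmorphXz.
rewrite (big_nbrs (h := fun v => f (f_rate q (val z) v) * g v)).
- by apply: eq_bigr => i _; rewrite f_rate_up f_rate_down fuf fdf.
- by move=> i nd; rewrite f_rate_up (up_rate_eq0 _ (valP z) nd) rmorph0 mul0r.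
- by move=> i nd; rewrite f_rate_down (down_rate_eq0 _ (valP z) nd) rmorph0 mul0r.
Qed.

Lemma f_rate_ge0 (z w : cone n) : 0 <= f_rate q (val z) (val w).
Proof.
have ex (k : int) : 0 <= k -> 0 <= 1 - q ^ k.
  by case: k => // k _; rewrite subr_ge0 exprn_ile1// ltW.
have d := elimT (dominantP _) (valP z).
rewrite /f_rate addr_ge0// sumr_ge0// => -[i im] _.
  rewrite /f_up /=; case: i im => // i im.
  by apply: ex; rewrite subr_ge0; exact: d.
by apply: ex; rewrite subr_ge0; exact: d.
Qed.

Section RealParameter.
Variable a : 'rV[R]_n.
Hypothesis a_gt0 : forall i, 0 < a ord0 i.
Local Notation E := (\sum_(i < n) (a ord0 i + (a ord0 i)^-1)).
Local Notation Pa z := (calP q (val z) a).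

Lemma calP_val_gt0 (z : cone n) : 0 < Pa z.
Proof. by apply: calP_gt0 => //; exact: (valP z). Qed.

Lemma Pieri_nbrs (z : cone n) :
  \sum_(w <- nbrs z) f_rate q (val z) (val w) * Pa w = E * Pa z.
Proof.
have := @qtoda_nbrs R idfun (fun v => calP q v a) z => /= <-.
rewrite (Pieri (lt01_neq0 q0) (lt01_nroot q0 q1))//; last exact: (valP z).
by move=> i; rewrite gt_eqF.
Qed.

Lemma rate_nbrs z w : w \in nbrs z ->
  rate q a z w = Pa w / Pa z * f_rate q (val z) (val w).
Proof.
move=> zw; rewrite /rate; case: eqP => // wz.
by have := nbrs_irr z; rewrite -{1}wz zw.
Qed.

Lemma rate_diag z : rate q a z z = - E.
Proof. by rewrite /rate eqxx. Qed.

Lemma rate_ge0 z w : w \in nbrs z -> 0 <= rate q a z w.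
Proof. by move=> zw; rewrite rate_nbrs// mulr_ge0 ?f_rate_ge0// divr_ge0// ltW// calP_val_gt0. Qed.

(** The Pieri rule at a, divided by calP_z(a). *)
Lemma rate_sum z : \sum_(w <- nbrs z) rate q a z w = E.
Proof.
rewrite big_seq (eq_bigr (fun w => f_rate q (val z) (val w) * Pa w / Pa z)); last first.
  by move=> w zw; rewrite rate_nbrs//; ring.
by rewrite -big_seq -mulr_suml Pieri_nbrs mulfK// gt_eqF// calP_val_gt0.
Qed.

Definition pieri_jumps := jumps (fun z w : cone n => f_rate q (val z) (val w)) nbrs.

(** Conjugation by calP(a) passes to powers. *)
Lemma jumps_rate k x z :
  jumps (rate q a) nbrs k x z = Pa z / Pa x * pieri_jumps k x z.
Proof.
have Pn (y : cone n) : Pa y != 0 by rewrite gt_eqF// calP_val_gt0.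
elim: k x => [|k IH] x; rewrite /pieri_jumps /=.
  by case: eqVneq => [->|_] /=; [rewrite divff ?Pn// mul1r|rewrite mulr0].
rewrite mulr_sumr big_seq [RHS]big_seq; apply: eq_bigr => w xw.
rewrite IH rate_nbrs// -/(pieri_jumps k w z); field.
by rewrite !Pn.
Qed.

End RealParameter.

Section Spectral.
Hypothesis n_gt0 : (1 <= n)%N.
Hypothesis hC : hypothesisC q.

Definition calP_circle (z : cone n) (th : 'rV[R]_n) : C := calP (toC q) (val z) (circle th).

(** The value of sum_i (b_i + 1 / b_i) on the torus, where 1 / b_i is the
    conjugate of b_i. *)
Definition circle_energy (th : 'rV[R]_n) : R := \sum_(i < n) (cos (th ord0 i) + cos (th ord0 i)).

Local Notation ip F G := (angle_inner q F G).
Local Notation N z := (ip (calP_circle z) (calP_circle z)).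

Lemma cblip_calP_circle z : cblip (calP_circle z).
Proof. exact: cblip_calP (valP z). Qed.

Lemma blip_circle_energy : blip circle_energy.
Proof. by apply: blip_sum => i; apply: blipD; exact: blip_cos. Qed.

Lemma circle_energy_circle th : \sum_(i < n) (circle th ord0 i + (circle th ord0 i)^-1) = toC (circle_energy th).
Proof.
rewrite /toC rmorph_sum; apply: eq_bigr => i _; rewrite circleV circleE.
by apply/eqP; rewrite eq_complex /= subrr !eqxx.
Qed.

Lemma circle_energy_bound th : `|circle_energy th| <= 2 * n%:R.
Proof.
apply: le_trans (ler_norm_sum _ _ _) _.
apply: (@le_trans _ _ (\sum_(i < n) 2)); last by rewrite sumr_const card_ord mulr_natr.
by apply: ler_sum => i _; have := cos_max (th ord0 i); have := ler_normD (cos (th ord0 i)) (cos (th ord0 i)); lra.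
Qed.

Lemma toC_neq0 : toC q != 0.
Proof. by rewrite /toC fmorph_eq0 lt01_neq0. Qed.

Lemma toC_nroot k : 1 - toC q ^+ k.+1 != 0.
Proof.
rewrite toCX -[1]/(toC 1) -rmorphB fmorph_eq0; exact: lt01_nroot.
Qed.

Lemma Pieri_circle z th :
  toC (circle_energy th) * calP_circle z th = \sum_(w <- nbrs z) toC (f_rate q (val z) (val w)) * calP_circle w th.
Proof.
have := @qtoda_nbrs C (real_complex R) (fun v => calP (toC q) v (circle th)) z => /= <-.
rewrite (Pieri toC_neq0 toC_nroot); [|exact: circle_neq0|exact: (valP z)].
by rewrite circle_energy_circle.
Qed.

Lemma calP_circle_origin : calP_circle (origin n) = (fun=> 1).
Proof. by apply/funext => th; rewrite /calP_circle (calP0 toC_neq0 toC_nroot)//; exact: circle_neq0. Qed.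

(** On the torus calP equals the orthogonal polynomial given by hypothesis (C). *)
Lemma calP_circle_orthogonal z w : z != w -> ip (calP_circle z) (calP_circle w) = 0.
Proof.
move=> zw; have [c [_ orth] cE] := hC n_gt0.
have zw' : val z <> val w by move=> /val_inj E; rewrite E eqxx in zw.
have triE y : calP_circle y = (fun th => triangular c q (val y) (circle th)).
  by apply/funext => th; rewrite /calP_circle cE//; [exact: valP|exact: circle_neq0].
by rewrite (triE z) (triE w) -innerE// orth//; exact: valP.
Qed.

(** By orthogonality only the term w of the Pieri rule for z survives. *)
Lemma ip_Pieri_l z w : w \in nbrs z ->
  ip (fun th => toC (circle_energy th) * calP_circle z th) (calP_circle w) = toC (f_rate q (val z) (val w)) * N w.
Proof.
move=> zw; under eq_fun do rewrite Pieri_circle.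
rewrite angle_inner_suml//; [|by move=> i; exact: cblip_calP_circle|exact: cblip_calP_circle].
rewrite (bigD1_seq w) ?nbrs_uniq//= big1 ?addr0// => v vw.
by rewrite calP_circle_orthogonal// mulr0.
Qed.

Lemma ip_Pieri_r z w : z \in nbrs w ->
  ip (calP_circle z) (fun th => toC (circle_energy th) * calP_circle w th) = toC (f_rate q (val w) (val z)) * N z.
Proof.
move=> zw; under eq_fun do rewrite Pieri_circle.
rewrite angle_inner_sumr//; [|by move=> i; exact: cblip_calP_circle|exact: cblip_calP_circle].
rewrite (bigD1_seq z) ?nbrs_uniq//= big1 ?addr0// => v vw.
by rewrite calP_circle_orthogonal ?mulr0// eq_sym.
Qed.

(** Take the last nonzero coordinate of z. *)
Lemma down_step (z : cone n) : z != origin n ->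
  exists2 i : 'I_n, 0 < part (val z) i & part (val z) i.+1 = 0.
Proof.
move=> z0; have d := elimT (dominantP _) (valP z).
have ex0 : exists k, part (val z) k == 0 by exists n; rewrite part_ge.
case: (ex_minnP ex0) => -[|k] /eqP k0 kmin.
  have all0 j : part (val z) j = 0.
    apply/eqP; rewrite eq_le (dominant_part_ge0 _ (valP z)) andbT -k0.
    by elim: j => // j IH; apply: le_trans (d j) IH.
  case/eqP: z0; apply/val_inj/rowP => j.
  by rewrite -part_ord all0 mxE.
have kn : (k < n)%N by apply: kmin; rewrite part_ge.
exists (Ordinal kn) => //=; rewrite lt_neqAle (dominant_part_ge0 _ (valP z)) andbT eq_sym.
by apply/eqP => /eqP/kmin; rewrite ltnn.
Qed.

(** Induction on the size of z.  Let w be z lowered at its last nonzero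
    coordinate.  Both ways of moving E across the inner product of calP_w and
    calP_z give f(w, z) N_z = f(z, w) N_w, and f(z, w) is nonzero. *)
Lemma norm_calP_circle_neq0 z : N z != 0.
Proof.
have [m zm] := ubnP `|wsize (val z)|%N; elim: m z zm => [//|m IH] z zm.
have [->|z0] := eqVneq z (origin n); first by rewrite calP_circle_origin angle_inner1_neq0.
have [i zi zi1] := down_step z0.
have fz : down_rate q (part (val z)) i != 0.
  rewrite /down_rate zi1 subr0; case: (part (val z) i) zi => [[|k]|]// _.
  exact: lt01_nroot.
have dw : dominant (val z - unit_vec i).
  by apply: contraNT fz => nd; rewrite (down_rate_eq0 _ (valP z) nd).
pose w : cone n := exist _ (val z - unit_vec i) dw.
have wz : w \in nbrs z.
  by rewrite mem_nbrs mem_cat; apply/orP; right; apply: map_f; rewrite mem_enum.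
have zw : z \in nbrs w.
  rewrite mem_nbrs mem_cat; apply/orP; left; rewrite -[val z](subrK (unit_vec i)).
  by apply: (map_f (fun i => val w + unit_vec i)); rewrite mem_enum.
have size_ge : part (val z) i <= wsize (val z).
  rewrite /wsize (bigD1 i)//= -part_ord lerDl sumr_ge0// => j _.
  by rewrite -part_ord (dominant_part_ge0 _ (valP z)).
have Nw : N w != 0.
  apply: IH; rewrite /w /= wsizeD wsizeN wsize_unit.
  by move: size_ge zi zm; move: (part _ _) (wsize _) => x y; lia.
have := ip_Pieri_l zw; rewrite angle_inner_real_sym ip_Pieri_r//.
rewrite [f_rate q (val z) (val w)]f_rate_down => E.
have : toC (down_rate q (part (val z)) i) * N w != 0 by rewrite mulf_neq0// /toC fmorph_eq0.
by rewrite E mulf_eq0 negb_or => /andP[].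
Qed.

(** Iterated Pieri rule, followed by orthogonality. *)
Lemma energy_moments k x z :
  ip (fun th => toC (circle_energy th ^+ k) * calP_circle x th) (calP_circle z) = toC (pieri_jumps k x z) * N z.
Proof.
elim: k x => [|k IH] x.
  under eq_fun do rewrite expr0 [toC 1](_ : _ = 1)// mul1r.
  rewrite /pieri_jumps /=; case: eqP => [->|/eqP xz]; first by rewrite [toC _](_ : _ = 1)// mul1r.
  by rewrite calP_circle_orthogonal// [toC _](_ : _ = 0)// mul0r.
have -> : (fun th => toC (circle_energy th ^+ k.+1) * calP_circle x th)
  = (fun th => \sum_(w <- nbrs x) toC (f_rate q (val x) (val w)) * (toC (circle_energy th ^+ k) * calP_circle w th)).
  apply/funext => th; rewrite exprSr /toC rmorphM -mulrA -/(toC _) -/(toC (circle_energy th)).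
  by rewrite Pieri_circle mulr_sumr; apply: eq_bigr => w _; rewrite mulrCA.
rewrite angle_inner_suml//; last first.
  exact: cblip_calP_circle.
  move=> w; apply: cblipM; last exact: cblip_calP_circle.
  under eq_fun do rewrite -toCX.
  by apply: cblipX; apply: cblip_real; exact: blip_circle_energy.
rewrite /pieri_jumps /= /toC rmorph_sum mulr_suml; apply: eq_bigr => w _.
by rewrite IH rmorphM mulrA.
Qed.

Lemma angle_inner_exp_partial t k z :
  ip (fun th => toC (exp_partial k (t * circle_energy th))) (calP_circle z)
  = toC (egf_partial (fun j => pieri_jumps j (origin n) z) k t) * N z.
Proof.
have -> : (fun th => toC (exp_partial k (t * circle_energy th)))
  = (fun th => \sum_(j < k) toC (t ^+ j / j`!%:R) * (toC (circle_energy th ^+ j) * calP_circle (origin n) th)).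
  apply/funext => th; rewrite /toC rmorph_sum; apply: eq_bigr => j _.
  by rewrite calP_circle_origin mulr1 -rmorphM; congr (_ %:C)%C; rewrite exprMn mulrAC.
rewrite angle_inner_suml//; last first.
  exact: cblip_calP_circle.
  move=> j; apply: cblipM; last exact: cblip_calP_circle.
  under eq_fun do rewrite -toCX.
  by apply: cblipX; apply: cblip_real; exact: blip_circle_energy.
rewrite /egf_partial [toC (\sum_(j < k) _)]rmorph_sum mulr_suml; apply: eq_bigr => j _.
by rewrite energy_moments mulrA -rmorphM.
Qed.

(** The exponential is Lipschitz on the bounded range of the energy. *)
Lemma blip_expR (c : R) : blip (fun th => expR (c * circle_energy th)).
Proof.
have [K [K0 Kb Kl]] := blipZ c blip_circle_energy.
exists (expR K * (1 + K)); split.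
- by rewrite mulr_ge0 ?expR_ge0 ?addr_ge0.
- move=> u; rewrite ger0_norm ?expR_ge0//; apply: (@le_trans _ _ (expR K)).
    by rewrite ler_expR; apply: le_trans (ler_norm _) (Kb u).
  by rewrite ler_peMr ?expR_ge0// lerDl.
- move=> u v d d0 uv.
  have half (x y : R) : `|x| <= K -> expR x - expR y <= expR K * `|x - y|.
    move=> xK; have -> : expR y = expR x * expR (y - x) by rewrite -expRD addrC subrK.
    apply: (@le_trans _ _ (expR x * (x - y))).
      rewrite -[X in X - _]mulr1 -mulrBr ler_wpM2l ?expR_ge0//.
      by have := expR_ge1Dx (y - x); lra.
    apply: (@le_trans _ _ (expR x * `|x - y|)).
      by rewrite ler_wpM2l ?expR_ge0// ler_norm.
    by rewrite ler_wpM2r// ler_expR; apply: le_trans (ler_norm _) xK.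
  apply: (@le_trans _ _ (expR K * `|c * circle_energy u - c * circle_energy v|)).
    rewrite ler_norml; apply/andP; split.
      by rewrite lerNl opprB distrC; exact: half.
    exact: half.
  rewrite -mulrA ler_wpM2l ?expR_ge0//; apply: le_trans (Kl u v d d0 uv) _.
  by rewrite ler_wpM2r// lerDr.
Qed.

Lemma blip_exp_partial (c : R) k : blip (fun th => exp_partial k (c * circle_energy th)).
Proof.
have bX j : blip (fun th => (c * circle_energy th) ^+ j).
  elim: j => [|j IH]; first by under eq_fun do rewrite expr0; exact: blip_cst.
  under eq_fun do rewrite exprS; apply: blipM => //.
  exact: blipZ blip_circle_energy.
by apply: blip_sum => j; apply: blipM; [exact: bX|exact: blip_cst].
Qed.

(** The truncations of the exponential converge uniformly on the torus, so the
    inner product is the limit of those computed in [angle_inner_exp_partial]. *)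
Lemma angle_inner_exp t z l : 0 <= t ->
  egf_partial (fun j => pieri_jumps j (origin n) z) k t @[k --> \oo] --> l ->
  ip (fun th => toC (expR (t * circle_energy th))) (calP_circle z) = toC l * N z.
Proof.
move=> t0 cl; set A := ip _ _.
have [K K0 KB] := angle_inner_bound q0 q1 (cblip_calP_circle z).
pose y := t * (2 * n%:R); pose M := ComplexField.Normc.normc (N z).
have tE th : `|t * circle_energy th| <= y by rewrite normrM ger0_norm// ler_wpM2l// circle_energy_bound.
suff : ComplexField.Normc.normc (A - toC l * N z) <= 0.
  move=> h; have /ComplexField.Normc.eq0_normc/eqP : ComplexField.Normc.normc (A - toC l * N z) = 0.
    by apply/eqP; rewrite eq_le h normc_ge0.
  by rewrite subr_eq0 => /eqP.
pose u k := egf_partial (fun j => pieri_jumps j (origin n) z) k t.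
(* Both the uniform error of the truncation and the error on its inner product
   tend to 0. *)
pose B k := K * (expR y - exp_partial k y) + `|u k - l| * M.
have cB : B k @[k --> \oo] --> K * (expR y - expR y) + `|l - l| * M.
  apply: cvgD.
    apply: cvgM; first exact: cvg_cst.
    by apply: cvgB; [exact: cvg_cst|exact: exp_partial_cvg].
  apply: cvgM; last exact: cvg_cst.
  by apply: cvg_norm; apply: cvgB => //; exact: cvg_cst.
rewrite !subrr mulr0 normr0 mul0r addr0 in cB.
have c0 : (fun _ : nat => ComplexField.Normc.normc (A - toC l * N z)) @ \oo
   --> ComplexField.Normc.normc (A - toC l * N z) by exact: cvg_cst.
apply: (ler_cvg_to c0 cB); apply: nearW => k.
have -> : A - toC l * N z = (A - toC (u k) * N z) + toC (u k - l) * N z.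
  by rewrite /toC rmorphB; ring.
apply: le_trans (normc_triangle _ _) _; apply: lerD; last first.
  by rewrite ComplexField.Normc.normcM normc_toC.
rewrite -angle_inner_exp_partial.
have -> : A - ip (fun th => toC (exp_partial k (t * circle_energy th))) (calP_circle z)
   = ip (fun th => toC (expR (t * circle_energy th) - exp_partial k (t * circle_energy th))) (calP_circle z).
  have -> : (fun th => toC (expR (t * circle_energy th) - exp_partial k (t * circle_energy th)))
    = (fun th => \sum_(b <- [:: true; false]) toC (if b then 1 else -1)
        * toC (if b then expR (t * circle_energy th) else exp_partial k (t * circle_energy th))).
    apply/funext => th; rewrite big_cons big_seq1 /= /toC -!rmorphM -rmorphD.
    by congr (_ %:C)%C; rewrite mul1r mulN1r.
  rewrite angle_inner_suml//; last first.
    exact: cblip_calP_circle.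
    by case; apply: cblip_real; [exact: blip_expR|exact: blip_exp_partial].
  by rewrite big_cons big_seq1 /= /toC rmorphN rmorph1 mul1r mulN1r.
apply: KB; first by apply: blipB; [exact: blip_expR|exact: blip_exp_partial].
by move=> th; exact: exp_partial_remainder.
Qed.

End Spectral.

End Neighbours.

(** * The law of the process at a fixed time *)

Section OneTimeLaw.
Variables (R : realType) (S : countType) (d : measure_display) (T : measurableType d).
Variables (P : probability T R) (Q : S -> S -> R) (x0 : S) (Z : R -> T -> S).

(** The defining property of the process is used for the two times 0 and t; the
    initial event has probability one and can be dropped from intersections. *)
Lemma one_time_law : markov_process P Q x0 Z ->
  exists p : R -> S -> S -> R, [/\ transition_function p, has_rates p Q
    & forall t z, 0 <= t -> P [set w | Z t w = z] = (p t x0 z)%:E].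
Proof.
move=> [mZ Z0 [p [p_trans p_rates p_law]]]; exists p; split=> // t z t0.
pose A := [set w | Z 0 w = x0]; pose B := [set w | Z t w = z].
have mA : measurable A by exact: mZ.
have mB : measurable B by exact: mZ.
have BA : P (B `\` A) = 0%E.
  apply/eqP; rewrite eq_le measure_ge0 andbT.
  have <- : P (~` A) = 0%E by rewrite probability_setC// Z0 subee.
  by apply: le_measure; rewrite ?inE; [exact: measurableD|exact: measurableC|move=> w []].
have AB : P B = P (A `&` B).
  have -> : P B = (P (B `\` A) + P (B `&` A))%E := measureDI P mB mA.
  by rewrite BA add0e setIC.
have := p_law 0%N (fun i => if i is 0%N then 0 else t) (fun i => if i is 0%N then x0 else z).
move=> /(_ (lexx _)) /(_ ltac:(by case)); rewrite subr0.
have -> : [set w | forall i, (i <= 1)%N -> Z (if i is 0%N then 0 else t) w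
    = (if i is 0%N then x0 else z)] = A `&` B.
  apply/seteqP; split=> w /=; first by move=> h; split; [exact: (h 0%N)|exact: (h 1%N)].
  by move=> [hA hB] [|[|i]].
have -> : [set w | forall i, (i <= 0)%N -> Z (if i is 0%N then 0 else t) w
    = (if i is 0%N then x0 else z)] = A.
  apply/seteqP; split=> w /=; first by move=> h; exact: (h 0%N).
  by move=> hA [|i].
by rewrite -AB Z0 mul1e.
Qed.

End OneTimeLaw.

Theorem proposition6p0p2 (R : realType) (n : nat) (hn : (1 <= n)%N)
    (q : R) (hq0 : 0 < q) (hq1 : q < 1)
    (a : 'rV[R]_n) (ha : forall i : 'I_n, 0 < a ord0 i)
    (d : measure_display) (T : measurableType d) (P : probability T R)
    (Z : R -> T -> cone n)
    (hZ : markov_process P (rate q a) (origin n) Z)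
    (hC : hypothesisC q) :
  forall (t : R), 0 <= t -> forall z : cone n,
    toC (fine (P [set w | Z t w = z])) = law_pt q a t z.
Proof.
move=> t t0 z; have [p [p_trans p_rates p_law]] := one_time_law hZ.
rewrite p_law//=.
set E := \sum_(i < n) (a ord0 i + (a ord0 i)^-1).
have Pn y : calP q (val (y : cone n)) a != 0 by rewrite gt_eqF// calP_val_gt0.
have P0 : calP q (val (origin n)) a = 1.
  by rewrite /= (calP0 (lt01_neq0 hq0) (lt01_nroot hq0 hq1))// => i; rewrite gt_eqF.
have c1 := @transition_exponential R (cone n) p (rate q a) E (@nbrs n) p_trans p_rates
  (@nbrs_uniq n) (@nbrs_irr n) (rate_diag q a) (@rate_ge0 R q n hq0 hq1 a ha)
  (@rate_sum R q n hq0 hq1 a ha) t (origin n) z t0.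
pose l := expR (t * E) * p t (origin n) z / calP q (val z) a.
have c2 : egf_partial (fun j => pieri_jumps q j (origin n) z) k t @[k --> \oo] --> l.
  have -> : (fun k => egf_partial (fun j => pieri_jumps q j (origin n) z) k t)
    = (fun k => egf_partial (fun j => jumps (rate q a) (@nbrs n) j (origin n) z) k t / calP q (val z) a).
    apply/funext => k; rewrite /egf_partial mulr_suml; apply: eq_bigr => j _.
    rewrite jumps_rate// P0 divr1; move: (t ^+ j / _) (Pn z) => c y0.
    by move: (calP q _ a) (pieri_jumps _ _ _ _) y0 => y f y0; field.
  by apply: cvgM => //; exact: cvg_cst.
have Nz := @norm_calP_circle_neq0 R q n hq0 hq1 hn hC z.
have e := @angle_inner_exp R q n hq0 hq1 hn hC t z l t0 c2.
have PiE (b : 'rV[R[i]]_n) s : \sum_(i < n) (b ord0 i + (b ord0 i)^-1) = toC s ->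
  PiF t b = toC (expR (t * s)).
  move=> bs; rewrite /PiF bs /cexp -[toC s * _]rmorphM /=.
  by rewrite cos0 sin0 [(1 +i* 0)%C](_ : _ = 1)// mulr1 mulrC.
have Qe : Qcoef q t (val z) = toC l.
  rewrite /Qcoef !innerE//.
  have -> : (fun th => PiF t (circle th)) = (fun th : 'rV[R]_n => toC (expR (t * circle_energy th))).
    by apply/funext => th; apply: PiE; exact: circle_energy_circle.
  by rewrite -/(calP_circle q z) e mulfK.
rewrite /law_pt Qe (PiE _ E); last first.
  rewrite /E /toC rmorph_sum; apply: eq_bigr => i _.
  by rewrite rmorphD fmorphV mxE.
have -> : calP (toC q) (val z) (map_mx (@toC R) a) = toC (calP q (val z) a).
  by apply: (@calP_morph R R[i] (real_complex R) q n a (val z)); [move=> i; rewrite gt_eqF|exact: valP].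
rewrite /toC -fmorphV -!rmorphM; congr (_%:C)%C; rewrite /l -/E.
have en : expR (t * E) != 0 by rewrite gt_eqF// expR_gt0.
by field; rewrite en Pn.
Qed.
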